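(* Let $\bm\lambda$ be a horizontal-strip and $\Pi=\Pi(\bm\lambda)$, with distinguished vertices $a,z$ determined by $\bm\lambda$ as described in the context. Then for every composition $\alpha$ the weighted graph $\alpha\circ\Pi$ is admissible, and if $\alpha,\beta$ are compositions with $\mathcal M(\alpha)=\mathcal M(\beta)$, then $G_{\alpha\circ\Pi}(\bm x;q)=G_{\beta\circ\Pi}(\bm x;q)$.
   Context: A row is $R=a/b=\{(1,j):b+1\le j\le a\}$ with integers $a\ge b\ge 0$; the content of $(1,j)$ is $j-1$; $l(R)=b$, $|R|$ is the number of cells, $R^+=(a+1)/(b+1)$. For rows $R,R'$: $M(R,R')=|R\cap R'|$ if $l(R)\le l(R')$, and $|R\cap R'^+|$ if $l(R)>l(R')$. A horizontal-strip is a sequence of rows $\bm\lambda=(R_1,\dots,R_n)$; $\Pi(\bm\lambda)$ is the weighted graph on vertices $R_1,\dots,R_n$ with vertex weights $|R_i|$ and, for $i<j$, an edge of weight $M(R_i,R_j)$ (zero-weight edges omitted). A weighted graph is admissible if it is isomorphic (preserving vertex and edge weights) to $\Pi(\bm\mu)$ for some horizontal-strip $\bm\mu$. The LLT polynomial of $\bm\mu$ is $G_{\bm\mu}(\bm x;q)=\sum_{\bm T}q^{\mathrm{inv}(\bm T)}\bm x^{\bm T}$ over tuples $\bm T$ of left-to-right weakly increasing fillings of the rows by positive integers, where $\mathrm{inv}$ counts pairs of entries $T^{(i)}(u),T^{(j)}(v)$, $i<j$, with either equal contents and $T^{(i)}(u)>T^{(j)}(v)$, or $c(u)=c(v)+1$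 and $T^{(i)}(u)<T^{(j)}(v)$. For admissible $\Gamma$, $G_\Gamma:=G_{\bm\mu}$ for any $\bm\mu$ with $\Pi(\bm\mu)\cong\Gamma$ (independent of the choice of $\bm\mu$). Distinguished vertices: order the cells of $\bm\lambda$ in content reading order (increasing content; among cells of equal content, increasing row index, $R_1$ being the bottom row). $a$ is the vertex (row) containing the first cell and $z$ the row containing the last cell. For weighted graphs $G,H$ with distinguished vertices $(a_G,z_G)$, $(a_H,z_H)$: the concatenation $G\cdot H$ is the disjoint union of $G$ and $H$ with an added edge of weight $1$ joining $z_G$ and $a_H$; the near-concatenation $G\odot H$ is $G\cdot H$ with that edge contracted (the two endpoints merged into one vertex whose weight is the sum of their weights, all other edges kept). In both, the distinguished vertices are $a_G$ and $z_H$ (read as the merged vertex where applicable). $G^{\odot k}$ is the $k$-fold near-concatenation $G\odot\cdots\odot G$. For a composition $\alpha=\alpha_1\cdots\alpha_n$ (finite sequence of positive integers), $\alpha\circ G=G^{\odot\alpha_1}\cdot G^{\odot\alpha_2}\cdots G^{\odot\alpha_n}$. A coarsening of $\alpha$ is a composition obtained by summing (possibly no) groups of adjacent parts; $\mathcal M(\alpha)$ is the multiset of partitions obtained by sorting the parts of each coarsening of $\alpha$ decreasingly. *)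

(* Defs.v *)
From mathcomp Require Import all_boot ssralg ssrint poly.
From mathcomp Require Import finmap multiset.

Set Implicit Arguments.
Unset Strict Implicit.
Unset Printing Implicit Defensive.

(* The row a/b = {(1, j) : b + 1 <= j <= a}. Empty rows (a = b) are allowed. *)
Record hrow := HRow { hi : nat; lo : nat; lo_le_hi : lo <= hi }.

Definition columns (R : hrow) : seq nat := iota (lo R).+1 (hi R - lo R).

Definition rsize (R : hrow) : nat := size (columns R).

Definition rplus (R : hrow) : hrow := @HRow (hi R).+1 (lo R).+1 (lo_le_hi R).

Definition rcap (R R' : hrow) : nat :=
  size [seq j <- columns R | j \in columns R'].

Definition rowM (R R' : hrow) : nat :=
  if lo R <= lo R' then rcap R R' else rcap R (rplus R').

Definition strip := seq hrow.

Definition nrow (lam : strip) (i : 'I_(size lam)) : hrow :=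
  tnth (in_tuple lam) i.

(* A cell is a pair (i, p) of a row index i and a position p from the left in
   the i-th row; it lies in column lo + p + 1, so it has content lo + p. *)
Definition cell (lam : strip) : finType :=
  {i : 'I_(size lam) & 'I_(rsize (nrow i))}.

Definition cellrow (lam : strip) (u : cell lam) : 'I_(size lam) := tag u.

Definition content (lam : strip) (u : cell lam) : nat :=
  lo (nrow (tag u)) + tagged u.

(* content reading order, in its reflexive form *)
Definition reading_le (lam : strip) (u v : cell lam) : bool :=
  (content u < content v) ||
  ((content u == content v) && (cellrow u <= cellrow v)).

Definition is_first_row (lam : strip) (a : 'I_(size lam)) : bool :=
  [exists u : cell lam, (cellrow u == a) && [forall v, reading_le u v]].

Definition is_last_row (lam : strip) (z : 'I_(size lam)) : bool :=
  [exists u : cell lam, (cellrow u == z) && [forall v, reading_le v u]].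

(* An edge weight 0 means that there is no edge. *)
Record wgraph := WGraph {
  vert :> finType;
  vwt : vert -> nat;
  ewt : vert -> vert -> nat;
  ewt_sym : forall u v, ewt u v = ewt v u;
  ewt_irr : forall u, ewt u u = 0
}.

Definition wg_iso (G H : wgraph) : Prop :=
  exists f : G -> H,
    [/\ bijective f, forall u, vwt (f u) = vwt u
      & forall u v, ewt (f u) (f v) = ewt u v].

Section Pi.
Variable lam : strip.

Definition Pi_ewt (i j : 'I_(size lam)) : nat :=
  if i < j then rowM (nrow i) (nrow j)
  else if j < i then rowM (nrow j) (nrow i)
  else 0.

Lemma Pi_ewt_sym i j : Pi_ewt i j = Pi_ewt j i.
Proof. by rewrite /Pi_ewt; case: ltngtP. Qed.

Lemma Pi_ewt_irr i : Pi_ewt i i = 0.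
Proof. by rewrite /Pi_ewt ltnn. Qed.

Definition Pi : wgraph :=
  @WGraph 'I_(size lam) (fun i => rsize (nrow i)) Pi_ewt Pi_ewt_sym Pi_ewt_irr.

End Pi.

Definition admissible (G : wgraph) : Prop := exists mu : strip, wg_iso (Pi mu) G.

Definition empty_wgraph : wgraph :=
  @WGraph void (fun _ => 0) (fun _ _ => 0) (fun _ _ => erefl) (fun _ => erefl).

(* Contraction of the edge xy, for x != y. The vertex x plays the role of the
   merged one, and cproj is the map from the old vertices to the new ones. *)
Section Contraction.
Variables (G : wgraph) (x y : G) (xy : x != y).

Definition cvert : finType := {v : G | v != y}.

Definition cmerged : cvert := Sub x xy.

Definition cproj (v : G) : cvert := insubd cmerged v.

Definition cvwt (u : cvert) : nat :=
  if val u == x then vwt x + vwt y else vwt (val u).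

Definition cewt (u v : cvert) : nat :=
  if u == v then 0
  else ewt (val u) (val v) + (if val u == x then ewt y (val v) else 0)
                           + (if val v == x then ewt (val u) y else 0).

Lemma cewt_sym u v : cewt u v = cewt v u.
Proof.
rewrite /cewt eq_sym [ewt (val v) (val u)]ewt_sym addnAC.
by rewrite [ewt (val v) y]ewt_sym [ewt y (val u)]ewt_sym.
Qed.

Lemma cewt_irr u : cewt u u = 0.
Proof. by rewrite /cewt eqxx. Qed.

Definition contract : wgraph := @WGraph cvert cvwt cewt cewt_sym cewt_irr.

End Contraction.

Record dgraph := DGraph { dg :> wgraph; da : dg; dz : dg }.

Section Concatenation.
Variables G H : dgraph.

Definition concat_vwt (u : G + H) : nat :=
  match u with inl g => vwt g | inr h => vwt h end.

Definition concat_ewt (u v : G + H) : nat :=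
  match u, v with
  | inl g, inl g' => ewt g g'
  | inr h, inr h' => ewt h h'
  | inl g, inr h | inr h, inl g => (g == dz G) && (h == da H)
  end.

Lemma concat_ewt_sym u v : concat_ewt u v = concat_ewt v u.
Proof. by case: u v => [g|h] [g'|h'] //=; apply: ewt_sym. Qed.

Lemma concat_ewt_irr u : concat_ewt u u = 0.
Proof. by case: u => [g|h] /=; apply: ewt_irr. Qed.

Definition concat_wgraph : wgraph :=
  @WGraph (G + H)%type concat_vwt concat_ewt concat_ewt_sym concat_ewt_irr.

Definition concat : dgraph :=
  @DGraph concat_wgraph (inl (da G)) (inr (dz H)).

Definition near_concat : dgraph :=
  let x : concat_wgraph := inl (dz G) in
  let y : concat_wgraph := inr (da H) in
  let xy : x != y := isT in
  @DGraph (contract x y) (cproj xy (inl (da G))) (cproj xy (inr (dz H))).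

End Concatenation.

(* the k-fold near-concatenation, for k > 0 *)
Definition near_pow (G : dgraph) (k : nat) : dgraph :=
  iter k.-1 (fun H => near_concat H G) G.

Definition is_composition (alpha : seq nat) : bool :=
  all (fun k => 0 < k) alpha.

(* alpha o G; for the empty composition this is the graph without vertices *)
Definition comp_graph (alpha : seq nat) (G : dgraph) : wgraph :=
  if alpha is k :: alpha' then
    foldl (fun H k' => concat H (near_pow G k')) (near_pow G k) alpha'
  else empty_wgraph.

(* Either the first part is kept apart from the second one, or they lie in the
   same group. *)
Fixpoint coarsenings (alpha : seq nat) : seq (seq nat) :=
  match alpha with
  | [::] => [:: [::]]
  | [:: k] => [:: [:: k]]
  | k :: alpha' =>
      [seq k :: beta | beta <- coarsenings alpha'] ++
      [seq (k + head 0 beta) :: behead beta | beta <- coarsenings alpha']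
  end.

Lemma coarseningsP (alpha beta : seq nat) :
  beta \in coarsenings alpha <->
  exists ss : seq (seq nat),
    [/\ all (fun s => s != [::]) ss, flatten ss = alpha & beta = map sumn ss].
Proof.
split.
- elim: alpha beta => [|k al IH] be /=; first by rewrite inE => /eqP->; exists [::].
  case: al IH => [|l al] IH.
    by rewrite inE => /eqP->; exists [:: [:: k]]; rewrite /= addn0.
  rewrite mem_cat => /orP[] /mapP[b /IH[ss [h1 h2 ->]] ->].
    by exists ([:: k] :: ss); rewrite /= h2 addn0 h1.
  case: ss h1 h2 => [|s ss] //= /andP[h0 h1] h2.
  by exists ((k :: s) :: ss); rewrite /= h1 h2.
- move=> [ss [h1 <- ->]] {alpha beta}.
  elim: ss h1 => [|s ss IH] //= /andP[hs h1]; have {}IH := IH h1.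
  elim: s hs => [|k s IHs] //= _.
  case: s IHs => [|l s] /= IHs.
    clear IHs; rewrite addn0; case E: (flatten ss) IH => [|x y] IH.
      by case: ss h1 E {IH} => [|[]] //= _ _; rewrite inE.
    by rewrite mem_cat map_f.
  rewrite mem_cat; apply/orP; right; apply/mapP.
  by eexists; first exact: IHs.
Qed.

Lemma coarsenings_uniq (alpha : seq nat) :
  is_composition alpha -> uniq (coarsenings alpha).
Proof.
have pos (l : nat) al b : is_composition (l :: al) ->
    b \in coarsenings (l :: al) -> 0 < head 0 b.
  move=> /andP[l0 _] /coarseningsP[] [|[|x s] ss] [] // _ [-> _] -> /=.
  by rewrite addn_gt0 l0.
elim: alpha => [|k [|l al] IH] // /andP[_ hal].
rewrite [coarsenings _]/= -/(coarsenings (l :: al)) cat_uniq.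
apply/and3P; split.
- by rewrite map_inj_uniq ?IH // => ? ? [].
- apply/hasPn => _ /mapP[b hb ->]; apply/mapP => -[c _ [+ _]].
  by move/eqP; rewrite -[X in _ == X]addn0 eqn_add2l; case: head (pos _ _ _ hal hb).
- rewrite map_inj_in_uniq ?IH // => b c /(pos _ _ _ hal) hb /(pos _ _ _ hal) hc.
  by case: b c hb hc => [|x b] [|y c] //= _ _ [/addnI -> ->].
Qed.

Definition cM (alpha : seq nat) : {mset (seq nat)}%mset :=
  seq_mset [seq sort geq beta | beta <- coarsenings alpha].

(* A power series in x_1, x_2, ... over Z[q] is given by its coefficients. The
   monomial m stands for the product of the x_k ^ (m k); q is 'X. *)
Definition monomial := {fsfun nat -> nat with 0}.

Section LLT.
Variable lam : strip.

(* fillings whose entries are indices of variables occurring in m *)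
Definition filling (m : monomial) : finType :=
  {ffun cell lam -> finsupp m}.

Variables (m : monomial) (T : filling m).

Definition entry (u : cell lam) : nat := val (T u).

Definition row_increasing : bool :=
  [forall u, 0 < entry u] &&
  [forall u, forall v,
     (cellrow u == cellrow v) && (content u <= content v) ==>
       (entry u <= entry v)].

Definition has_weight : bool :=
  [forall k : finsupp m, #|[set u | entry u == val k]| == m (val k)].

Definition is_inv (u v : cell lam) : bool :=
  (cellrow u < cellrow v) &&
  ((content u == content v) && (entry v < entry u) ||
   (content u == (content v).+1) && (entry u < entry v)).

Definition inv : nat := #|[set p : cell lam * cell lam | is_inv p.1 p.2]|.

End LLT.

Definition LLT (lam : strip) (m : monomial) : {poly int} :=
  (\sum_(T : filling lam m | row_increasing T && has_weight T)
     'X^(inv T))%R.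

(* Main.v *)
(* A horizontal-strip is encoded by the lengths r_i of its rows and the integers
   f_ij = floor(p_j - p_i), where the p_i are real starting points of the rows,
   pairwise different modulo 1: this is an alcove of the affine arrangement of
   type A. Moving one row across an integer distance of another one either keeps
   the LLT polynomial or gives G = q G' + (1 - q) G'', where G' belongs to the
   other side of the wall, and where in G'' two overlapping rows are replaced by
   their union and their intersection.

   Alcoves with equal weights have equal polynomials, by induction on the sum of
   the r_i^2, which increases from G to G'', then on the weights. With the
   induction hypothesis, a set T of rows can be reflected in place if each other
   row avoids T or contains it. Such reflections connect any two alcoves f, g
   with equal weights: non-nested pairs of rows have the same order in f and g
   (kept) or not (flipped), and there are no triangles with a flipped, a kept and
   an overlapping side; hence, by Gallai's theorem on 3-coloured complete graphs,
   some proper subset of the rows can be handled first, up to reflecting all rows.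

   The recursion at the wall between the last row of X and the first row of Y
   reads G_{X.Y} = q G_X G_Y + (1 - q) G_{X (.) Y}. So G_{alpha o P} is the sum of
   q^(l(beta)-1) (1-q)^(l(alpha)-l(beta)) prod_i G_{P^(.)beta_i} over the
   coarsenings beta of alpha, and it depends on M(alpha) only. *)
Require Import Defs.
From mathcomp Require Import finmap multiset.
From mathcomp Require Import all_boot all_order ssralg ssrint ssrnum intdiv poly perm.
From mathcomp Require Import zify ring.

Set Implicit Arguments.
Unset Strict Implicit.
Unset Printing Implicit Defensive.

Import Order.TTheory GRing.Theory Num.Theory.

(** * Connected colour classes *)

(** The wall-crossing formula is proved one letter at a time. Adding the largest letter is a linear
    operator on functions of the row lengths, and so is the passage through a wall; the two commute
    up to a change of alcove, which reduces the formula to an identity between powers of [q] for two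
    rows. Hence polynomials are computed as iterated sums over the lengths filled so far, in
    finitely many variables over an integral domain, where [q != 0] can be cancelled. The
    intersection produced by a contraction may be empty. It is kept as a row of length 0, so that
    the index set of the rows stays fixed, and graphs are compared by maps that miss only vertices
    of weight 0. An alcove and its reflection are in general not joined by walls that preserve all
    weights. Both are led to a wall where the same weight grows by one. These walls are crossed in
    opposite directions, but the contracted configurations agree in weights after exchanging the two
    rows, and there the induction applies. *)

Section Connectivity.
Variable I : finType.
Implicit Types (e : rel I) (X Q : {set I}).

(** Connectedness by cuts rather than paths: the arguments below take the set of offending vertices
    as [Q] and look at an edge that leaves it. *)
Definition connected e X : bool :=
  [forall Q : {set I}, (Q \subset X) && (Q != set0) && (Q != X) ==>
    [exists a in Q, exists b in X :\: Q, e a b]].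

Lemma connectedP e X Q : connected e X -> Q \subset X -> Q != set0 -> Q != X ->
  exists a b, [/\ a \in Q, b \in X, b \notin Q & e a b].
Proof.
move=> /forallP/(_ Q)/implyP H QX Q0 QnX.
have /exists_inP[a aQ /exists_inP[b]] := H (introT andP (conj (introT andP (conj QX Q0)) QnX)).
by rewrite inE => /andP[bQ bX] eab; exists a, b.
Qed.

Definition component e X x : {set I} :=
  [set y in X | connect [rel a b | [&& a \in X, b \in X & e a b]] x y].

Lemma component_sub e X x : component e X x \subset X.
Proof. by apply/subsetP => y; rewrite inE => /andP[]. Qed.

Lemma component_refl e X x : x \in X -> x \in component e X x.
Proof. by move=> xX; rewrite inE xX connect0. Qed.

Lemma component_step e X x y z :
  y \in component e X x -> z \in X -> e y z -> z \in component e X x.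
Proof.
rewrite !inE => /andP[yX xy] zX yz; rewrite zX /=.
by apply: connect_trans xy (connect1 _); rewrite /= yX zX.
Qed.

Lemma component_ind e X x (A : {set I}) : symmetric e -> x \in A ->
    (forall y z, y \in A -> y \in component e X x -> z \in component e X x -> e y z ->
       z \in A) ->
  component e X x \subset A.
Proof.
move=> e_sym xA step; apply/subsetP => y.
case: (boolP (x \in X)) => xX; last first.
  rewrite inE => /andP[yX /connectP[[|z p] /= + ey]]; first by rewrite ey.
  by rewrite (negPf xX).
move=> yC; pose B := A :&: component e X x.
have cB : closed [rel a b | [&& a \in X, b \in X & e a b]] (mem B).
  have half a b : [&& a \in X, b \in X & e a b] -> a \in B -> b \in B.
    case/and3P=> aX bX ab; rewrite inE => /andP[aA aC].
    have bC := component_step aC bX ab.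
    by rewrite inE bC (step a b).
  move=> a b /= ab; apply/idP/idP; first exact: half.
  by apply: half; case/and3P: ab => -> -> /=; rewrite e_sym.
have : y \in B.
  move: yC; rewrite inE => /andP[_ /(closed_connect cB) <-].
  by rewrite inE xA component_refl.
by rewrite inE => /andP[].
Qed.

Lemma component_connected e X x : symmetric e -> x \in X -> component e X x = X ->
  connected e X.
Proof.
move=> e_sym xX CX; apply/forallP => Q; apply/implyP => /andP[/andP[QX Q0] QnX].
apply: contraT => /negP none; exfalso.
have no a b : a \in Q -> b \in X -> b \notin Q -> ~~ e a b.
  move=> aQ bX bQ; apply/negP => ab; apply: none; apply/exists_inP; exists a => //.
  by apply/exists_inP; exists b; rewrite // inE bQ.
case: (boolP (x \in Q)) => xQ.
  case/negP: QnX; rewrite eqEsubset QX -CX; apply: component_ind => // y z yQ _ zC yz.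
  apply: contraLR yz => zQ; apply: no => //; exact: (subsetP (component_sub _ _ _)) zC.
have : X \subset ~: Q.
  rewrite -{1}CX; apply: component_ind; rewrite ?inE // => y z; rewrite !inE => yQ /andP[yX _] _ yz.
  by apply: contraL yz => zQ; rewrite e_sym; apply: no.
rewrite -disjoints_subset => /disjoint_setI0 XQ; case/negP: Q0.
by rewrite -XQ (setIidPr QX).
Qed.

Lemma connected_component e X x : connected e X -> x \in X -> component e X x = X.
Proof.
move=> cX xX; apply/eqP; apply: contraT => nX; exfalso.
have [|a [b [aC bX bC ab]]] := connectedP cX (component_sub e X x) _ nX.
  by apply/set0Pn; exists x; apply: component_refl.
by rewrite (component_step aC bX ab) in bC.
Qed.

Lemma component_sym e X x y : symmetric e -> x \in X -> y \in component e X x ->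
  x \in component e X y.
Proof.
move=> e_sym xX; rewrite !inE xX /= => /andP[_].
rewrite (sym_connect_sym _) // => a b /=.
by rewrite e_sym andbCA.
Qed.

Lemma eq_component e X x y : symmetric e -> x \in X -> y \in component e X x ->
  component e X y = component e X x.
Proof.
move=> e_sym xX yC; have xC := component_sym e_sym xX yC.
apply/eqP; rewrite eqEsubset !component_ind //.
  by move=> a b aC _ bC ab; apply: component_step aC _ ab; apply: subsetP bC; apply: component_sub.
by move=> a b aC _ bC ab; apply: component_step aC _ ab; apply: subsetP bC; apply: component_sub.
Qed.

Lemma connected_nbr e X x : connected e X -> x \in X -> 1 < #|X| ->
  exists2 y, y \in X & (y != x) && e x y.
Proof.
move=> cX xX X1; have [|||a [b [/set1P-> bX bx xb]]] := connectedP (Q := [set x]) cX.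
- by rewrite sub1set.
- by apply/set0Pn; exists x; rewrite inE.
- by apply: contraTneq X1 => <-; rewrite cards1.
by exists b; rewrite // xb andbT; apply: contraNneq bx => ->; rewrite inE.
Qed.

End Connectivity.

(** * Colourings without rainbow triangles *)

Section ThreeColors.
Variable I : finType.
Implicit Types (D S E : rel I) (T X Q : {set I}).

(* D and S are disjoint, their union contains the complement of E, and a pair
   closing up a D-pair and an S-pair is not in E. *)
Definition three_colored D S E T : Prop :=
  [/\ symmetric D, symmetric S, symmetric E,
      forall x y, D x y -> ~~ S x y &
      {in T &, forall x y, x != y -> ~~ E x y -> D x y || S x y} /\
      {in T & &, forall x y z, D x y -> S y z -> ~~ E x z}].

Lemma three_coloredC D S E T : three_colored D S E T -> three_colored S D E T.
Proof.
case=> Ds Ss Es dDS [cov lnk]; split=> //.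
  by move=> x y xy; apply: contraTN xy; apply: dDS.
split=> [x y xT yT xy nE|x y z xT yT zT xy yz]; first by rewrite orbC cov.
by rewrite Es; apply: (lnk z y x); rewrite // 1?Ds 1?Ss.
Qed.

Section Link.
Variables (D S E : rel I) (T : {set I}).
Hypothesis H : three_colored D S E T.

(** Otherwise [S x z], and the sides [D y x] and [S x z] would forbid [E y z]. *)
Lemma linkD x y z : x \in T -> y \in T -> z \in T -> x != z ->
  D y x -> ~~ E x z -> E y z -> D x z.
Proof.
case: H => Ds Ss Es dDS [cov lnk] xT yT zT xz yx nE yz.
case/orP: (cov x z xT zT xz nE) => // sxz.
by have := lnk y x z yT xT zT yx sxz; rewrite yz.
Qed.

Lemma component_neq (e : rel I) X x y u : symmetric e -> x \in X -> u \in X ->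
  u \notin component e X x -> y \in component e X x -> ~~ e y u /\ (y != u).
Proof.
move=> es xX uX uC yC; split.
  by apply: contra uC => yu; apply: component_step yC uX yu.
by apply: contraNneq uC => <-.
Qed.

(** No vertex of the component is [E]-related to [u], so [linkD] carries the colour [D] along its
    [E]-edges. *)
Lemma component_uniform X x u y : X \subset T -> x \in X -> u \in X ->
  u \notin component E X x -> D x u -> y \in component E X x -> D y u.
Proof.
case: (H) => Ds Ss Es dDS _ XT xX uX uC xu yC.
suff /subsetP/(_ y yC) : component E X x \subset [set c | D c u] by rewrite inE.
apply: component_ind; rewrite ?inE // => a b; rewrite inE => au aC bC ab.
have bX := subsetP (component_sub _ _ _) _ bC.
have aX := subsetP (component_sub _ _ _) _ aC.
have [nE bu] := component_neq Es xX uX uC bC.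
have [uT [aT bT]] := (subsetP XT _ uX, (subsetP XT _ aX, subsetP XT _ bX)).
by rewrite inE Ds; apply: (linkD uT aT bT _ au _ ab); rewrite 1?eq_sym // Es.
Qed.

End Link.

(** Some [E]-edge leaves the set of violating vertices. It ends at [v] or at a vertex already
    [D]-related to [d], and [linkD] then colours its start. *)
Lemma no_E_split D S E T X v d : three_colored D S E T -> X \subset T -> v \in X ->
    connected E X -> d \in X :\ v -> D v d ->
    forall u, u \in X :\ v -> u \notin component E (X :\ v) d -> D d u.
Proof.
move=> H XT vX cE dX vd; have [Ds Ss Es dDS [cov lnk]] := H.
set X' := X :\ v in dX *; set C := component E X' d.
have X'X : X' \subset X by apply: subsetDl.
have tT x : x \in X' -> x \in T by move=> xX; apply: (subsetP XT); apply: (subsetP X'X).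
have vT : v \in T by apply: (subsetP XT).
pose B := [set u in X' | (u \notin C) && ~~ D d u].
suff B0 : B = set0.
  move=> u uX uC; apply: contraT => ndu; exfalso.
  by have : u \in B by [rewrite inE uX uC ndu]; rewrite B0 inE.
apply/eqP; apply: contraT => B0; exfalso.
have [||b [c [bB cX cB bc]]] := connectedP cE _ B0.
- by apply/subsetP => x; rewrite inE => /andP[/(subsetP X'X)].
- by apply: contraTneq vX => <-; rewrite !inE eqxx.
move: bB; rewrite inE => /and3P[bX bC ndb].
have [nE db] := component_neq Es dX bX bC (component_refl E dX).
have [cv|cv] := eqVneq c v.
  by subst c; case/negP: ndb; apply: (linkD H (tT _ dX) vT (tT _ bX) db vd nE); rewrite Es.
have cX' : c \in X' by rewrite !inE cv.
case: (boolP (c \in C)) => cC.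
  by have [] := component_neq Es dX bX bC cC; rewrite Es bc.
have dc : D d c by apply: contraNT cB => ndc; rewrite inE cX' cC.
case/negP: ndb; rewrite Ds in dc.
by apply: (linkD H (tT _ dX) (tT _ cX') (tT _ bX) db dc nE); rewrite Es.
Qed.

(** If the component [C] were proper, all pairs between [C] and the rest of [X :\ v] would be in [S]
    and not in [E]. Then an [E]-edge leaving the rest and a [D]-edge leaving [C] both end at [v],
    and with an [S]-pair they form a forbidden triangle. *)
Lemma no_D_split D S E T X v k : three_colored D S E T -> X \subset T -> v \in X ->
    connected D X -> connected E X -> k \in X :\ v -> S v k ->
  component D (X :\ v) k = X :\ v.
Proof.
move=> H XT vX cD cE kX vk; have [Ds Ss Es dDS [cov lnk]] := H.
set X' := X :\ v in kX *; set C := component D X' k.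
have X'X : X' \subset X by apply: subsetDl.
have tT x : x \in X' -> x \in T by move=> xX; apply: (subsetP XT); apply: (subsetP X'X).
have vT : v \in T by apply: (subsetP XT).
have kC : k \in C by apply: component_refl.
apply/eqP; apply: contraT => CnX; exfalso.
(* not D-related and not E-related, hence S-related *)
have toS x y z : x \in T -> y \in T -> z \in T -> x != z -> ~~ D x z -> D x y -> S y z ->
    S x z && ~~ E x z.
  move=> xT yT zT xz nD xy yz; have nE := lnk x y z xT yT zT xy yz.
  by have := cov x z xT zT xz nE; rewrite (negPf nD) nE /= => ->.
pose ok c u := S c u && ~~ E c u.
have claim1 u : u \in X' -> u \notin C -> ok k u.
  move=> uX uC; apply: contraT => nku; exfalso.
  pose B := [set u in X' | (u \notin C) && ~~ ok k u].
  have [|||b [c [bB cX cB bc]]] := connectedP (Q := B) cD.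
  - by apply/subsetP => x; rewrite inE => /andP[/(subsetP X'X)].
  - by apply/set0Pn; exists u; rewrite inE uX uC.
  - by apply: contraTneq vX => <-; rewrite !inE eqxx.
  move: bB; rewrite inE => /and3P[bX bC nkb].
  have [nD kb] := component_neq Ds kX bX bC kC.
  have nD' : ~~ D b k by rewrite Ds.
  have bk : b != k by rewrite eq_sym.
  case/negP: nkb; rewrite /ok Ss Es.
  have [cv|cv] := eqVneq c v.
    by subst c; apply: (toS b v k (tT _ bX) vT (tT _ kX) bk nD' bc vk).
  have cX' : c \in X' by rewrite !inE cv.
  case: (boolP (c \in C)) => cC.
    by have [] := component_neq Ds kX bX bC cC; rewrite Ds bc.
  have : ok k c by apply: contraNT cB => nkc; rewrite inE cX' cC.
  case/andP => skc _; rewrite Ss in skc.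
  exact: (toS b c k (tT _ bX) (tT _ cX') (tT _ kX) bk nD' bc skc).
have claim2 c u : c \in C -> u \in X' -> u \notin C -> ok c u.
  move=> cC uX uC.
  suff /subsetP/(_ c cC) : C \subset [set c | ok c u] by rewrite inE.
  apply: component_ind; rewrite ?inE ?claim1 // => a b; rewrite inE => /andP[sau nau] aC bC ab.
  rewrite inE.
  have [nD bu] := component_neq Ds kX uX uC bC.
  have inX := subsetP (component_sub D X' k).
  rewrite Ds in ab.
  exact: (toS b a u (tT _ (inX _ bC)) (tT _ (inX _ aC)) (tT _ uX) bu nD ab sau).
pose Q := X' :\: C.
have [|||y [c [yQ cX cQ yc]]] := connectedP (Q := Q) cE.
- exact: subset_trans (subsetDl _ _) X'X.
- by rewrite setD_eq0; apply: contra CnX => sX; rewrite eqEsubset component_sub.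
- by apply: contraTneq vX => <-; rewrite !inE eqxx andbF.
move: yQ; rewrite inE => /andP[yC yX].
have ycv : c = v.
  apply/eqP; apply: contraT => cv; exfalso; have cX' : c \in X' by rewrite !inE cv.
  have cC : c \in C by apply: contraNT cQ => cC; rewrite inE cC.
  by have /andP[_] := claim2 c y cC yX yC; rewrite Es yc.
subst c.
have [|||x [c [xC cX' cC xc]]] := connectedP (Q := C) cD.
- exact: subset_trans (component_sub _ _ _) X'X.
- by apply/set0Pn; exists k.
- apply: contraTneq vX => e; have := component_sub D X' k; rewrite -/C e => /subsetP/(_ v).
  by move=> sv; apply/negP => /sv; rewrite !inE eqxx.
have xX := subsetP (component_sub _ _ _) _ xC.
have cv : c = v.
  apply/eqP; apply: contraT => cv; exfalso; have cX'' : c \in X' by rewrite !inE cv.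
  by rewrite /C (component_step xC cX'' xc) in cC.
subst c; have /andP[sxy _] := claim2 x y xC yX yC.
by have := lnk v x y vT (tT _ xX) (tT _ yX); rewrite Ds Es yc => /(_ xc sxy).
Qed.

(* Gallai's theorem on 3-colourings of complete graphs without rainbow
   triangles: one of the colours is disconnected. *)
Lemma three_colored_disconnected D S E T X : three_colored D S E T -> X \subset T ->
  1 < #|X| -> connected D X -> connected S X -> connected E X -> False.
Proof.
move=> H; have [Ds Ss Es dDS [cov lnk]] := H.
have [n] := ubnP #|X|; elim: n X => // n IH X; rewrite ltnS => Xn XT X1 cD cS cE.
have /set0Pn[v vX] : X != set0 by rewrite -card_gt0; apply: leq_trans X1.
have [d dX /andP[dv vd]] := connected_nbr cD vX X1.
have [s sX /andP[sv vs]] := connected_nbr cS vX X1.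
have dX' : d \in X :\ v by rewrite !inE dv.
have sX' : s \in X :\ v by rewrite !inE sv.
have X'T : X :\ v \subset T by apply: subset_trans (subsetDl _ _) XT.
have ds : d != s by apply: contraTneq vs => <-; apply: dDS.
apply: (IH (X :\ v)) => //.
- by move: Xn; rewrite (cardsD1 v X) vX add1n.
- by rewrite (cardsD1 d) dX' ltnS (cardsD1 s) in_setD1 eq_sym ds sX' add1n.
- by apply: (component_connected Ds sX'); apply: no_D_split H XT vX cD cE sX' vs.
- apply: (component_connected Ss dX').
  exact: no_D_split (three_coloredC H) XT vX cS cE dX' vd.
(* Vertices outside the [E]-component of [d] are [D]-related to [d], those outside the component of
   [s] are [S]-related to [s]. Whether or not the two components coincide, some pair receives both
   colours. *)
apply: (component_connected Es dX'); apply/eqP; rewrite eqEsubset component_sub.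
apply/subsetP => u uX; apply: contraT => uC; exfalso.
have Dd := no_E_split H XT vX cE dX' vd; have Sd := no_E_split (three_coloredC H) XT vX cE sX' vs.
case: (boolP (s \in component E (X :\ v) d)) => sC.
  have su : D s u by apply: (component_uniform H X'T dX' uX uC) => //; apply: Dd.
  by have /negP[] := dDS _ _ su; apply: Sd => //; rewrite (eq_component Es dX' sC).
have /negP[] := dDS _ _ (Dd s sX' sC); rewrite Ss; apply: Sd => //.
by apply: contra sC; apply: component_sym.
Qed.

Lemma other_component D S E T X x u : three_colored D S E T -> X \subset T -> x \in X ->
    u \in X -> u \notin component E X x -> D x u ->
    forall y, y \in X -> S x y -> u \notin component E X y /\ y \notin component E X u.
Proof.
move=> H XT xX uX uC xu y yX xy; have [Ds Ss Es dDS _] := H.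
have nyu : y \notin component E X u.
  apply/negP => yu; suff /dDS : D x y by rewrite xy.
  rewrite Ds; apply: (component_uniform H XT uX xX) => //; last by rewrite Ds.
  by apply: contra uC => xC; apply: component_sym.
by split=> //; apply: contra nyu => uy; apply: component_sym.
Qed.

(** By [component_uniform] the [E]-components are the vertices of a complete graph whose edges are
    coloured by [D] and [S]. Two complementary graphs are both connected only from four vertices on,
    so three labels cannot separate the components. *)
Lemma four_blocks D S E T X x (lab : I -> 'I_3) :
    three_colored D S E T -> X \subset T -> x \in X ->
    connected D X -> connected S X -> component E X x != X ->
    {in X &, forall a b, a \notin component E X b -> lab a != lab b} ->
  False.
Proof.
move=> H XT xX cD cS nX labP; have H' := three_coloredC H.
have [Ds Ss Es dDS [cov lnk]] := H.
have cross e c : connected e X -> symmetric e -> c \in X -> component E X c != X ->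
    (forall a b, a \in component E X c -> b \in X -> b \notin component E X c ->
       e a b -> e c b) ->
    exists2 b, b \in X & (b \notin component E X c) && e c b.
  move=> ce es cX ncX uni.
  have [|a [b [aC bX bC ab]]] := connectedP ce (component_sub E X c) _ ncX.
    by apply/set0Pn; exists c; apply: component_refl.
  by exists b; rewrite // bC (uni a b).
have uniD c a b : c \in X -> a \in component E X c -> b \in X -> b \notin component E X c ->
    D a b -> D c b.
  move=> cX aC bX bC ab; have aX := subsetP (component_sub _ _ _) _ aC.
  apply: (component_uniform H XT aX bX) => //; last exact: component_sym.
  by rewrite (eq_component Es cX aC).
have uniS c a b : c \in X -> a \in component E X c -> b \in X -> b \notin component E X c ->
    S a b -> S c b.
  move=> cX aC bX bC ab; have aX := subsetP (component_sub _ _ _) _ aC.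
  apply: (component_uniform H' XT aX bX) => //; last exact: component_sym.
  by rewrite (eq_component Es cX aC).
have nfull c : c \in X -> component E X c != X.
  move=> cX; apply: contraNneq nX => e; have xC : x \in component E X c by rewrite e.
  by rewrite (eq_component Es cX xC) e.
have [u2 u2X /andP[u21 xu2]] := cross D x cD Ds xX nX (fun a b => uniD x a b xX).
have [u3 u3X /andP[u31 xu3]] := cross S x cS Ss xX nX (fun a b => uniS x a b xX).
have [n23 n32] := other_component H XT xX u2X u21 xu2 u3X xu3.
have u23 : u2 != u3 by apply: contraNneq n23 => ->; apply: component_refl.
have nE23 : ~~ E u2 u3 by apply: contra n32 => e; apply: component_step e => //; apply: component_refl.
have [u4 u4X [n41 n42 n43]] : exists2 u4, u4 \in X &
    [/\ u4 \notin component E X x, u4 \notin component E X u2 & u4 \notin component E X u3].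
  have n12 : x \notin component E X u2 by apply: contra u21; apply: component_sym.
  have n13 : x \notin component E X u3 by apply: contra u31; apply: component_sym.
  have [d23|s23] := orP (cov u2 u3 (subsetP XT _ u2X) (subsetP XT _ u3X) u23 nE23).
    have [u4 u4X /andP[n42 u24]] :=
      cross S u2 cS Ss u2X (nfull _ u2X) (fun a b => uniS u2 a b u2X).
    exists u4 => //; split=> //.
      by have [] := other_component H XT u2X xX n12 _ u4X u24; rewrite 1?Ds.
    by have [] := other_component H XT u2X u3X n32 d23 u4X u24.
  have [u4 u4X /andP[n43 u34]] :=
    cross D u3 cD Ds u3X (nfull _ u3X) (fun a b => uniD u3 a b u3X).
  exists u4 => //; split=> //.
    by have [] := other_component H' XT u3X xX n13 _ u4X u34; rewrite 1?Ss.
  by have [] := other_component H' XT u3X u2X n23 _ u4X u34; rewrite 1?Ss.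
have : uniq [:: lab u4; lab u3; lab u2; lab x].
  by rewrite /= !inE !negb_or !labP //.
by move/card_uniqP => /= e; have := max_card (mem [:: lab u4; lab u3; lab u2; lab x]); rewrite e card_ord.
Qed.

End ThreeColors.

Local Open Scope ring_scope.

(** * Crossing inversions *)

Definition clamp (a : int) (v : nat) (x : int) : int :=
  Num.min (Num.max x a) (a + v%:Z).

(* For a <= b, the number of integers in [a, b) that lie in [c, c + v). *)
Definition overlap (a b : nat) (c : int) (v : nat) : int :=
  clamp c v b - clamp c v a.

Lemma overlap_ge0 a b c v : (a <= b)%N -> 0 <= overlap a b c v.
Proof. rewrite /overlap /clamp; lia. Qed.

Lemma overlap0l a c v : overlap a a c v = 0.
Proof. by rewrite /overlap subrr. Qed.

Lemma overlap0r a b c : overlap a b c 0 = 0.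
Proof. rewrite /overlap /clamp; lia. Qed.

Lemma clamp_shift c v x (m : int) : clamp (c - m) v x = clamp c v (x + m) - m.
Proof. rewrite /clamp; lia. Qed.

(** The same count with [[c, c + v)] cut down to [[a, b]]: a difference of contributions of its two
    ends, which [outer_swapl] exchanges between two rows. *)
Lemma overlapE a b c v : (a <= b)%N ->
  overlap a b c v = Num.min (Num.max (c + v%:Z) a%:Z) b%:Z - Num.min (Num.max c a%:Z) b%:Z.
Proof. rewrite /overlap /clamp; lia. Qed.

Section Inversions.
Variable I : finType.
Implicit Types (f : I -> I -> int) (u w r : I -> nat).

(* The number of inversions between the cells of the largest letter, which fill
   the places u i, ..., w i - 1 of row i, and the cells of the smaller letters. *)
Definition cross_inv f u w : int :=
  \sum_i \sum_(j | j != i) overlap (u i) (w i) (f i j) (u j).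

Lemma cross_inv_ge0 f u w : (forall i, u i <= w i)%N -> 0 <= cross_inv f u w.
Proof. by move=> le_uw; do 2!apply: sumr_ge0 => ? _; apply: overlap_ge0. Qed.

Lemma eq_cross_inv f f' u u' w w' :
    (forall i j, i != j -> f i j = f' i j) -> u =1 u' -> w =1 w' ->
  cross_inv f u w = cross_inv f' u' w'.
Proof.
move=> ef eu ew; apply: eq_bigr => i _; apply: eq_bigr => j ji.
by rewrite ef 1?eq_sym // !eu ew.
Qed.

Lemma sum_pairs_split (K : I -> I -> int) i j : i != j ->
  \sum_k \sum_(l | l != k) K k l =
    (K i j + K j i)
    + (\sum_(k | (k != i) && (k != j)) ((K i k + K j k) + (K k i + K k j))
    + \sum_(k | (k != i) && (k != j))
        \sum_(l | (l != k) && (l != i) && (l != j)) K k l).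
Proof.
move=> ij; have ji : j != i by rewrite eq_sym.
rewrite (bigD1 i) // (bigD1 j (P := fun k => true && (k != i))) ?ji //.
rewrite (bigD1 j (P := fun k => k != i)) ?ji // (bigD1 i (P := fun k => k != j)) //=.
have -> : \sum_(k | (k != i) && (k != j)) \sum_(l | l != k) K k l =
    \sum_(k | (k != i) && (k != j)) ((K k i + K k j) +
        \sum_(l | (l != k) && (l != i) && (l != j)) K k l).
  apply: eq_bigr => k /andP[ki kj].
  rewrite (bigD1 i) 1?eq_sym //= (bigD1 j) /= ?addrA //.
  by rewrite ji eq_sym kj.
have -> : \sum_(k | (k != j) && (k != i)) K j k =
    \sum_(k | (k != i) && (k != j)) K j k by apply: eq_bigl => k; rewrite andbC.
rewrite !big_split /=; ring.
Qed.

(** Row [j] starting [m] cells right of row [i], the two rows exchange their right ends. If row [i]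
    ends inside row [j], the results are the union and the intersection. *)
Definition swap_at i j (m : nat) u : I -> nat := fun k =>
  if k == i then (m + u j)%N else if k == j then (u i - m)%N else u k.

Lemma eq_swap_at i j m u u' : u =1 u' -> swap_at i j m u =1 swap_at i j m u'.
Proof. by move=> e k; rewrite /swap_at !e. Qed.

Definition outer i j f u w : int :=
  cross_inv f u w - overlap (u i) (w i) (f i j) (u j)
                  - overlap (u j) (w j) (f j i) (u i).

Lemma outerE i j f u w : i != j ->
  outer i j f u w =
    \sum_(k | (k != i) && (k != j))
      ((overlap (u i) (w i) (f i k) (u k) + overlap (u j) (w j) (f j k) (u k)) +
       (overlap (u k) (w k) (f k i) (u i) + overlap (u k) (w k) (f k j) (u j)))
    + \sum_(k | (k != i) && (k != j)) \sum_(l | (l != k) && (l != i) && (l != j))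
        overlap (u k) (w k) (f k l) (u l).
Proof. by move=> ij; rewrite /outer /cross_inv (sum_pairs_split _ ij); ring. Qed.

Lemma outer_ge0 i j f u w : i != j -> (forall k, u k <= w k)%N ->
  0 <= outer i j f u w.
Proof.
move=> ij le_uw; rewrite outerE //; apply: addr_ge0.
  by apply: sumr_ge0 => k _; apply: addr_ge0; apply: addr_ge0; apply: overlap_ge0.
by do 2!apply: sumr_ge0 => ? _; apply: overlap_ge0.
Qed.

Lemma outer_eq i j f f' u w : i != j ->
    (forall k l, ~~ ((k == i) && (l == j)) -> ~~ ((k == j) && (l == i)) ->
       f k l = f' k l) ->
  outer i j f u w = outer i j f' u w.
Proof.
move=> ij ef; rewrite !outerE //; congr (_ + _).
  apply: eq_bigr => k /andP[ki kj].
  by rewrite !ef ?(negPf ki) ?(negPf kj) ?andbF.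
apply: eq_bigr => k /andP[ki kj]; apply: eq_bigr => l /andP[/andP[_ li] lj].
by rewrite ef ?(negPf ki) ?(negPf kj).
Qed.

Section Swap.
Variables (i j : I) (m : nat) (f : I -> I -> int).
Hypotheses (ij : i != j)
  (fj : forall k, k != i -> k != j -> f j k = f i k - m%:Z)
  (fk : forall k, k != i -> k != j -> f k j = f k i + m%:Z).

Let swapi u : swap_at i j m u i = (m + u j)%N.
Proof. by rewrite /swap_at eqxx. Qed.
Let swapj u : swap_at i j m u j = (u i - m)%N.
Proof. by rewrite /swap_at eqxx eq_sym (negPf ij). Qed.
Let swapk u k : k != i -> k != j -> swap_at i j m u k = u k.
Proof. by rewrite /swap_at => /negPf-> /negPf->. Qed.

(** By [fj] and [fk] every other row sees [i] and [j] exactly [m] apart, and an overlap is a sum of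
    contributions of ends. So it does not matter which of the two rows owns which end; this holds
    separately for the ends [u] and, in [outer_swapr], for the ends [w]. *)
Lemma outer_swapl u w : (m <= u i)%N ->
    (forall k, k != i -> k != j -> u k <= w k)%N ->
  outer i j f (swap_at i j m u) w = outer i j f u w.
Proof.
move=> mu le_uw; rewrite !outerE //; congr (_ + _); last first.
  apply: eq_bigr => k /andP[ki kj]; apply: eq_bigr => l /andP[/andP[_ li] lj].
  by rewrite !swapk.
apply: eq_bigr => k /andP[ki kj]; rewrite swapi swapj !swapk // fj // fk //.
congr (_ + _).
  have e1 : (u i - m)%N%:Z + m%:Z = u i by lia.
  have e2 : (m + u j)%N%:Z = (u j)%:Z + m%:Z by lia.
  by rewrite /overlap !clamp_shift e1 e2; ring.
have e1 : f k i + m%:Z + (u i - m)%N%:Z = f k i + (u i)%:Z by lia.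
have e2 : f k i + (m + u j)%N%:Z = f k i + m%:Z + (u j)%:Z by lia.
by rewrite !overlapE ?le_uw // e1 e2; ring.
Qed.

Lemma outer_swapr u w : (m <= w i)%N ->
  outer i j f u (swap_at i j m w) = outer i j f u w.
Proof.
move=> mw; rewrite !outerE //; congr (_ + _); last first.
  apply: eq_bigr => k /andP[ki kj]; apply: eq_bigr => l /andP[/andP[_ li] lj].
  by rewrite !swapk.
apply: eq_bigr => k /andP[ki kj]; rewrite swapi swapj !swapk // fj // fk //.
congr (_ + _).
have e1 : (w i - m)%N%:Z + m%:Z = w i by lia.
have e2 : (m + w j)%N%:Z = (w j)%:Z + m%:Z by lia.
by rewrite /overlap !clamp_shift e1 e2; ring.
Qed.

Lemma swap_atK u : (m <= u i)%N -> swap_at i j m (swap_at i j m u) =1 u.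
Proof.
move=> mu k; rewrite {1}/swap_at swapi swapj.
case: eqP => [->|/eqP ki]; first by rewrite subnKC.
by case: eqP => [->|/eqP kj]; [rewrite addKn | rewrite swapk].
Qed.

Lemma sum_swap_at u : (m <= u i)%N ->
  (\sum_k swap_at i j m u k = \sum_k u k)%N.
Proof.
move=> mu; have ji : j != i by rewrite eq_sym.
rewrite (bigD1 i) // (bigD1 j) //= [RHS](bigD1 i) // [in RHS](bigD1 j) //=.
rewrite swapi swapj (eq_bigr u) => [|k /andP[? ?]]; last exact: swapk.
lia.
Qed.

End Swap.
End Inversions.

Lemma overlap_out a b c v : (a <= b)%N -> c + v%:Z <= a%:Z \/ b%:Z <= c ->
  overlap a b c v = 0.
Proof. rewrite /overlap /clamp; lia. Qed.

(** * The wall identity for two rows and one letter *)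

Section CrossOneLetter.
Variables (R : comNzRingType) (q : R).

Let left_exp (U W v y m : nat) (c d : int) :
  (U < m + v)%N -> (U <= W)%N -> (v <= y)%N -> m%:Z - 1 <= c -> d <= - m%:Z ->
  overlap U W c v + overlap v y d U = overlap U W c v.
Proof. by move=> *; rewrite [X in _ + X]overlap_out ?addr0 //; left; lia. Qed.

Let right_exp (U W v y m : nat) (c d : int) :
  (m + v <= U)%N -> (U <= W)%N -> (v <= y)%N -> c <= m%:Z -> - m%:Z - 1 <= d ->
  overlap U W c v + overlap v y d U = overlap v y d U.
Proof. by move=> *; rewrite overlap_out ?add0r //; left; lia. Qed.

Let exp1 (U W v m : nat) : (U < m + v)%N -> (U <= W)%N ->
  absz (overlap U W (m%:Z - 1) v) = (minn W.+1 (m + v) - maxn U.+1 m)%N.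
Proof. rewrite /overlap /clamp; lia. Qed.

Let exp3 (U W v m : nat) : (U < m + v)%N -> (U <= W)%N ->
  absz (overlap U W m%:Z v) = (minn W (m + v) - maxn U m)%N.
Proof. rewrite /overlap /clamp; lia. Qed.

Let exp1' (U v y m : nat) : (m + v <= U)%N -> (v <= y)%N ->
  absz (overlap v y (- m%:Z) U) = (minn (m + y) U - (m + v))%N.
Proof. rewrite /overlap /clamp; lia. Qed.

Let exp3' (U v y m : nat) : (m + v <= U)%N -> (v <= y)%N ->
  absz (overlap v y (- m%:Z - 1) U) = (minn (m + y) U.-1 - (m + v))%N.
Proof. rewrite /overlap /clamp; lia. Qed.

(* Two rows whose starts are m apart, just before (a1, a2) or just after
   (a3, a4) the start of the right one passes an integer distance; one letter
   fills the columns from U to W, resp. from m + v to m + y. *)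
Lemma cross_one_letter (U W v y m : nat) :
  let a1 := absz (overlap U W (m%:Z - 1) v + overlap v y (- m%:Z) U) in
  let a2 := absz (overlap (m + v) W (m%:Z - 1) (U - m)
              + overlap (U - m) y (- m%:Z) (m + v)) in
  let a3 := absz (overlap U W m%:Z v + overlap v y (- m%:Z - 1) U) in
  let a4 := absz (overlap U (m + y) m%:Z v
              + overlap v (W - m) (- m%:Z - 1) U) in
  let b1 := (U <= W)%N && (v <= y)%N in
  let b2 := (m + v <= W)%N && (U - m <= y)%N in
  let b4 := (U <= m + y)%N && (v <= W - m)%N in
  (if b1 then q ^+ a1 else 0) * (if (m <= U)%N && (U < m + v)%N then q else 1)
  + (if (m <= U)%N && (m + v < U)%N then
       (1 - q) * (if b2 then q ^+ a2 else 0) else 0)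
  = if (m <= W)%N && (W < m + y)%N then
      q * (if b1 then q ^+ a3 else 0) + (1 - q) * (if b4 then q ^+ a4 else 0)
    else if b1 then q ^+ a3 else 0.
Proof.
move=> a1 a2 a3 a4 b1 b2 b4.
(* Only one overlap survives in each sum: the first if the smaller letters of the left row end
   before those of the right row ([left_exp]), else the second ([right_exp]). Each exponent then is
   the length of one interval. *)
case: (boolP (U < m + v)%N) => [UV|VU]; last rewrite -leqNgt in VU.
- have E1 : b1 -> a1 = (minn W.+1 (m + v) - maxn U.+1 m)%N.
    by case/andP=> *; rewrite /a1 (@left_exp _ _ _ _ m) ?exp1.
  have E3 : b1 -> a3 = (minn W (m + v) - maxn U m)%N.
    by case/andP=> *; rewrite /a3 (@left_exp _ _ _ _ m) ?exp3 //; lia.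
  have E4 : b4 -> a4 = (minn (m + y) (m + v) - maxn U m)%N.
    by case/andP=> *; rewrite /a4 (@left_exp _ _ _ _ m) ?exp3 //; lia.
  clearbody a1 a2 a3 a4; rewrite /b1 /b4 in E1 E3 E4 *.
  have -> : (m + v < U)%N = false by clear -UV; lia.
  rewrite andbT andbF addr0; clear a2 b1 b2 b4.
  case: (boolP ((m <= W) && (W < m + y))%N) => cW; last first.
    case: ifP E1 E3 => [b1T /(_ isT) E1 /(_ isT) E3 | _ _ _]; last by rewrite mul0r.
    case: ifP => mU; rewrite -?exprSr ?mulr1; congr (q ^+ _); lia.
  case: (boolP (m + v <= W)%N) => [VW|WV]; last first.
    have b4F : (U <= m + y)%N && (v <= W - m)%N = false by lia.
    rewrite b4F mulr0 addr0.
    case: ifP E1 E3 => [b1T /(_ isT) E1 /(_ isT) E3 | _ _ _]; last by rewrite mul0r mulr0.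
    case: ifP => mU; rewrite -?exprSr -?exprS ?mulr1; congr (q ^+ _); lia.
  have b1T : (U <= W)%N && (v <= y)%N by lia.
  have b4T : (U <= m + y)%N && (v <= W - m)%N by lia.
  move: E1 E3 E4; rewrite b1T b4T => /(_ isT) E1 /(_ isT) E3 /(_ isT) E4.
  have -> : a4 = a3 by lia.
  rewrite -mulrDl subrKC mul1r.
  case: ifP => mU; rewrite -?exprSr ?mulr1; congr (q ^+ _); lia.
have E1 : b1 -> a1 = (minn (m + y) U - (m + v))%N.
  by case/andP=> *; rewrite /a1 (@right_exp _ _ _ _ m) ?exp1' //; lia.
have E3 : b1 -> a3 = (minn (m + y) U.-1 - (m + v))%N.
  by case/andP=> *; rewrite /a3 (@right_exp _ _ _ _ m) ?exp3' //; lia.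
have E4 : b4 -> a4 = (minn (m + (W - m)) U.-1 - (m + v))%N.
  by case/andP=> *; rewrite /a4 (@right_exp _ _ _ _ m) ?exp3' //; lia.
have E2 : (m <= U)%N -> (m + v < U)%N -> b2 ->
    a2 = (minn W.+1 (m + (U - m)) - maxn (m + v).+1 m)%N.
  rewrite /a2 /b2; clear a1 a2 a3 a4 b1 b2 b4 E1 E3 E4 => mU lVU /andP[? ?].
  by rewrite (@left_exp _ _ _ _ m) ?exp1 //; lia.
clearbody a1 a2 a3 a4; rewrite andbF mulr1.
rewrite /b1 /b2 /b4 in E1 E2 E3 E4 *; clear b1 b2 b4.
case: (boolP (m + v < U)%N) => [lVU|]; last first.
  rewrite andbF addr0 -leqNgt => leUV.
  case: (boolP ((m <= W) && (W < m + y))%N) => cW; last first.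
    case: ifP E1 E3 => // b1T /(_ isT) E1 /(_ isT) E3; congr (q ^+ _).
    by clear - E1 E3 leUV VU; lia.
  have b41 : (U <= m + y)%N && (v <= W - m)%N = (U <= W)%N && (v <= y)%N.
    by clear - VU leUV cW; lia.
  rewrite b41 in E4 *; case: ifP E1 E3 E4; last by rewrite !mulr0 addr0.
  move=> b1T /(_ isT) E1 /(_ isT) E3 /(_ isT) E4.
  have [-> ->] : a3 = a1 /\ a4 = a1 by clear - E1 E3 E4 VU leUV; lia.
  by rewrite -mulrDl subrKC mul1r.
have mU : (m <= U)%N by clear - lVU; lia.
rewrite mU !andTb; move/(_ mU lVU): E2 => E2.
case: (boolP ((m <= W) && (W < m + y))%N) => cW; last first.
  case: (boolP (U <= m + y)%N) => [UY|YU]; last first.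
    have b2F : (m + v <= W)%N && (U - m <= y)%N = false by clear - YU mU; lia.
    rewrite b2F mulr0 addr0.
    case: ifP E1 E3 => // b1T /(_ isT) E1 /(_ isT) E3; congr (q ^+ _).
    by clear - E1 E3 YU; lia.
  case: ifP E1 E3 => [b1T /(_ isT) E1 /(_ isT) E3 | b1F _ _]; last first.
    have b2F : (m + v <= W)%N && (U - m <= y)%N = false.
      by clear - b1F cW UY lVU mU; lia.
    by rewrite b2F mulr0 addr0.
  have b2T : (m + v <= W)%N && (U - m <= y)%N by clear - b1T cW UY lVU mU; lia.
  rewrite b2T in E2 *; move/(_ isT): E2 => E2.
  have [-> ->] : a1 = a2.+1 /\ a3 = a2.
    by clear - E1 E2 E3 UY lVU mU b1T; lia.
  by rewrite exprS -mulrDl subrKC mul1r.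
have b42 : (U <= m + y)%N && (v <= W - m)%N = (m + v <= W)%N && (U - m <= y)%N.
  by clear - cW mU lVU; lia.
rewrite b42 in E4 *.
case: (boolP (U <= W)%N) => [UW|WU] /=; last first.
  rewrite mulr0 !add0r.
  by case: ifP E2 E4 => // b2T /(_ isT) E2 /(_ isT) E4; congr (_ * q ^+ _);
     clear - E2 E4 WU lVU mU b2T cW; lia.
have [b1T b2T] : (v <= y)%N /\ (m + v <= W)%N && (U - m <= y)%N.
  by clear - cW UW lVU mU; lia.
rewrite b2T in E2 E4 *; rewrite UW b1T in E1 E3 *.
move/(_ isT): E1 => E1; move/(_ isT): E2 => E2.
move/(_ isT): E3 => E3; move/(_ isT): E4 => E4.
have UY : (U <= m + y)%N by clear - cW UW; lia.
have {}E1 : a1 = (U - (m + v))%N by clear - E1 UY; lia.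
have {}E2 : a2 = (U - (m + v).+1)%N by clear - E2 UW mU; lia.
have {}E3 : a3 = (U.-1 - (m + v))%N by clear - E3 UY; lia.
have {}E4 : a4 = (U.-1 - (m + v))%N by clear - E4 UW cW; lia.
have [-> [-> ->]] : a1 = a2.+1 /\ a3 = a2 /\ a4 = a2.
  by clear - E1 E2 E3 E4 lVU; lia.
by rewrite exprS.
Qed.

End CrossOneLetter.

Lemma big_inj_support (A B : finType) (V : Type) (idx : V) (op : Monoid.com_law idx)
    (h : A -> B) (F : B -> V) :
  injective h -> (forall b, b \notin codom h -> F b = idx) ->
  \big[op/idx]_b F b = \big[op/idx]_a F (h a).
Proof.
move=> h_inj F0; rewrite (bigID (fun b => b \in [set h a | a in A])) /=.
rewrite [X in op _ X]big1 ?Monoid.mulm1 => [|b nb].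
  by rewrite big_imset //= => ? ? _ _; apply: h_inj.
by apply: F0; apply: contra nb => /codomP[a ->]; apply: imset_f.
Qed.

(** * Summation letter by letter *)

Section LetterSum.
Variables (R : idomainType) (q : R) (L : nat).

Section Def.
Variable I : finType.
Implicit Types (f : I -> I -> int) (u w r : I -> nat) (x : R) (xs : seq R).

Definition letter f x u w : R :=
  if [forall i, u i <= w i]%N then
    x ^+ (\sum_i w i - \sum_i u i) * q ^+ absz (cross_inv f u w) else 0.

(* The LLT polynomial of the rows of lengths w in the variables xs, the first
   variable standing for the largest letter: u records the part of each row
   filled with smaller letters. *)
Fixpoint letter_sum f xs w : R :=
  if xs is x :: xs' then
    \sum_(u : {ffun I -> 'I_L})
      letter f x (fun i => u i) w * letter_sum f xs' (fun i => u i)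
  else [forall i, w i == 0%N]%:R.

Lemma eq_letter f f' x u u' w w' :
    (forall i j, i != j -> f i j = f' i j) -> u =1 u' -> w =1 w' ->
  letter f x u w = letter f' x u' w'.
Proof.
move=> ef eu ew; rewrite /letter (eq_cross_inv ef eu ew).
rewrite (eq_bigr _ (fun i _ => eu i)) (eq_bigr _ (fun i _ => ew i)).
by rewrite (eq_forallb (fun i => congr2 leq (eu i) (ew i))).
Qed.

Lemma eq_letter_sum f f' xs w w' :
  (forall i j, i != j -> f i j = f' i j) -> w =1 w' ->
  letter_sum f xs w = letter_sum f' xs w'.
Proof.
move=> ef; elim: xs w w' => [|x xs IH] w w' ew /=.
  by rewrite (eq_forallb (fun i => congr1 (eq_op^~ 0%N) (ew i))).
by apply: eq_bigr => u _; rewrite (eq_letter x ef (fun=> erefl) ew) // (IH _ (fun i => u i)).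
Qed.

Lemma letter_gt f x u w i : (w i < u i)%N -> letter f x u w = 0.
Proof.
by rewrite /letter ltnNge => /negP wu; case: forallP => // le_uw; case: wu.
Qed.

Section Cross.
Variables (i j : I) (m : nat) (f f' : I -> I -> int).
Hypotheses (ij : i != j) (fij : f i j = m%:Z - 1) (fji : f j i = - m%:Z)
  (fij' : f' i j = m%:Z) (fji' : f' j i = - m%:Z - 1)
  (ff' : forall k l, ~~ ((k == i) && (l == j)) -> ~~ ((k == j) && (l == i)) ->
     f k l = f' k l)
  (fj : forall k, k != i -> k != j -> f j k = f i k - m%:Z)
  (fk : forall k, k != i -> k != j -> f k j = f k i + m%:Z).

Let swapi u : swap_at i j m u i = (m + u j)%N.
Proof. by rewrite /swap_at eqxx. Qed.
Let swapj u : swap_at i j m u j = (u i - m)%N.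
Proof. by rewrite /swap_at eqxx eq_sym (negPf ij). Qed.
Let swapk u k : k != i -> k != j -> swap_at i j m u k = u k.
Proof. by rewrite /swap_at => /negPf-> /negPf->. Qed.

Let others u w := [forall k, (k != i) && (k != j) ==> (u k <= w k)%N].

Let others_le u w : others u w -> forall k, k != i -> k != j -> (u k <= w k)%N.
Proof. by move=> /forallP H k ki kj; have := H k; rewrite ki kj. Qed.

Let forall_others u w :
  [forall k, (u k <= w k)%N] = [&& others u w, (u i <= w i)%N & (u j <= w j)%N].
Proof.
apply/forallP/and3P => [H|[/others_le H Hi Hj] k].
  by split=> //; apply/forallP => k; apply/implyP.
by have [->//|ki] := eqVneq k i; have [->//|kj] := eqVneq k j; apply: H.
Qed.

Let others_swapl u w : others (swap_at i j m u) w = others u w.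
Proof.
apply: eq_forallb => k; case: (boolP (_ && _)) => //= /andP[ki kj].
by rewrite swapk.
Qed.

Let others_swapr u w : others u (swap_at i j m w) = others u w.
Proof.
apply: eq_forallb => k; case: (boolP (_ && _)) => //= /andP[ki kj].
by rewrite swapk.
Qed.

Let letterE g x u w : letter g x u w =
  if others u w then
    if (u i <= w i)%N && (u j <= w j)%N then
      (x ^+ (\sum_i w i - \sum_i u i) * q ^+ absz (outer i j g u w)) *
      q ^+ absz (overlap (u i) (w i) (g i j) (u j)
                 + overlap (u j) (w j) (g j i) (u i))
    else 0
  else 0.
Proof.
rewrite /letter forall_others; case: (boolP (others u w)) => //= ou.
case: (boolP (_ && _)) => // /andP[ui uj].
have le_uw k : (u k <= w k)%N.
  have /forallP : [forall k, (u k <= w k)%N] by rewrite forall_others ou ui.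
  exact.
have o0 := outer_ge0 g ij le_uw.
have o1 := overlap_ge0 (g i j) (u j) ui; have o2 := overlap_ge0 (g j i) (u i) uj.
rewrite -mulrA -exprD; congr (_ * q ^+ _).
have -> : cross_inv g u w = outer i j g u w +
    (overlap (u i) (w i) (g i j) (u j) + overlap (u j) (w j) (g j i) (u i)).
  by rewrite /outer; ring.
by clear - o0 o1 o2; lia.
Qed.

(** The commutation of the letter operator with the wall. The left side is the whole coefficient of
    the value at [u] after the formula has been applied to the smaller letters: [u] arises from
    itself and from [swap_at i j m u]. *)
Lemma letter_cross x u w :
  letter f x u w * (if (m <= u i)%N && (u i < m + u j)%N then q else 1)
  + (if (m <= u i)%N && (m + u j < u i)%N then
       (1 - q) * letter f x (swap_at i j m u) w else 0)
  = if (m <= w i)%N && (w i < m + w j)%N then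
      q * letter f' x u w + (1 - q) * letter f' x u (swap_at i j m w)
    else letter f' x u w.
Proof.
rewrite !letterE others_swapl others_swapr.
case: (boolP (others u w)) => [ou|_]; last first.
  by rewrite mul0r !mulr0 addr0 !if_same addr0.
have := cross_one_letter q (u i) (w i) (u j) (w j) m.
rewrite !swapi !swapj fij fji fij' fji' => /(congr1 (fun z =>
  x ^+ (\sum_i w i - \sum_i u i) * q ^+ absz (outer i j f u w) * z)).
rewrite -(outer_eq u w ij ff').
(* The power of [x] and the inversions outside the pair [i], [j] are the same in all four terms, so
   the identity for two rows can be multiplied by [A]. *)
set A := x ^+ _ * _ => E.
have El : (m <= u i)%N -> x ^+ (\sum_k w k - \sum_k swap_at i j m u k) *
    q ^+ absz (outer i j f (swap_at i j m u) w) = A.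
  move=> mu; rewrite (sum_swap_at ij mu) (outer_swapl ij fj fk) //.
  exact: others_le ou.
have Er : (m <= w i)%N -> x ^+ (\sum_k swap_at i j m w k - \sum_k u k) *
    q ^+ absz (outer i j f' u (swap_at i j m w)) = A.
  by move=> mw; rewrite (sum_swap_at ij mw) -(outer_eq _ _ ij ff') (outer_swapr ij fj fk).
have pull (b : bool) (t : R) : (if b then A * t else 0) = A * (if b then t else 0).
  by case: b; rewrite ?mulr0.
case: (boolP (m <= u i)%N) El => [mu /(_ isT) ->|mu _];
case: (boolP (m <= w i)%N) Er => [mw /(_ isT) ->|mw _];
rewrite ?(negPf mu) ?(negPf mw) ?mu ?mw in E *; rewrite !pull;
move: E;
set t1 := (if _ && _ then q ^+ absz (overlap _ _ (m%:Z - 1) _ + _) else 0);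
try set t2 := (if _ && _ then q ^+ absz (overlap (m + _) _ _ _ + _) else 0);
set t3 := (if _ && _ then q ^+ absz (overlap _ (w i) m%:Z _ + _) else 0);
try set t4 := (if _ && _ then q ^+ absz (overlap _ (m + _) m%:Z _ + _) else 0);
case: (u i < m + u j)%N; case: (m + u j < u i)%N; case: (w i < m + w j)%N => E;
apply: etrans (etrans _ E) _; rewrite /= ?mulr0 ?addr0; ring.
Qed.

(** Extended by the identity where the swapped lengths would be negative or exceed the bound [L], so
    as to be an involution of all tuples. *)
Let swap_tup (u : {ffun I -> 'I_L}) : {ffun I -> 'I_L} :=
  if (m <= u i)%N && (m + u j < L)%N then
    [ffun k => insubd (u k) (swap_at i j m (fun k => u k) k)] else u.

Let swap_tupE (u : {ffun I -> 'I_L}) k :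
  (m <= u i)%N -> (m + u j < L)%N -> swap_tup u k = swap_at i j m (fun k => u k) k :> nat.
Proof.
move=> mu lu; rewrite /swap_tup mu lu ffunE val_insubd; case: ifP => // /negP[].
rewrite /swap_at; case: ifP => // _; case: ifP => // _.
exact: leq_ltn_trans (leq_subr _ _) (ltn_ord _).
Qed.

Let swap_tupK : involutive swap_tup.
Proof.
move=> u; case: (boolP ((m <= u i)%N && (m + u j < L)%N)) => [/andP[mu lu]|gu]; last first.
  by rewrite /swap_tup !(negPf gu).
have ei := swap_tupE i mu lu; have ej := swap_tupE j mu lu.
rewrite swapi in ei; rewrite swapj in ej.
have mu' : (m <= swap_tup u i)%N by rewrite ei leq_addr.
have lu' : (m + swap_tup u j < L)%N by rewrite ej subnKC.
apply/ffunP => k; apply: val_inj; rewrite /= swap_tupE //.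
rewrite -[RHS](swap_atK ij (u := fun k => u k) mu).
by apply: eq_swap_at => ? /=; rewrite swap_tupE.
Qed.

(** Apply the formula to the smaller letters, move its second term from [u] to [swap_tup u], and
    collect coefficients with [letter_cross]. *)
Lemma letter_sum_cross xs w : (\sum_k w k < L)%N ->
  letter_sum f xs w =
    if (m <= w i)%N && (w i < m + w j)%N then
      q * letter_sum f' xs w + (1 - q) * letter_sum f' xs (swap_at i j m w)
    else letter_sum f' xs w.
Proof.
have sum_ij v : (v i + v j <= \sum_k v k)%N.
  by rewrite (bigD1 i) // (bigD1 j) /= 1?eq_sym // addnA leq_addr.
elim: xs w => [|x xs IH] w wL /=.
  case: ifP => // /andP[mw lw].
  have w0 v : (0 < v i + v j)%N -> [forall k, v k == 0%N] = false.
    by move=> v0; apply/negP => /forallP v0'; move: v0; rewrite !(eqP (v0' _)).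
  by rewrite !w0 ?mulr0 ?addr0 // ?swapi ?swapj; clear - mw lw; lia.
pose g (u : {ffun I -> 'I_L}) := letter_sum f' xs (fun k => u k).
pose c (v : I -> nat) := (m <= v i)%N && (v i < m + v j)%N.
have -> : \sum_(u : {ffun I -> 'I_L}) letter f x (fun k => u k) w *
      letter_sum f xs (fun k => u k) =
    \sum_(u : {ffun I -> 'I_L})
      (letter f x (fun k => u k) w * (if c (fun k => u k) then q else 1)
       + (if (m <= u i)%N && (m + u j < u i)%N then
         (1 - q) * letter f x (swap_at i j m (fun k => u k)) w else 0)) * g u.
  under [RHS]eq_bigr => u _ do rewrite mulrDl.
  rewrite big_split /= [X in _ = _ + X](reindex_inj (inv_inj swap_tupK)) -big_split /=.
  apply: eq_bigr => u _.
  (* Tuples exceeding [w] contribute 0. For the others, if [m <= u i], then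
     [m + u j <= w i + w j < L] and the swap is a genuine one. *)
  case: (boolP [forall k, (u k <= w k)%N]) => [/forallP uw|]; last first.
    rewrite negb_forall => /existsP[k]; rewrite -ltnNge => uwk.
    rewrite (@letter_gt _ _ (fun k => u k) _ k) // !mul0r add0r.
    case: ifP => [/andP[mu lu]|_]; last by rewrite mul0r.
    rewrite [letter _ _ _ _](_ : _ = 0) ?mulr0 ?mul0r //.
    case: (boolP ((m <= u i)%N && (m + u j < L)%N)) => [/andP[mu' lu']|gu]; last first.
      rewrite /swap_tup (negPf gu) in mu lu; have ui := ltn_ord (u i).
      by exfalso; clear - gu mu lu ui; lia.
    rewrite -(@letter_gt f x (fun k => u k) w k) //.
    apply: eq_letter => // l; rewrite -[RHS](swap_atK ij (u := fun k => u k) mu').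
    by apply: eq_swap_at => ? /=; rewrite swap_tupE.
  rewrite IH; last by apply: leq_ltn_trans wL; apply: leq_sum.
  have wij := leq_ltn_trans (sum_ij w) wL; have [ui uj] := (uw i, uw j).
  case: (boolP ((m <= u i)%N && (m + u j < L)%N)) => [/andP[mu lu]|gu]; last first.
    have mu : (m <= u i)%N = false by clear - gu ui uj wij; lia.
    by rewrite /c /swap_tup !mu /= mul0r addr0 mulr1.
  rewrite !swap_tupE // swapi swapj leq_addr /= subnKC //.
  rewrite /c mu /=.
  have -> : letter f x (swap_at i j m (fun k => swap_tup u k)) w = letter f x (fun k => u k) w.
    apply: eq_letter => // l; rewrite -[RHS](swap_atK ij (u := fun k => u k) mu).
    by apply: eq_swap_at => ? /=; rewrite swap_tupE.
  have -> : g (swap_tup u) = letter_sum f' xs (swap_at i j m (fun k => u k)).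
    by apply: eq_letter_sum => // l; rewrite swap_tupE.
  by case: ifP => _; rewrite /g; ring.
rewrite (eq_bigr (fun u : {ffun I -> 'I_L} => g u *
   if (m <= w i)%N && (w i < m + w j)%N then
      q * letter f' x (fun k => u k) w
      + (1 - q) * letter f' x (fun k => u k) (swap_at i j m w)
    else letter f' x (fun k => u k) w)); last first.
  by move=> u _; rewrite [RHS]mulrC -letter_cross.
case: ifP => _; last by apply: eq_bigr => u _; rewrite mulrC.
rewrite !big_distrr -big_split /=; apply: eq_bigr => u _; rewrite /g; ring.
Qed.

End Cross.
End Def.

Section Transport.
Variables (I J : finType) (h : I -> J) (h_inj : injective h) (L_gt0 : (0 < L)%N).
Variable f : J -> J -> int.

Let fh i i' := f (h i) (h i').

Let cross_inv_inj u w : (forall j, j \notin codom h -> u j = 0%N /\ w j = 0%N) ->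
  cross_inv f u w = cross_inv fh (fun i => u (h i)) (fun i => w (h i)).
Proof.
move=> uw0; rewrite /cross_inv (big_inj_support _ h_inj); last first.
  by move=> j /uw0[-> ->]; apply: big1 => ? _; apply: overlap0l.
apply: eq_bigr => i _; rewrite big_mkcond [RHS]big_mkcond (big_inj_support _ h_inj) /=.
  by apply: eq_bigr => i' _; rewrite (inj_eq h_inj).
by move=> j /uw0[-> _]; rewrite overlap0r if_same.
Qed.

Lemma letter_sum_inj xs w : (forall j, j \notin codom h -> w j = 0%N) ->
  letter_sum f xs w = letter_sum fh xs (fun i => w (h i)).
Proof.
elim: xs w => [|x xs IH] w w0 /=.
  congr (_%:R); congr (nat_of_bool _).
  apply/forallP/forallP => [H i|H j]; first exact: H.
  by case: (boolP (j \in codom h)) => [/codomP[i ->]|/w0->].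
pose P (u : {ffun J -> 'I_L}) := [forall j, (j \notin codom h) ==> (u j == 0%N :> nat)].
rewrite (bigID P) /= [X in _ + X]big1 ?addr0; last first.
  move=> u; rewrite negb_forall => /existsP[j]; rewrite negb_imply => /andP[nj uj].
  by rewrite (@letter_gt _ _ _ _ _ j) ?mul0r //= w0 // lt0n.
pose ext (v : {ffun I -> 'I_L}) : {ffun J -> 'I_L} :=
  [ffun j => if [pick i | h i == j] is Some i then v i else Ordinal L_gt0].
pose res (u : {ffun J -> 'I_L}) : {ffun I -> 'I_L} := [ffun i => u (h i)].
have ext_h v i : ext v (h i) = v i.
  rewrite ffunE; case: pickP => [i' /eqP/h_inj->//|/(_ i)].
  by rewrite eqxx.
have ext0 v j : j \notin codom h -> ext v j = 0%N :> nat.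
  move=> nj; rewrite ffunE; case: pickP => // i /eqP hi.
  by move: nj; rewrite -hi codom_f.
rewrite (reindex_onto ext res) => [|u /forallP Pu]; last first.
  apply/ffunP => j; apply: val_inj => /=.
  case: (boolP (j \in codom h)) => [/codomP[i ->]|nj]; first by rewrite ext_h ffunE.
  by rewrite ext0 //; have := Pu j; rewrite nj => /eqP.
apply: eq_big => [v|v _].
  apply/andP; split; first by apply/forallP => j; apply/implyP => /ext0->.
  by apply/eqP/ffunP => i; rewrite ffunE ext_h.
rewrite IH => [|j /(ext0 v)//]; congr (_ * _); last first.
  by apply: eq_letter_sum => // i; rewrite ext_h.
rewrite /letter (cross_inv_inj (u := fun j => ext v j)); last first.
  by move=> j nj; rewrite ext0 // w0.
rewrite (big_inj_support _ h_inj w0).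
rewrite (big_inj_support _ h_inj (F := fun j => nat_of_ord (ext v j)) (ext0 v)).
rewrite [X in (_ - X)%N](eq_bigr (fun i => v i : nat)) => [|i _]; last by rewrite ext_h.
rewrite (@eq_cross_inv _ fh fh _ (fun i => v i) _ (fun i => w (h i))) // => [|i]; last first.
  by rewrite ext_h.
congr (if _ then _ else _); apply/forallP/forallP => [H i|H j].
  by rewrite -ext_h.
case: (boolP (j \in codom h)) => [/codomP[i ->]|nj]; first by rewrite ext_h.
by rewrite ext0.
Qed.

End Transport.

Section Product.
Variables (I J : finType) (f1 : I -> I -> int) (f2 : J -> J -> int).
Variable (f : I + J -> I + J -> int).
Hypotheses (fl : forall i i', f (inl i) (inl i') = f1 i i')
  (fr : forall j j', f (inr j) (inr j') = f2 j j').

Let wl (w : I + J -> nat) i := w (inl i).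
Let wr (w : I + J -> nat) j := w (inr j).

Let cross_inv_sum u w :
    (forall i j, (0 < w (inl i))%N -> (0 < w (inr j))%N ->
       (w (inl i))%:Z <= f (inl i) (inr j) /\ f (inr j) (inl i) <= - (w (inl i))%:Z) ->
    (forall i, u i <= w i)%N ->
  cross_inv f u w = cross_inv f1 (wl u) (wl w) + cross_inv f2 (wr u) (wr w).
Proof.
move=> sep uw; rewrite /cross_inv big_sumType /=.
have u0 k : (w k = 0 -> u k = 0)%N by have := uw k; clear; lia.
congr (_ + _).
  apply: eq_bigr => i _; rewrite big_sumType /= [X in _ + X]big1 ?addr0.
    by apply: eq_bigr => i' _; rewrite fl.
  move=> j _; have [wi|wi] := posnP (w (inl i)); first by rewrite u0 // wi overlap0l.
  have [wj|wj] := posnP (w (inr j)); first by rewrite [u (inr j)]u0 // overlap0r.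
  by have [h _] := sep i j wi wj; apply: overlap_out => //; right.
apply: eq_bigr => j _; rewrite big_sumType /= [X in X + _]big1 ?add0r.
  by apply: eq_bigr => j' _; rewrite fr.
move=> i _; have [wi|wi] := posnP (w (inl i)); first by rewrite [u (inl i)]u0 // overlap0r.
have [wj|wj] := posnP (w (inr j)); first by rewrite u0 // wj overlap0l.
have [_ h] := sep i j wi wj; apply: overlap_out => //; left.
by have := uw (inl i); move: h; clear; lia.
Qed.

(** The nonempty rows of the left summand end before those of the right one start, so there are no
    inversions across, and each letter is distributed independently on the two sides. *)
Lemma letter_sum_sum xs w :
    (forall i j, (0 < w (inl i))%N -> (0 < w (inr j))%N ->
       (w (inl i))%:Z <= f (inl i) (inr j) /\ f (inr j) (inl i) <= - (w (inl i))%:Z) ->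
  letter_sum f xs w = letter_sum f1 xs (wl w) * letter_sum f2 xs (wr w).
Proof.
elim: xs w => [|x xs IH] w sep /=.
  rewrite -natrM mulnb; congr (nat_of_bool _)%:R.
  apply/forallP/andP => [H|[/forallP H1 /forallP H2] [i|j]]; last 2 first.
  - exact: H1.
  - exact: H2.
  by split; apply/forallP => i; apply: H.
rewrite big_distrlr pair_bigA /=.
pose ext (v : {ffun I -> 'I_L} * {ffun J -> 'I_L}) : {ffun I + J -> 'I_L} :=
  [ffun k => match k with inl i => v.1 i | inr j => v.2 j end].
pose res (u : {ffun I + J -> 'I_L}) : {ffun I -> 'I_L} * {ffun J -> 'I_L} :=
  ([ffun i => u (inl i)], [ffun j => u (inr j)]).
rewrite (reindex_onto ext res) => [|u _]; last first.
  by apply/ffunP => -[i|j]; rewrite !ffunE.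
apply: eq_big => [v|v _].
  by apply/eqP; case: v => v1 v2; congr (_, _); apply/ffunP => k; rewrite !ffunE.
have ext1 : wl (fun k => ext v k) =1 (fun i => v.1 i) by move=> i; rewrite /wl ffunE.
have ext2 : wr (fun k => ext v k) =1 (fun j => v.2 j) by move=> j; rewrite /wr ffunE.
rewrite /letter.
have -> : [forall k, (ext v k <= w k)%N] =
    [forall i, (v.1 i <= wl w i)%N] && [forall j, (v.2 j <= wr w j)%N].
  apply/forallP/andP => [H|[/forallP H1 /forallP H2] [i|j]].
  - by split; apply/forallP => k; [rewrite -ext1 | rewrite -ext2]; apply: H.
  - by have := H1 i; rewrite -ext1.
  - by have := H2 j; rewrite -ext2.
case: (boolP [forall i, _]) => [/forallP le1|_]; last by rewrite !mul0r.
case: (boolP [forall j, _]) => [/forallP le2|_]; last by rewrite /= mulrA !(mulr0, mul0r).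
have le_w k : (ext v k <= w k)%N by case: k => k; rewrite ffunE; [apply: le1 | apply: le2].
rewrite /= cross_inv_sum // IH => [|i j vi vj]; last first.
  have [h1 h2] := sep i j (leq_trans vi (le_w _)) (leq_trans vj (le_w _)).
  by split; [apply: le_trans h1|apply: le_trans h2 _]; rewrite ?lerN2 lez_nat.
rewrite (eq_letter_sum xs (f' := f1) _ ext1) // (eq_letter_sum xs (f' := f2) _ ext2) //.
rewrite (eq_cross_inv (f' := f1) _ ext1 (w' := wl w)) //.
rewrite (eq_cross_inv (f' := f2) _ ext2 (w' := wr w)) //.
rewrite !big_sumType /= (eq_bigr _ (fun i _ => ext1 i)) (eq_bigr _ (fun i _ => ext2 i)).
have -> : (\sum_i w (inl i) + \sum_j w (inr j) - (\sum_i v.1 i + \sum_j v.2 j) =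
   (\sum_i w (inl i) - \sum_i v.1 i) + (\sum_j w (inr j) - \sum_j v.2 j))%N.
  have : (\sum_i v.1 i <= \sum_i w (inl i))%N by apply: leq_sum => i _; apply: le1.
  have : (\sum_j v.2 j <= \sum_j w (inr j))%N by apply: leq_sum => i _; apply: le2.
  by clear; lia.
have c1 := cross_inv_ge0 f1 le1; have c2 := cross_inv_ge0 f2 le2.
have -> : absz (cross_inv f1 (fun i => v.1 i) (wl w) + cross_inv f2 (fun j => v.2 j) (wr w))
    = (absz (cross_inv f1 (fun i => v.1 i) (wl w))
       + absz (cross_inv f2 (fun j => v.2 j) (wr w)))%N by clear - c1 c2; lia.
by rewrite !exprD; ring.
Qed.

End Product.
End LetterSum.

(** * Alcoves *)

Section Alcoves.
Variable I : finType.
Implicit Types (f g h : I -> I -> int) (r : I -> nat) (i j k : I).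

(* f i j is the integral part of p_j - p_i for points p_i which are pairwise
   different modulo 1. *)
Definition alcove f : Prop :=
  [/\ forall i, f i i = 0, forall i j, i != j -> f i j + f j i = -1
    & forall i j k, f i j + f j k <= f i k].

Lemma alcoveN f i j : alcove f -> i != j -> f j i = - 1 - f i j.
Proof. by case=> _ H _ /H; clear; lia. Qed.

Lemma alcove_le f i j k : alcove f -> f i j + f j k <= f i k.
Proof. by case. Qed.

Lemma alcove_ge f i j k : alcove f -> f i k <= f i j + f j k + 1.
Proof.
case=> f0 fN fT; have [->|jk] := eqVneq j k; first by rewrite f0; lia.
by have := fT i k j; have := fN _ _ jk; clear; lia.
Qed.

(* The paper's M(R_i, R_j). *)
Definition wt r f i j : int :=
  Num.max 0 (Num.min (Num.min (r i)%:Z (r j)%:Z)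
                     (Num.min ((r i)%:Z - f i j) ((r j)%:Z - f j i))).

Lemma wtC r f i j : wt r f i j = wt r f j i.
Proof. rewrite /wt; lia. Qed.

Lemma wt_ge0 r f i j : 0 <= wt r f i j.
Proof. rewrite /wt; lia. Qed.

Lemma wt_le r f i j : wt r f i j <= Num.min (r i)%:Z (r j)%:Z.
Proof. rewrite /wt; lia. Qed.

Definition crossed f f' i j : Prop :=
  [/\ f' i j = f i j + 1, f' j i = f j i - 1
    & forall k l, ~~ ((k == i) && (l == j)) -> ~~ ((k == j) && (l == i)) ->
      f' k l = f k l].

Definition adjacent f f' i j : Prop :=
  [/\ alcove f, alcove f', i != j & crossed f f' i j].

Lemma adjacentC f f' i j : adjacent f f' i j -> adjacent f' f j i.
Proof.
case=> Af Af' ij [c1 c2 c3]; split; rewrite // 1?eq_sym //; split.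
- by rewrite c2; lia.
- by rewrite c1; lia.
- by move=> k l kl lk; rewrite c3.
Qed.

Lemma adjacent_other f f' i j k : adjacent f f' i j -> k != i -> k != j ->
  [/\ f' k i = f k i, f' i k = f i k, f' k j = f k j & f' j k = f j k].
Proof.
by case=> _ _ ij [_ _ c3] /negPf ki /negPf kj; split; apply: c3;
  rewrite ?ki ?kj ?andbF.
Qed.

(** The distances to [k] are the same on both sides of the wall while that of [i] and [j] grows by
    one. The lower triangle bound before and the upper one after leave a single value. *)
Lemma adjacent_split f f' i j k : adjacent f f' i j -> k != i -> k != j ->
  f i j = f i k + f k j.
Proof.
move=> A ki kj; have [_ e1 e2 _] := adjacent_other A ki kj.
case: A => Af Af' ij [c1 _ _].
have := alcove_le i k j Af; have := alcove_ge i k j Af'; rewrite c1 e1 e2.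
by clear; lia.
Qed.

Definition cross f i j : I -> I -> int := fun a b =>
  f a b + ((a == i) && (b == j))%:Z - ((a == j) && (b == i))%:Z.

Lemma adjacent_cross f i j : alcove f -> i != j ->
    (forall k, k != i -> k != j -> f i j = f i k + f k j) ->
  adjacent f (cross f i j) i j.
Proof.
move=> Af ij fk; have ji : j != i by rewrite eq_sym.
have crE : crossed f (cross f i j) i j.
  split; rewrite /cross ?eqxx ?(negPf ij) ?(negPf ji) /= ?subr0 ?addr0 //.
  by move=> k l /negPf-> /negPf->; rewrite addr0 subr0.
split=> //; case: crE => c1 c2 c3.
have [f0 fN fT] := Af.
have cd k : cross f i j k k = 0.
  rewrite c3 ?f0 //; first by apply/negP => /andP[/eqP-> /eqP e]; rewrite e eqxx in ij.
  by apply/negP => /andP[/eqP-> /eqP e]; rewrite e eqxx in ij.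
have co k : k != i -> k != j ->
  [/\ cross f i j k i = f k i, cross f i j i k = f i k,
      cross f i j k j = f k j & cross f i j j k = f j k].
  by move=> /negPf ki /negPf kj; split; apply: c3; rewrite ?ki ?kj ?andbF.
have cN a b : a != b -> cross f i j a b + cross f i j b a = -1.
  move=> ab; have := fN _ _ ab; rewrite /cross; clear; do 4!case: eqP => _; lia.
split=> // a b c.
have [->|ab] := eqVneq a b; first by rewrite cd add0r.
have [->|bc] := eqVneq b c; first by rewrite cd addr0.
have [<-|ac] := eqVneq a c; first by rewrite cd cN.
have Tabc := fT a b c; have eab := fN _ _ ab; have ebc := fN _ _ bc.
have eac := fN _ _ ac.
have eij := fN _ _ ij.
have [ai|ai] := eqVneq a i.
  subst a; have [bj|bj] := eqVneq b j.
    subst b; rewrite eq_sym in ac; rewrite eq_sym in bc.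
    have [_ -> _ ->] := co c ac bc; rewrite c1 (fk c ac bc).
    by clear - ebc; lia.
  rewrite eq_sym in ab; have [_ -> b2 b3] := co b ab bj.
  have [cj|cj] := eqVneq c j.
    by subst c; rewrite b2 c1; clear - Tabc; lia.
  rewrite eq_sym in ac; have [_ -> _ _] := co c ac cj.
  rewrite (c3 b c) ?(negPf ab) ?(negPf bj) //.
have [aj|aj] := eqVneq a j.
  subst a; have [bi|bi] := eqVneq b i.
    subst b; rewrite eq_sym in ac; rewrite eq_sym in bc.
    have [_ -> _ ->] := co c bc ac; rewrite c2.
    by clear - Tabc; lia.
  rewrite eq_sym in ab; have [b2 b3 _ ->] := co b bi ab.
  have [ci|ci] := eqVneq c i.
    subst c; rewrite b2 c2; have := fk b bi ab; rewrite eq_sym in ab; have := fN _ _ ab.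
    by clear - eij ebc; lia.
  rewrite eq_sym in ac; have [_ _ _ ->] := co c ci ac.
  by rewrite (c3 b c) ?(negPf ab) ?(negPf bi).
rewrite (c3 a b) ?(negPf ai) ?(negPf aj) // (c3 a c) ?(negPf ai) ?(negPf aj) //.
have [bi|bi] := eqVneq b i.
  subst b; have [cj|cj] := eqVneq c j.
    subst c; rewrite c1; have := fk a ai aj; clear - eab; lia.
  by rewrite eq_sym in bc; have [_ -> _ _] := co c bc cj.
have [bj|bj] := eqVneq b j.
  subst b; have [ci|ci] := eqVneq c i.
    subst c; rewrite c2; clear - Tabc; lia.
  by rewrite eq_sym in bc; have [_ _ _ ->] := co c ci bc.
by rewrite (c3 b c) ?(negPf bi) ?(negPf bj).
Qed.

(* Among the pairs to be raised towards g, one with the fewest rows k whose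
   start lies, modulo 1, strictly between the starts of i and j has none. *)
Lemma exists_cross f g : alcove f -> alcove g ->
    (exists i j, f i j != g i j) ->
  exists i j, [/\ i != j, f i j < g i j
    & forall k, k != i -> k != j -> f i j = f i k + f k j].
Proof.
move=> Af Ag [a [b ab]].
have [f0 fN fT] := Af; have [g0 gN gT] := Ag.
pose B (p : I * I) := #|[set k | f p.1 k + f k p.2 < f p.1 p.2]|.
have [p0 p0P] : exists p : I * I, f p.1 p.2 < g p.1 p.2.
  have nab : a != b by apply: contraNneq ab => ->; rewrite f0 g0.
  case: (ltgtP (f a b) (g a b)) ab => // [lt|gt] _; first by exists (a, b).
  exists (b, a) => /=; have := fN _ _ nab; have := gN _ _ nab; move: gt; clear; lia.
case: (@arg_minnP _ p0 (fun p => f p.1 p.2 < g p.1 p.2) B p0P) => -[i j] /= ltij minB.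
have ij : i != j by apply: contraTneq ltij => ->; rewrite f0 g0.
exists i, j; split=> // k ki kj; apply/eqP; rewrite eq_le fT andbT leNgt.
apply/negP => ltk.
have Bdec p : (p == (i, k)) || (p == (k, j)) -> (B p < B (i, j))%N.
  move=> pE; apply: proper_card; apply/properP; split; last first.
    exists k; rewrite ?inE //=.
    by case/orP: pE => /eqP-> /=; rewrite f0 ?addr0 ?add0r ltxx.
  apply/subsetP => l; rewrite !inE.
  case/orP: pE => /eqP-> /= ltl.
    by have := alcove_ge l k j Af; move: ltl ltk; clear; lia.
  by have := alcove_ge i k l Af; move: ltl ltk; clear; lia.
have nik : g i k <= f i k.
  rewrite leNgt; apply/negP => lt; have := minB (i, k) lt.
  by rewrite leqNgt Bdec ?eqxx.
have nkj : g k j <= f k j.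
  rewrite leNgt; apply/negP => lt; have := minB (k, j) lt.
  by rewrite leqNgt Bdec ?eqxx ?orbT.
by have := alcove_ge i k j Ag; move: nik nkj ltk ltij; clear; lia.
Qed.

End Alcoves.

(** * Walls where a weight changes *)

Section Contraction.
Variable I : finType.
Implicit Types (f g h : I -> I -> int) (r : I -> nat) (i j k : I).

(* Row i starts m cells left of row j and ends inside row j. *)
Definition straddle r (m : int) i j : Prop :=
  [/\ 0 < m, m <= (r i)%:Z & (r i)%:Z < m + (r j)%:Z].

Lemma adjacent_neq_wt r f f' i j : adjacent f f' i j ->
    wt r f i j != wt r f' i j ->
  (straddle r (f' i j) i j /\ wt r f i j = wt r f' i j + 1)
  \/ (straddle r (f j i) j i /\ wt r f' i j = wt r f i j + 1).
Proof.
case=> Af _ ij [c1 c2 _]; have := alcoveN Af ij.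
rewrite /straddle /wt c1 c2 => fji ne.
have [m1|m1] := lerP 0 (f i j); [left|right].
  suff: 0 < f i j + 1 /\ f i j + 1 <= (r i)%:Z /\ (r i)%:Z < f i j + 1 + (r j)%:Z.
    by case=> -> [] -> ->; split=> //; move: fji ne m1; clear; lia.
  by move: fji ne m1; clear; lia.
suff: 0 < f j i /\ f j i <= (r j)%:Z /\ (r j)%:Z < f j i + (r i)%:Z.
  by case=> -> [] -> ->; split=> //; move: fji ne m1; clear; lia.
by move: fji ne m1; clear; lia.
Qed.

Lemma straddle_wt r f f' i j : adjacent f f' i j -> straddle r (f' i j) i j ->
  wt r f' i j = (r i)%:Z - f' i j /\ wt r f i j = wt r f' i j + 1.
Proof.
case=> Af _ ij [c1 c2 _]; have := alcoveN Af ij.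
rewrite /straddle /wt c1 c2 => fji [s1 s2 s3].
by split; move: fji s1 s2 s3; clear; lia.
Qed.

(* The rows i and j are replaced by their union and their intersection; the
   new weights are given by the old ones. *)
Lemma wt_contract r f f' i j k : adjacent f f' i j -> straddle r (f' i j) i j ->
    k != i -> k != j ->
  let r' := swap_at i j (absz (f' i j)) r in
  let c := Num.min (wt r f' i j) (Num.min (wt r f' k i) (wt r f' k j)) in
  wt r' f' k j = c /\
  wt r' f' k i = Num.min (r k)%:Z (wt r f' k i + wt r f' k j - c).
Proof.
move=> A S ki kj r' c; have [wij _] := straddle_wt A S.
have [Af Af' ij [c1 c2 _]] := A.
have [e1 e2 e3 e4] := adjacent_other A ki kj; have spl := adjacent_split A ki kj.
have nki := alcoveN Af ki; have nkj := alcoveN Af kj.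
have [s1 s2 s3] := S.
have ri : (r' i)%:Z = f' i j + (r j)%:Z.
  by rewrite /r' /swap_at eqxx; move: s1; clear; lia.
have rj : (r' j)%:Z = (r i)%:Z - f' i j.
  by rewrite /r' /swap_at eqxx eq_sym (negPf ij); move: s1 s2; clear; lia.
have rk : r' k = r k by rewrite /r' /swap_at (negPf ki) (negPf kj).
rewrite /c wij /wt e1 e2 e3 e4 ri rj rk nki nkj.
have -> : f k j = f k i + f' i j.
  by move: nki spl c1; clear; lia.
move: (f k i) (f' i j) s1 s2 s3 => x m; clear; move: (r i) (r j) (r k) => a b d.
move=> m0 ma amb.
have pos (a' x' : int) : 0 <= a' -> 0 <= x' ->
    Num.max 0 (Num.min (Num.min d%:Z a') (Num.min (d%:Z - x') (a' - (- 1 - x'))))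
    = Num.max 0 (Num.min a' (d%:Z - x')) by clear; lia.
have neg (a' x' : int) : 0 <= a' -> x' < 0 ->
    Num.max 0 (Num.min (Num.min d%:Z a') (Num.min (d%:Z - x') (a' - (- 1 - x'))))
    = Num.max 0 (Num.min d%:Z (a' + 1 + x')) by clear; lia.
have [a0 b0 c0 d0] : [/\ 0 <= a%:Z, 0 <= b%:Z, 0 <= a%:Z - m & 0 <= m + b%:Z].
  by split; move: m0 ma; clear; lia.
have [x0|x0] := lerP 0 x.
  have xm0 : 0 <= x + m by move: x0 m0; clear; lia.
  by rewrite !pos //; clear - m0 ma amb x0; split; lia.
have [y0|y0] := lerP 0 (x + m).
  rewrite (neg a%:Z x) // (pos b%:Z (x + m)) // (pos (a%:Z - m)) // (neg (m + b%:Z)) //.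
  by clear - m0 ma amb x0 y0; split; lia.
by rewrite !neg //; clear - m0 ma amb x0 y0; split; lia.
Qed.

Lemma wt_contract_pair r f f' i j : adjacent f f' i j -> straddle r (f' i j) i j ->
  wt (swap_at i j (absz (f' i j)) r) f' i j = wt r f' i j.
Proof.
move=> A S; have [wij _] := straddle_wt A S.
have [Af Af' ij [c1 c2 _]] := A; have nij := alcoveN Af' ij.
have [s1 s2 s3] := S; rewrite wij /wt nij /swap_at !eqxx [j == i]eq_sym (negPf ij).
move: s1 s2 s3; move: (f' i j) => m; clear; lia.
Qed.

End Contraction.

(** * Paths of alcoves *)

Section Gallery.
Variables (R : idomainType) (q : R) (L : nat) (xs : seq R).
Variable I : finType.
Implicit Types (f g h : I -> I -> int) (r : I -> nat) (i j k : I).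

Let LS f r := letter_sum q L f xs r.

Lemma adjacent_sum f f' i j (m : nat) r : adjacent f f' i j -> f' i j = m ->
    (\sum_k r k < L)%N ->
  LS f r = if (m <= r i)%N && (r i < m + r j)%N then
      q * LS f' r + (1 - q) * LS f' (swap_at i j m r) else LS f' r.
Proof.
move=> A fm rL; have A' := A; case: A' => Af Af' ij [c1 c2 c3].
have nij := alcoveN Af ij.
apply: letter_sum_cross => //.
- by rewrite -fm c1; clear; lia.
- by rewrite -fm c1 nij; clear; lia.
- by rewrite c2 nij -fm c1; clear; lia.
- by move=> k l kl lk; rewrite c3.
- move=> k ki kj; rewrite (alcoveN Af (i := k)) // -fm c1 (adjacent_split A ki kj).
  by clear; lia.
- move=> k ki kj; rewrite (alcoveN Af (i := i)) 1?eq_sym // -fm c1.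
  by rewrite (adjacent_split A ki kj); clear; lia.
Qed.

Lemma adjacent_straddle f f' i j r : adjacent f f' i j -> straddle r (f' i j) i j ->
    (\sum_k r k < L)%N ->
  LS f r = q * LS f' r + (1 - q) * LS f' (swap_at i j (absz (f' i j)) r).
Proof.
move=> A [s1 s2 s3] rL; rewrite (adjacent_sum (m := absz (f' i j)) A) //; last first.
  by move: s1; clear; lia.
have -> : (absz (f' i j) <= r i)%N && (r i < absz (f' i j) + r j)%N.
  by move: s1 s2 s3; clear; lia.
by [].
Qed.

Lemma adjacent_eq f f' i j r : adjacent f f' i j -> wt r f i j = wt r f' i j ->
  (\sum_k r k < L)%N -> LS f r = LS f' r.
Proof.
wlog m0 : f f' i j / 0 <= f' i j => [wl A ew rL|A ew rL].
  have [f0|f0] := lerP 0 (f' i j); first exact: (wl _ _ i j).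
  apply/esym; apply: (wl _ _ j i) => //; first last.
  - by rewrite wtC -ew wtC.
  - exact: adjacentC.
  case: A => Af _ ij [c1 _ _]; rewrite (alcoveN Af ij).
  by move: f0; rewrite c1; clear; lia.
have [Af Af' ij [c1 c2 _]] := A.
have fij : f' i j = absz (f' i j) by move: m0; clear; lia.
rewrite (adjacent_sum A fij rL); case: ifP => // cnd.
(* For [f' i j > 0] the condition is [straddle], which changes the weight. At distance 0 the formula
   for the opposite crossing is used instead: it has no second term because row [j] is the longer
   one. *)
have f'0 : f' i j = 0.
  move: ew cnd; rewrite /wt c2 (alcoveN Af ij) c1 in m0 *; move: m0; clear; lia.
have fji : f j i = 0%N by rewrite (alcoveN Af ij); move: c1 f'0; clear; lia.
rewrite -[RHS]mul1r.
have ri : (r i < r j)%N by move: cnd; rewrite f'0 /=.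
have e2 := adjacent_sum (adjacentC A) fji rL.
have ef : LS f' r = LS f r.
  by rewrite e2; case: ifP => // /andP[_]; rewrite add0n ltnNge ltnW.
have := adjacent_sum A fij rL; rewrite cnd -ef => <-.
by rewrite mul1r.
Qed.

Definition between f g h : Prop :=
  forall i j, Num.min (f i j) (h i j) <= g i j <= Num.max (f i j) (h i j).

(* A path of adjacent alcoves from f to g, followed up to the first wall where
   some weight changes. *)
Lemma gallery f g r : alcove f -> alcove g -> (\sum_k r k < L)%N ->
  (LS f r = LS g r /\ forall i j, i != j -> wt r f i j = wt r g i j)
  \/ exists f1 f2 i j,
     [/\ adjacent f1 f2 i j, between f f1 g /\ between f f2 g,
         LS f r = LS f1 r, (forall k l, k != l -> wt r f k l = wt r f1 k l)
       & wt r f1 i j != wt r f2 i j /\ f1 i j < g i j].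
Proof.
move=> + Ag rL.
have [n] := ubnP (\sum_i \sum_j absz (f i j - g i j)); elim: n f => // n IH f.
rewrite ltnS => le_n Af.
case: (boolP [exists i, exists j, f i j != g i j]) => [/existsP[a /existsP[b ab]]|]; last first.
  rewrite negb_exists => /forallP H; left.
  have e i j : f i j = g i j.
    by have := H i; rewrite negb_exists => /forallP/(_ j); rewrite negbK => /eqP.
  by split=> [|i j _]; [apply: eq_letter_sum | rewrite /wt !e].
have [|i [j [ij lt_ij fk]]] := exists_cross Af Ag; first by exists a, b.
have A := adjacent_cross Af ij fk; set f' := cross f i j in A.
have [_ Af' _ [c1 c2 c3]] := A.
have bt h : between f' h g -> between f h g.
  move=> H k l; have := H k l.
  case: (boolP ((k == i) && (l == j))) => [/andP[/eqP-> /eqP->]|kl].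
    by rewrite c1; move: lt_ij; clear; lia.
  case: (boolP ((k == j) && (l == i))) => [/andP[/eqP-> /eqP->]|lk].
    by rewrite c2 (alcoveN Af ij) (alcoveN Ag ij); move: lt_ij; clear; lia.
  by rewrite c3.
have bff' : between f f' g by apply: bt => k l; clear; lia.
case: (eqVneq (wt r f i j) (wt r f' i j)) => [ew|nw]; last first.
  right; exists f, f', i, j; split=> //; split=> // k l; clear; lia.
have ew' k l : k != l -> wt r f k l = wt r f' k l.
  move=> nkl; case: (boolP ((k == i) && (l == j))) => [/andP[/eqP-> /eqP->]//|kl].
  case: (boolP ((k == j) && (l == i))) => [/andP[/eqP-> /eqP->]|lk].
    by rewrite wtC ew wtC.
  by rewrite /wt !c3 // andbC.
have eLS := adjacent_eq A ew rL.
have dec : (\sum_i \sum_j absz (f' i j - g i j) < n)%N.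
  apply: leq_trans le_n; rewrite (bigD1 i) //= [X in (_ < X)%N](bigD1 i) //=.
  rewrite (bigD1 j) //= [X in (_ < X + _)%N](bigD1 j) //=.
  have le1 : (\sum_(l | l != j) absz (f' i l - g i l) <=
             \sum_(l | l != j) absz (f i l - g i l))%N.
    apply: leq_sum => l lj; rewrite c3 //; first by rewrite (negPf lj) andbF.
    by rewrite (negPf ij).
  have le2 : (\sum_(k | k != i) \sum_l absz (f' k l - g k l) <=
             \sum_(k | k != i) \sum_l absz (f k l - g k l))%N.
    apply: leq_sum => k ki; apply: leq_sum => l _.
    case: (boolP ((k == j) && (l == i))) => [/andP[/eqP-> /eqP->]|lk].
      by rewrite c2 (alcoveN Af ij) (alcoveN Ag ij); move: lt_ij; clear; lia.
    by rewrite c3 // (negPf ki).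
  by move: le1 le2 lt_ij; rewrite c1; clear; lia.
have [[e1 e2]|[f1 [f2 [k [l [B1 [B2 B3] B4 B5 B6]]]]]] := IH f' dec Af'.
  by left; split=> [|k l kl]; [rewrite eLS | rewrite ew' // e2].
right; exists f1, f2, k, l; split; rewrite ?eLS //; first by split; apply: bt.
by move=> k' l' kl'; rewrite ew' // B5.
Qed.

End Gallery.

(** * Mirroring *)

Section Positions.
Variable I : finType.
Implicit Types (f g h : I -> I -> int) (r : I -> nat) (i j k : I).

Lemma alcove_of_positions (N : int) (p : I -> int) : 0 < N ->
    (forall i j, i != j -> ~~ (N %| p j - p i)%Z) ->
  alcove (fun i j => ((p j - p i) %/ N)%Z).
Proof.
move=> N0 ndiv; have N' : N != 0 by rewrite gt_eqF.
split=> [i|i j ij|i j k].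
- by rewrite subrr div0z.
- have e1 := divz_eq (p j - p i) N; have e2 := divz_eq (p i - p j) N.
  have l1 : 0 < ((p j - p i) %% N)%Z.
    by rewrite lt_neqAle modz_ge0 // eq_sym andbT; apply: contra (ndiv _ _ ij) => /eqP/dvdz_mod0P.
  have l2 : 0 < ((p i - p j) %% N)%Z.
    rewrite lt_neqAle modz_ge0 // eq_sym andbT; apply/negP => /eqP/dvdz_mod0P.
    by rewrite -[p i - p j]opprB rpredN; apply/negP/ndiv.
  have u1 := ltz_pmod (p j - p i) N0; have u2 := ltz_pmod (p i - p j) N0.
  move: ((p j - p i) %/ N)%Z ((p i - p j) %/ N)%Z e1 e2 => x y e1 e2.
  have lo : - 2 * N < (x + y) * N by move: e1 e2 u1 u2; clear; lia.
  have hi : (x + y) * N < 0 * N by move: e1 e2 l1 l2; clear; lia.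
  by rewrite !ltr_pM2r // in lo hi; move: lo hi; clear; lia.
- rewrite lez_divRL //; have := lez_floor (p j - p i) N'; have := lez_floor (p k - p j) N'.
  by clear; lia.
Qed.

(* The positions p_i realize the alcove at scale #|I|. *)
Definition position f i : int := \sum_k f k i.

(** Each [f k j - f k i] is [f i j] or [f i j + 1] by the triangle bounds. The terms for [k = j] and
    [k = i] make the lower and the upper inequality strict. *)
Lemma position_bounds f i j : alcove f -> i != j ->
  #|I|%:Z * f i j < position f j - position f i < #|I|%:Z * f i j + #|I|%:Z.
Proof.
move=> Af ij; have [f0 fN fT] := Af.
have cI c : \sum_(k : I) (c : int) = #|I|%:Z * c by rewrite sumr_const -mulr_natl natz.
have -> : position f j - position f i = \sum_k (f k j - f k i).
  by rewrite /position -sumrB.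
rewrite -[X in _ + X]mulr1 -!cI -big_split /= -subr_gt0 -sumrB -[X in _ && X]subr_gt0 -sumrB.
apply/andP; split.
  rewrite (bigD1 j) //= f0 ltr_wpDr //; last by have := fN _ _ ij; clear; lia.
  by apply: sumr_ge0 => k _; have := fT k i j; clear; lia.
rewrite (bigD1 i) //= f0 ltr_wpDr //; last by clear; lia.
by apply: sumr_ge0 => k _; have := alcove_ge k i j Af; clear; lia.
Qed.

Lemma position_mul f i j (c : int) : alcove f -> i != j ->
  (c <= f i j -> #|I|%:Z * c < position f j - position f i) /\
  (f i j <= c -> position f j - position f i < #|I|%:Z * c + #|I|%:Z).
Proof.
move=> Af ij; have /andP[lo hi] := position_bounds Af ij.
have N0 : 0 <= #|I|%:Z by [].
split=> le.
  by apply: le_lt_trans lo; rewrite ler_wpM2l.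
by apply: lt_le_trans hi _; rewrite lerD2r ler_wpM2l.
Qed.

Lemma position_lt f i j : alcove f -> i != j ->
  (0 <= f i j) = (position f i < position f j).
Proof.
move=> Af ij; have [h1 _] := position_mul 0 Af ij; have [_ h2] := position_mul (-1) Af ij.
apply/idP/idP => [/h1|lt]; first by clear; lia.
rewrite leNgt; apply/negP => lt0; have : f i j <= -1 by move: lt0; clear; lia.
by move/h2; move: lt; clear; lia.
Qed.

Section Mirror.
Variable r : I -> nat.
Implicit Types T : {set I}.

Definition left_of f T k : Prop := {in T, forall x, (r k)%:Z <= f k x}.
Definition right_of f T k : Prop := {in T, forall x, (r x)%:Z <= f x k}.
Definition outer_of f T k : Prop := {in T, forall x,
  [/\ (r x <= r k)%N, -1 <= f k x & (r x)%:Z - (r k)%:Z - 1 <= f x k]}.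

(* Every nonempty row outside T is disjoint from the rows of T, on one side of
   all of them, or contains them all up to less than one cell at each end. *)
Definition encapsulated f T : Prop := forall k, k \notin T -> (0 < r k)%N ->
  [\/ left_of f T k, right_of f T k | outer_of f T k].

(** Reflected, row [x] starts at [C - p_x - r x] for a constant [C]. The starts of [y] and [x] then
    differ by [r x - r y + p_x - p_y], whence the formula inside [T]. Towards outside rows only the
    side, or the containment, is prescribed. *)
Definition mirrored f T f' : Prop :=
  [/\ alcove f',
      {in T &, forall x y, x != y -> f' x y = (r x)%:Z - (r y)%:Z + f y x},
      (forall k l, k \notin T -> l \notin T -> f' k l = f k l)
    & forall k, k \notin T ->
        [/\ left_of f T k -> left_of f' T k, right_of f T k -> right_of f' T k
          & outer_of f T k -> outer_of f' T k]].

Lemma exists_mirrored f T : alcove f -> T != set0 -> exists f', mirrored f T f'.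
Proof.
move=> Af /set0Pn[t tT]; set N := #|I|%:Z; have N0 : 0 < N.
  by rewrite /N ltz_nat; apply/card_gt0P; exists t.
pose p := position f; pose e x := p x + N * (r x)%:Z.
case: (@Order.TotalTheory.arg_minP _ _ _ t (fun x => x \in T) p tT) => a aT a_min.
case: (@Order.TotalTheory.arg_maxP _ _ _ t (fun x => x \in T) e tT) => b bT b_max.
(* The reflection exchanges the first start [p a] and the last end [e b], so [T] stays in the same
   interval. Doubled positions keep the rows outside [T] even and make the reflected ones odd, so
   that they never agree modulo [2 * N]; the strict bounds on positions absorb the half unit. *)
pose C := p a + e b.
pose P x := if x \in T then 2 * C + 1 - 2 * e x else 2 * p x.
have N20 : 0 < 2 * N by rewrite mulr_gt0.
have N2 : 2 * N != 0 by rewrite gt_eqF.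
have dvd2 (x : int) : (2 * N %| 2 * x)%Z = (N %| x)%Z by rewrite dvdz_mul2l.
have div2 (x : int) : (2 * x %/ (2 * N))%Z = (x %/ N)%Z by rewrite divzMpl.
have ndvd i j : i != j -> ~~ (N %| p j - p i)%Z.
  move=> ij; have /andP[lo hi] := position_bounds Af ij.
  apply/negP => /dvdzP[c ec]; rewrite -/(p i) -/(p j) ec [c * _]mulrC in lo hi.
  have {}hi : N * c < N * (f i j + 1) by rewrite mulrDr mulr1.
  by rewrite !(ltr_pM2l N0) in lo hi; move: lo hi; clear; lia.
have odd_ndvd (x : int) : ~~ (2 * N %| 2 * x + 1)%Z.
  by apply/negP => /dvdzP[c]; rewrite mulrCA => ec; move: (c * N) ec => d; clear; lia.
have PT x y : x \in T -> y \in T ->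
    P y - P x = 2 * ((r x)%:Z - (r y)%:Z) * N + 2 * (p x - p y).
  by move=> xT yT; rewrite /P xT yT /e; ring.
have fE i j : i != j -> ((p j - p i) %/ N)%Z = f i j.
  move=> ij; have /andP[lo hi] := position_bounds Af ij.
  apply/eqP; rewrite eq_le lez_divRL // mulrC (ltW lo) andbT.
  by rewrite -ltzD1 ltNge lez_divRL // -ltNge mulrDl mul1r [_ * N]mulrC.
exists (fun i j => ((P j - P i) %/ (2 * N))%Z).
have fx c i j : (c <= ((P j - P i) %/ (2 * N))%Z) = (2 * (N * c) <= P j - P i).
  by rewrite lez_divRL // mulrC mulrA.
split.
- apply: alcove_of_positions => // i j ij; rewrite /P.
  case: (boolP (i \in T)) => iT; case: (boolP (j \in T)) => jT.
  + have -> : 2 * C + 1 - 2 * e j - (2 * C + 1 - 2 * e i) =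
       ((r i)%:Z - (r j)%:Z) * (2 * N) + 2 * (p i - p j) by rewrite /e; ring.
    by rewrite (rpredDl _ (dvdz_mull _ (dvdzz _))) dvd2 ndvd // eq_sym.
  + have -> : 2 * p j - (2 * C + 1 - 2 * e i) = 2 * (p j - C + e i - 1) + 1 by ring.
    exact: odd_ndvd.
  + have -> : 2 * C + 1 - 2 * e j - 2 * p i = 2 * (C - e j - p i) + 1 by ring.
    exact: odd_ndvd.
  + by rewrite -mulrBr dvd2 ndvd.
- move=> x y xT yT xy; rewrite PT //.
  have -> : 2 * ((r x)%:Z - (r y)%:Z) * N = ((r x)%:Z - (r y)%:Z) * (2 * N) by ring.
  by rewrite divzMDl // div2 fE // eq_sym.
- move=> k l kT lT; rewrite /P (negPf kT) (negPf lT) -mulrBr div2.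
  have [->|kl] := eqVneq k l; last exact: fE.
  by rewrite subrr div0z; have [-> _ _] := Af.
move=> k kT.
have neq x : x \in T -> k != x by move=> xT; apply: contraNneq kT => ->.
have neq' x : x \in T -> x != k by move=> xT; rewrite eq_sym neq.
have PK : P k = 2 * p k by rewrite /P (negPf kT).
have PX x : x \in T -> P x = 2 * C + 1 - 2 * e x by rewrite /P => ->.
split=> H x xT.
- rewrite fx PK PX //; have [h _] := position_mul (r k)%:Z Af (neq _ aT).
  have := h (H _ aT); have := b_max x xT; rewrite /C -/N -/(p a) -/(p k).
  by move: (N * _) => ?; clear; lia.
- rewrite fx PK PX //; have [h _] := position_mul (r b)%:Z Af (neq' _ bT).
  have := h (H _ bT); have := a_min x xT; rewrite /C /e -/N -/(p b) -/(p k).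
  by move: (N * (r b)%:Z) (N * (r x)%:Z) => ? ?; clear; lia.
have [h1 h2 h3] := H x xT; split=> //.
- rewrite fx PK PX //; have [_ hh _] := H a aT.
  have [h _] := position_mul (-1) Af (neq _ aT).
  have := h hh; have := b_max x xT; rewrite /C -/N -/(p a) -/(p k) mulrN1.
  by clear; lia.
- rewrite fx PK PX //; have [_ _ hh] := H b bT.
  have [h _] := position_mul ((r b)%:Z - (r k)%:Z - 1) Af (neq' _ bT).
  have := h hh; have := a_min x xT; rewrite /C /e -/N -/(p b) -/(p k) !mulrBr mulr1.
  by move: (N * (r b)%:Z) (N * (r x)%:Z) (N * (r k)%:Z) => ? ? ?; clear; lia.
Qed.

End Mirror.
End Positions.

(** * Relative order of two rows *)

Section Types.
Variable I : finType.
Variable r : I -> nat.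
Implicit Types (f g h : I -> I -> int) (i j k : I) (T : {set I}).

(* Row i starts and ends at least one cell left of row j. For nonempty rows,
   two rows are incomparable when their weight is the smaller length. *)
Definition precedes f i j : bool :=
  (1 <= f i j) && ((r i)%:Z - (r j)%:Z + 1 <= f i j).

Definition same_type f g i j : Prop :=
  [/\ wt r f i j = wt r g i j, precedes f i j = precedes g i j
    & precedes f j i = precedes g j i].

Lemma same_typeC f g i j : same_type f g i j -> same_type f g j i.
Proof. by case=> e1 e2 e3; split=> //; rewrite [LHS]wtC [RHS]wtC. Qed.

Lemma same_type_sym f g i j : same_type f g i j -> same_type g f i j.
Proof. by case. Qed.

Lemma same_type_trans f g h i j :
  same_type f g i j -> same_type g h i j -> same_type f h i j.
Proof. by case=> e1 e2 e3 [e4 e5 e6]; split; rewrite ?e1 ?e2 ?e3. Qed.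

Lemma wt_precedes f i j : alcove f -> i != j -> precedes f i j ->
  wt r f i j = Num.max 0 ((r i)%:Z - f i j).
Proof.
move=> Af ij /andP[]; rewrite /wt (alcoveN Af ij).
by move: (f i j) (r i) (r j); clear; lia.
Qed.

Lemma wt_incomparable f i j : alcove f -> i != j ->
    ~~ precedes f i j -> ~~ precedes f j i ->
  wt r f i j = Num.min (r i)%:Z (r j)%:Z.
Proof.
move=> Af ij; rewrite /wt /precedes (alcoveN Af ij).
by move: (f i j) (r i) (r j); clear; lia.
Qed.

Lemma precedes_lt f i j : alcove f -> i != j -> (0 < r i)%N -> (0 < r j)%N ->
  precedes f i j -> wt r f i j < Num.min (r i)%:Z (r j)%:Z.
Proof.
move=> Af ij ri rj pij; rewrite wt_precedes //; move: ri rj pij; rewrite /precedes.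
by move: (f i j) (r i) (r j); clear; lia.
Qed.

Lemma precedes_asym f i j : alcove f -> i != j -> precedes f i j -> ~~ precedes f j i.
Proof.
by move=> Af ij; rewrite /precedes (alcoveN Af ij); move: (f i j); clear; lia.
Qed.

(** The values of [f i j] making [i] and [j] incomparable form an interval on which the weight is
    constant, and those with [i] before [j] an interval on which it is monotone. *)
Lemma between_wt f g h i j : alcove f -> alcove g -> alcove h -> i != j ->
    between f g h -> same_type f h i j ->
  wt r g i j = wt r f i j.
Proof.
move=> Af Ag Ah + b; wlog pij : i j / ~~ precedes f j i => [wl ij|ij].
  have [|pji] := boolP (precedes f j i); last exact: wl.
  move/(precedes_asym Af); rewrite eq_sym ij => /(_ isT) pij /same_typeC st.
  by rewrite wtC [RHS]wtC; apply: wl st; rewrite 1?eq_sym.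
case: (boolP (precedes f i j)) => [pf|npf] [ew /esym e1 e2]; last first.
  rewrite [RHS]wt_incomparable //; apply: wt_incomparable => //.
    have := b i j; move: npf e1; rewrite /precedes; clear; lia.
  have := b j i; move: pij e2; rewrite /precedes; clear; lia.
have pg : precedes g i j by have := b i j; move: pf e1; rewrite /precedes; clear; lia.
move: ew; rewrite !wt_precedes //; last by rewrite e1.
by have := b i j; move: (f i j) (g i j) (h i j); clear; lia.
Qed.

Lemma wt_empty f i j : (r i == 0%N) || (r j == 0%N) -> wt r f i j = 0.
Proof. rewrite /wt; lia. Qed.

Lemma left_same f g i j : alcove f -> alcove g -> i != j -> (0 < r i)%N -> (0 < r j)%N ->
  (r i)%:Z <= f i j -> (r i)%:Z <= g i j -> same_type f g i j.
Proof.
move=> Af Ag ij ri rj; rewrite /same_type /precedes /wt !(alcoveN _ ij) //.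
by move: ri rj; clear => ri rj fi gi; split; lia.
Qed.

Lemma outer_same f g i j : alcove f -> alcove g -> i != j -> (r j <= r i)%N ->
    (0 < r j)%N ->
    -1 <= f i j -> (r j)%:Z - (r i)%:Z - 1 <= f j i ->
    -1 <= g i j -> (r j)%:Z - (r i)%:Z - 1 <= g j i ->
  same_type f g i j.
Proof.
move=> Af Ag ij rij rj; rewrite /same_type /precedes /wt !(alcoveN _ ij) //.
by move: rij rj; clear => rij rj fi fj gi gj; split; lia.
Qed.

End Types.

(** * Equal types and opposite walls *)

Section SameType.
Variables (R : idomainType) (q : R) (L : nat) (xs : seq R) (I : finType).
Implicit Types (f g h : I -> I -> int) (r : I -> nat) (i j k : I).

(** By [between_wt] no weight changes on the way from [f] to [g], which excludes the second outcome
    of [gallery]. *)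
Lemma same_type_sum f g r : alcove f -> alcove g -> (\sum_k r k < L)%N ->
    (forall i j, i != j -> (0 < r i)%N -> (0 < r j)%N -> same_type r f g i j) ->
  letter_sum q L f xs r = letter_sum q L g xs r.
Proof.
move=> Af Ag rL st; have [[]//|] := gallery q xs Af Ag rL.
case=> f1 [f2 [i [j [[Af1 Af2 ij _] [b1 b2] _ _ [/eqP[]]]]]].
have [ri|ri] := posnP (r i); first by rewrite !wt_empty ?ri.
have [rj|rj] := posnP (r j); first by rewrite !wt_empty ?rj ?orbT.
by rewrite !(@between_wt _ _ f _ g) //; apply: st.
Qed.

End SameType.

Lemma adjacent_wt_other (I : finType) (f f' : I -> I -> int) i j k l r :
    adjacent f f' i j ->
    ~~ ((k == i) && (l == j)) -> ~~ ((k == j) && (l == i)) ->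
  wt r f k l = wt r f' k l.
Proof.
case=> _ _ _ [_ _ c3] kl lk; rewrite /wt !c3 //; first by rewrite andbC.
by rewrite andbC.
Qed.

Section Recursion.
Variables (R : idomainType) (q : R) (L : nat) (xs : seq R) (I : finType).
Implicit Types (f g h c p : I -> I -> int) (i j k : I) (T : {set I}).
Variable r : I -> nat.
Hypotheses (q_neq0 : q != 0) (rL : (\sum_k r k < L)%N).

Let LS f w := letter_sum q L f xs w.
Let same_wt (w : I -> nat) f g := forall i j, i != j -> wt w f i j = wt w g i j.

Hypothesis spread : forall w f g, (\sum_k w k = \sum_k r k)%N ->
  (\sum_k r k ^ 2 < \sum_k w k ^ 2)%N -> alcove f -> alcove g ->
  same_wt w f g -> LS f w = LS g w.

(** The two new lengths have the same sum and are further apart: the union is longer than both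
    rows. *)
Lemma sum_sq_swap (m : int) i j : i != j -> straddle r m i j ->
  (\sum_k r k ^ 2 < \sum_k swap_at i j (absz m) r k ^ 2)%N.
Proof.
move=> ij [m0 ri rj]; have ji : j != i by rewrite eq_sym.
rewrite (bigD1 i) // (bigD1 j) //= [X in (_ < X)%N](bigD1 i) // [X in (_ < _ + X)%N](bigD1 j) //=.
rewrite {1 2}/swap_at !eqxx (negPf ji).
rewrite [X in (_ < _ + (_ + X))%N](eq_bigr (fun k => r k ^ 2)%N); last first.
  by move=> k /andP[/negPf ki /negPf kj]; rewrite /swap_at ki kj.
rewrite !addnA ltn_add2r.
have : (0 < absz m)%N by move: m0; clear; lia.
have : (absz m <= r i)%N by move: m0 ri; clear; lia.
have : (r i < absz m + r j)%N by move: m0 rj; clear; lia.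
move: (absz m) (r i) (r j) => {m m0 ri rj} m a b lt1 le1 m0.
have [d [e [ea eb]]] : exists d e : nat, (a = m + d /\ b = d + e.+1)%N.
  exists (a - m)%N, (m + b - a).-1; split; lia.
rewrite ea eb addKn; have [m' ->] : exists m', m = m'.+1 by exists m.-1; lia.
rewrite -!mulnn; nia.
Qed.

Lemma sum_swap (m : int) i j : i != j -> straddle r m i j ->
  (\sum_k swap_at i j (absz m) r k = \sum_k r k)%N.
Proof. by move=> ij [m0 ri rj]; apply: sum_swap_at => //; move: m0 ri; clear; lia. Qed.

(* The two walls are crossed in opposite directions, so the rows i and j
   exchange their roles in the contracted configurations. *)
Lemma opposite_crossings c p c' p' i j :
    adjacent c p i j -> straddle r (p i j) i j ->
    adjacent c' p' j i -> straddle r (p' j i) j i ->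
    same_wt r p p' -> LS c r = LS c' r ->
  LS p r = LS p' r.
Proof.
move=> A S A' S' ew ec; have [Ac Ap ij _] := A; have [_ Ap' ji _] := A'.
have [w1 _] := straddle_wt A S; have [w1' _] := straddle_wt A' S'.
(* Both wall formulas evaluate the common value of [c] and [c']. Once the contracted terms agree,
   which is a matter for [spread], they can be subtracted and [q] cancelled. *)
apply: (mulfI q_neq0); apply: (@addIr _ ((1 - q) * LS p (swap_at i j (absz (p i j)) r))).
rewrite /LS -(adjacent_straddle q xs A S rL) -/(LS c r) ec /LS (adjacent_straddle q xs A' S' rL).
congr (_ + _ * _); rewrite -/(LS _ _) -/(LS _ _).
set w := swap_at i j _ r; set w' := swap_at j i _ r.
have L0 : (0 < L)%N by apply: leq_ltn_trans rL.
have eij : (r i)%:Z - p i j = (r j)%:Z - p' j i by rewrite -w1 -w1' ew // wtC.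
have ti : tperm i j i = j := tpermL i j; have tj : tperm i j j = i := tpermR i j.
have tk k : k != i -> k != j -> tperm i j k = k by move=> ? ?; rewrite tpermD 1?eq_sym.
have ww' : (fun k => w' (tperm i j k)) =1 w.
  move=> k; have [S1 S2 _] := S; have [S1' S2' _] := S'.
  have [->|ki] := eqVneq k i.
    by rewrite ti /w /w' /swap_at !eqxx; move: S1 S2 S1' S2' eij; clear; lia.
  have [->|kj] := eqVneq k j.
    by rewrite tj /w /w' /swap_at !eqxx (negPf ij) (negPf ji); move: S1 S2 S1' S2' eij; clear; lia.
  by rewrite tk // /w /w' /swap_at (negPf ki) (negPf kj).
have -> : LS p' w' = LS (fun k l => p' (tperm i j k) (tperm i j l)) w.
  rewrite /LS (letter_sum_inj q (@perm_inj _ (tperm i j)) L0).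
    exact: eq_letter_sum.
  by move=> k /negP[]; apply/codomP; exists (tperm i j k); rewrite tpermK.
have Apt : alcove (fun k l => p' (tperm i j k) (tperm i j l)).
  have [h0 hN hT] := Ap'; split=> // k l kl.
  by apply: hN; rewrite (inj_eq perm_inj).
apply/esym; apply: spread => //; [exact: sum_swap | exact: sum_sq_swap |].
have wtt k l : wt w (fun k l => p' (tperm i j k) (tperm i j l)) k l =
    wt w' p' (tperm i j k) (tperm i j l) by rewrite /wt -!ww'.
suff step k l : k != l -> (l == i) || (l == j) ->
    wt w p k l = wt w (fun k l => p' (tperm i j k) (tperm i j l)) k l.
  move=> k l kl; case: (boolP ((l == i) || (l == j))) => [|ln]; first exact: step.
  case: (boolP ((k == i) || (k == j))) => [kn|kn].
    by rewrite wtC [RHS]wtC; apply: step => //; rewrite eq_sym.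
  move: ln kn; rewrite !negb_or => /andP[li lj] /andP[ki kj].
  rewrite wtt !tk //; have := ew _ _ kl.
  by rewrite /wt /w /w' /swap_at (negPf li) (negPf lj) (negPf ki) (negPf kj).
move=> kl lij; rewrite wtt.
have [ki|ki] := eqVneq k i; [|have [kj|kj] := eqVneq k j].
- subst k; have -> : l = j by case/orP: lij kl => /eqP->; rewrite ?eqxx.
  by rewrite ti tj /w /w' (wt_contract_pair A S) (wt_contract_pair A' S') ew // wtC.
- subst k; have -> : l = i by case/orP: lij kl => /eqP->; rewrite ?eqxx.
  rewrite ti tj /w /w' wtC (wt_contract_pair A S) [RHS]wtC (wt_contract_pair A' S').
  by rewrite ew // wtC.
have [e1 e2] := wt_contract A S ki kj.
have [e1' e2'] := wt_contract A' S' kj ki.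
case/orP: lij => /eqP->; rewrite ?ti ?tj tk // /w /w'.
  by rewrite e2 e2' !ew // [wt r p' i j]wtC; clear; lia.
by rewrite e1 e1' !ew // [wt r p' i j]wtC; clear; lia.
Qed.

End Recursion.

Section Gather.
Variables (I : finType) (r : I -> nat).
Implicit Types (f g h c p : I -> I -> int) (i j k : I) (T : {set I}).

(* The rows of T are brought to the place of a. *)
Definition gather f T a : I -> I -> int := fun x y =>
  if x \in T then
    if y \in T then
      if x == y then 0 else if (enum_rank x < enum_rank y)%N then 0 else -1
    else f a y
  else if y \in T then f x a else f x y.

Lemma alcove_gather f T a : alcove f -> a \in T -> alcove (gather f T a).
Proof.
move=> Af aT; have [h0 hN hT] := Af; rewrite /gather.
have aN k : k \notin T -> a != k by move=> kT; apply: contraNneq kT => <-.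
have rk (x y : I) : x != y -> (enum_rank x < enum_rank y)%N = ~~ (enum_rank y < enum_rank x)%N.
  move=> xy; rewrite -leqNgt ltn_neqAle andb_idl // => _.
  by rewrite (inj_eq val_inj) (inj_eq enum_rank_inj).
split=> [x|x y xy|x y z].
- by case: (boolP (x \in T)) => _; rewrite ?eqxx ?h0.
- rewrite (negPf xy) eq_sym (negPf xy).
  case: (boolP (x \in T)) => xT; case: (boolP (y \in T)) => yT; last exact: hN.
  + by rewrite (rk x y) //; case: (_ < _)%N.
  + exact: hN (aN _ yT).
  + by rewrite addrC; apply: hN (aN _ xT).
- case: (boolP (x \in T)) => xT; case: (boolP (y \in T)) => yT;
  case: (boolP (z \in T)) => zT; try exact: hT.
  + have [->|xy] := eqVneq x y; first by rewrite add0r.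
    have [e|yz] := eqVneq y z; first by subst z; rewrite addr0 (negPf xy).
    have [->|xz] := eqVneq x z; first by rewrite (rk z y) 1?eq_sym //; case: (_ < _)%N.
    case: ifP => l1; case: ifP => l2; case: ifP => l3 //.
    by move: l1 l2 l3; clear; lia.
  + by case: ifP => _; [clear | case: ifP => _; clear]; lia.
  + by rewrite (hN _ _ (aN _ yT)); case: eqP => // _; case: ifP.
  + by case: ifP => _; [clear | case: ifP => _; clear]; lia.
Qed.

(** A row outside [T] keeps its placement relative to [T], and by [left_same] and [outer_same] the
    placement determines the type. *)
Lemma mirrored_same f T f' i j : alcove f -> mirrored r f T f' ->
    {in T, forall x, 0 < r x}%N -> encapsulated r f T ->
    ~~ ((i \in T) && (j \in T)) -> i != j -> (0 < r i)%N -> (0 < r j)%N ->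
  same_type r f f' i j.
Proof.
move=> Af [Af' _ out cat] rT enc.
have main k x : k \notin T -> x \in T -> (0 < r k)%N -> same_type r f f' k x.
  move=> kT xT rk; have kx : k != x by apply: contraNneq kT => ->.
  have xk : x != k by rewrite eq_sym.
  have [c1 c2 c3] := cat k kT; case: (enc k kT rk) => H.
  - by apply: left_same => //; [apply: rT | apply: H | apply: c1].
  - apply/same_typeC; apply: left_same => //; [exact: rT | exact: H | exact: c2].
  - have [h1 h2 h3] := H x xT; have [_ h2' h3'] := c3 H x xT.
    by apply: outer_same => //; apply: rT.
case: (boolP (i \in T)) => iT; case: (boolP (j \in T)) => // jT _ ij ri rj.
- by apply/same_typeC; apply: main.
- exact: main.
- by rewrite /same_type /wt /precedes !out.
Qed.

Lemma mirrored_wt f T f' i j : alcove f -> mirrored r f T f' -> i \in T -> j \in T ->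
  i != j -> wt r f' i j = wt r f i j.
Proof.
move=> Af [Af' H _ _] iT jT ij; rewrite /wt !H // 1?eq_sym //.
by move: (f i j) (f j i) (r i) (r j); clear; lia.
Qed.

Lemma mirrored_precedes f T f' i j : alcove f -> mirrored r f T f' ->
  i \in T -> j \in T -> i != j -> precedes r f' i j = precedes r f j i.
Proof.
move=> Af [Af' H _ _] iT jT ij; rewrite /precedes !H // 1?eq_sym //.
by move: (f i j) (f j i) (r i) (r j); clear; lia.
Qed.

Lemma mirrored_same_wt f T f' : alcove f -> mirrored r f T f' ->
    {in T, forall x, 0 < r x}%N -> encapsulated r f T ->
  forall i j, i != j -> wt r f i j = wt r f' i j.
Proof.
move=> Af M rT enc i j ij; case: (boolP ((i \in T) && (j \in T))) => [/andP[iT jT]|nT].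
  by rewrite (mirrored_wt Af M).
have [ri|ri] := posnP (r i); first by rewrite !wt_empty ?ri.
have [rj|rj] := posnP (r j); first by rewrite !wt_empty ?rj ?orbT.
by have [] := mirrored_same Af M rT enc nT ij ri rj.
Qed.

End Gather.

(** * Reflection in place preserves the polynomial *)

Section MirroredSum.
Variables (R : idomainType) (q : R) (L : nat) (xs : seq R) (I : finType).
Implicit Types (f g h c p : I -> I -> int) (i j k : I) (T : {set I}).
Variable r : I -> nat.
Hypotheses (q_neq0 : q != 0) (rL : (\sum_k r k < L)%N).

Let LS f w := letter_sum q L f xs w.
Let same_wt (w : I -> nat) f g := forall i j, i != j -> wt w f i j = wt w g i j.

Hypothesis spread : forall w f g, (\sum_k w k = \sum_k r k)%N ->
  (\sum_k r k ^ 2 < \sum_k w k ^ 2)%N -> alcove f -> alcove g ->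
  same_wt w f g -> LS f w = LS g w.

Variable f0 : I -> I -> int.
Hypothesis raise : forall f g, alcove f -> alcove g -> same_wt r f g ->
    (forall i j, i != j -> wt r f0 i j <= wt r f i j) ->
    (exists i j, i != j /\ wt r f0 i j < wt r f i j) ->
  LS f r = LS g r.

(** On the way from [f] to the alcove with [T] gathered in one place, the first weight change [f1]
    to [f2] raises the weight of a pair in [T]. Between the reflections of [f1] and [f2] the same
    pair meets a wall [h1] to [h2] in the opposite direction. Then [opposite_crossings] equates the
    sums of [f1] and [h1], with [raise] for the heavier alcoves [f2] and [h2], and equality of types
    gives the remaining links. *)
Lemma mirrored_sum f T f' : alcove f -> same_wt r f f0 -> mirrored r f T f' ->
    {in T, forall x, 0 < r x}%N -> encapsulated r f T ->
  LS f r = LS f' r.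
Proof.
move=> Af f_f0 M rT enc; have [Af' MT _ _] := M.
case: (boolP [exists x in T, exists y in T, precedes r f x y]) => [/exists_inP|npr]; last first.
  apply: same_type_sum => // i j ij ri rj.
  case: (boolP ((i \in T) && (j \in T))) => [/andP[iT jT]|nT]; last first.
    exact: (mirrored_same Af M).
  have np x y : x \in T -> y \in T -> precedes r f x y = false.
    move=> xT yT; apply/negP => pxy; move/negP: npr; apply.
    by apply/exists_inP; exists x => //; apply/exists_inP; exists y.
  by split; rewrite ?(mirrored_wt Af M) ?(mirrored_precedes Af M) ?np // eq_sym.
case=> x0 x0T /exists_inP[y0 y0T pxy0].
have xy0 : x0 != y0 by apply: contraTneq pxy0 => ->; rewrite /precedes; have [-> _ _] := Af.
(* Gathering at the leftmost row moves the other rows of [T] to the left only, not beyond [a]; so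
   the outside rows keep their placement throughout. *)
case: (@Order.TotalTheory.arg_minP _ _ _ x0 (fun x => x \in T) (position f) x0T) => a aT a_min.
have fa x : x \in T -> 0 <= f a x.
  move=> xT; have [->|ax] := eqVneq a x; first by have [-> _ _] := Af.
  rewrite leNgt; apply/negP => lt0; have : 0 <= f x a.
    by rewrite (alcoveN Af ax); move: lt0; clear; lia.
  by rewrite position_lt 1?eq_sym // ltNge a_min.
pose o := gather f T a; have Ao : alcove o by apply: alcove_gather.
have oT x y : x \in T -> y \in T -> -1 <= o x y <= 0.
  by move=> xT yT; rewrite /o /gather xT yT; case: ifP => // _; case: ifP.
have btw h i j : alcove h -> between f h o -> ~~ ((i \in T) && (j \in T)) -> i != j ->
    (0 < r i)%N -> (0 < r j)%N -> same_type r f h i j.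
  move=> Ah b nT ij ri rj; move: nT.
  have main k x : k \notin T -> x \in T -> (0 < r k)%N -> same_type r f h k x.
    move=> kT xT rk; have kx : k != x by apply: contraNneq kT => ->.
    have xk : x != k by rewrite eq_sym.
    have okx : o k x = f k a by rewrite /o /gather (negPf kT) xT.
    have oxk : o x k = f a k by rewrite /o /gather (negPf kT) xT.
    have bkx := b k x; have bxk := b x k; rewrite okx in bkx; rewrite oxk in bxk.
    have Tak := alcove_le a x k Af; have fax := fa x xT.
    case: (enc k kT rk) => H.
    - apply: left_same => //; [exact: rT | exact: H |].
      by have := H x xT; have := H a aT; move: bkx; clear; lia.
    - apply/same_typeC; apply: left_same => //; [exact: rT | exact: H |].
      by have := H x xT; move: bxk Tak fax; clear; lia.
    - have [h1 h2 h3] := H x xT; have [_ h2' _] := H a aT.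
      apply: outer_same => //; first exact: rT.
        by move: bkx h2 h2'; clear; lia.
      by move: bxk h3 Tak fax; clear; lia.
  case: (boolP (i \in T)) => iT; case: (boolP (j \in T)) => // jT _.
  - by apply/same_typeC; apply: main.
  - exact: main.
  - rewrite /same_type /wt /precedes.
    have e k l : k \notin T -> l \notin T -> h k l = f k l.
      move=> kT lT; have := b k l; rewrite /o /gather (negPf kT) (negPf lT).
      by clear; lia.
    by rewrite !e.
have [[_ /(_ _ _ xy0)]|] := gallery q xs Af Ao rL.
  have := precedes_lt Af xy0 (rT _ x0T) (rT _ y0T) pxy0 => /[swap] ->.
  rewrite wt_incomparable ?ltxx //; rewrite /precedes.
    by have := oT _ _ x0T y0T; clear; lia.
  by have := oT _ _ y0T x0T; clear; lia.
case=> f1 [f2 [i [j [A12 [b1 b2] eS1 ew1 [ne12 lt12]]]]].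
have [Af1 Af2 ij c12] := A12.
have ijT : (i \in T) && (j \in T).
  apply/negPn/negP => nT; case/eqP: ne12; rewrite -ew1 //.
  have [ri|ri] := posnP (r i); first by rewrite !wt_empty ?ri.
  have [rj|rj] := posnP (r j); first by rewrite !wt_empty ?rj ?orbT.
  by have [] := btw f2 i j Af2 b2 nT ij ri rj.
have /andP[iT jT] := ijT; have ji : j != i by rewrite eq_sym.
(* A decrease would require [0 < f2 i j], but the path stays below [o i j <= 0]. So the weight
   increases. *)
have [[[S0 _ _] _]|[S21 w21]] := adjacent_neq_wt A12 ne12.
  have [c1 _ _] := c12; have := oT i j iT jT; move: S0 lt12; rewrite c1 -/o.
  by clear; lia.
have A21 := adjacentC A12.
have encb h : between f h o -> encapsulated r h T.
  move=> b k kT rk; case: (enc k kT rk) => H; [constructor 1|constructor 2|constructor 3] => x xT.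
  - have := b k x; rewrite /o /gather (negPf kT) xT.
    by have := H x xT; have := H a aT; clear; lia.
  - have := b x k; rewrite /o /gather (negPf kT) xT.
    by have := H x xT; have := alcove_le a x k Af; have := fa x xT; clear; lia.
  - have [h1 h2 h3] := H x xT; have [_ h2' _] := H a aT.
    have := b k x; have := b x k; rewrite /o /gather (negPf kT) xT.
    have := alcove_le a x k Af; have := fa x xT; move: h1 h2 h3 h2'; clear => *.
    by split; lia.
have T0 : T != set0 by apply/set0Pn; exists a.
have [f1' M1] := exists_mirrored r Af1 T0; have [f2' M2] := exists_mirrored r Af2 T0.
have [Af1' MT1 _ _] := M1; have [Af2' MT2 _ _] := M2.
have wt11' := mirrored_same_wt Af1 M1 rT (encb _ b1).
have wt22' := mirrored_same_wt Af2 M2 rT (encb _ b2).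
have out11' := mirrored_same Af1 M1 rT (encb _ b1).
have out22' := mirrored_same Af2 M2 rT (encb _ b2).
have [c1 c2 c3] := c12.
have d_ij : f2' i j = f1' i j - 1 by rewrite MT1 // MT2 // c2; clear; lia.
have d_ji : f2' j i = f1' j i + 1 by rewrite MT1 // MT2 // c1; clear; lia.
(* Inside [T] the two reflections differ at the pair [i], [j] alone, and the other pairs have equal
   types. So the weight change on the path between them must occur at this pair. *)
have [[_ /(_ i j ij)]|] := gallery q xs Af1' Af2' rL.
  by rewrite -wt11' // -wt22' // => e; rewrite e eqxx in ne12.
case=> h1 [h2 [k [l [B [b3 b4] eS2 ew2 [ne34 lt34]]]]].
have [Ah1 Ah2 kl _] := B.
have [ek el] : k = j /\ l = i.
  case: (boolP ((k == j) && (l == i))) => [/andP[/eqP-> /eqP->]//|kl1].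
  case: (boolP ((k == i) && (l == j))) => [/andP[/eqP ek /eqP el]|kl2].
    by subst k l; have := b3 i j; move: lt34 d_ij; clear; lia.
  case/eqP: ne34; rewrite -ew2 //.
  case: (boolP ((k \in T) && (l \in T))) => [/andP[kT lT]|nT].
    have lk : l != k by rewrite eq_sym.
    have ekl : f2' k l = f1' k l by rewrite MT1 // MT2 // c3 // andbC.
    have elk : f2' l k = f1' l k by rewrite MT1 // MT2 // c3.
    have := b4 k l; have := b4 l k; rewrite /wt ekl elk.
    by move: (f1' k l) (f1' l k) (h2 k l) (h2 l k); clear => *; congr (Num.max 0 (Num.min _ (Num.min (_ - _) (_ - _)))); lia.
  have [rk|rk] := posnP (r k); first by rewrite !wt_empty ?rk.
  have [rl|rl] := posnP (r l); first by rewrite !wt_empty ?rl ?orbT.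
  apply/esym; apply: (between_wt Af1' Ah2 Af2') => //.
  apply: same_type_trans (same_type_sym (out11' _ _ nT kl rk rl)) _.
  apply: same_type_trans (same_type_sym (btw _ _ _ Af1 b1 nT kl rk rl)) _.
  apply: same_type_trans (btw _ _ _ Af2 b2 nT kl rk rl) _.
  exact: out22'.
subst k l; clear kl; have [_ _ _ [hc1 hc2 hc3]] := B.
have hji : h2 j i = f2' j i by have := b3 j i; move: lt34 d_ji hc1; clear; lia.
have hij : h2 i j = f2' i j by rewrite (alcoveN Ah2 ji) (alcoveN Af2' ji) hji.
have wh2 : wt r h2 i j = wt r f2 i j by rewrite wt22' // /wt hij hji.
have wh1 k l : k != l -> wt r f1 k l = wt r h1 k l by move=> kl; rewrite wt11' // ew2.
have [[_ wB]|[SB wB]] := adjacent_neq_wt B ne34.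
  have := wh1 i j ij; have := w21; rewrite -wh2 [wt r h1 i j]wtC [wt r h2 i j]wtC wB.
  by clear; lia.
have eq12 : LS f1 r = LS h1 r.
  apply: (opposite_crossings q_neq0 rL spread A21 S21 (adjacentC B) SB wh1).
  have oth k l : ~~ ((k == i) && (l == j)) -> ~~ ((k == j) && (l == i)) ->
      wt r f1 k l = wt r f2 k l by apply: adjacent_wt_other A12.
  apply: raise => //.
  - move=> k l kl.
    case: (boolP ((k == i) && (l == j))) => [/andP[/eqP-> /eqP->]//|kl1].
    case: (boolP ((k == j) && (l == i))) => [/andP[/eqP-> /eqP->]|kl2].
      by rewrite wtC [RHS]wtC.
    by rewrite -oth // wh1 // (adjacent_wt_other _ B).
  - move=> k l kl; rewrite -f_f0 // ew1 //.
    case: (boolP ((k == i) && (l == j))) => [/andP[/eqP-> /eqP->]|kl1].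
      by rewrite w21; clear; lia.
    case: (boolP ((k == j) && (l == i))) => [/andP[/eqP-> /eqP->]|kl2].
      by rewrite wtC [X in _ <= X]wtC w21; clear; lia.
    by rewrite oth.
  - exists i, j; split=> //; rewrite -f_f0 // ew1 // w21; clear; lia.
transitivity (LS f1 r) => //; rewrite eq12 /LS -eS2.
apply: same_type_sum => // k l kl rk rl.
case: (boolP ((k \in T) && (l \in T))) => [/andP[kT lT]|nT]; last first.
  apply: same_type_trans (same_type_sym (out11' _ _ nT kl rk rl)) _.
  apply: same_type_trans (same_type_sym (btw _ _ _ Af1 b1 nT kl rk rl)) _.
  exact: (mirrored_same Af M).
have lk : l != k by rewrite eq_sym.
(* Moving towards [o] creates no order relation inside [T], and equality of the weights forbids
   losing one. *)
have prl x y : x \in T -> y \in T -> precedes r f1 x y -> precedes r f x y.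
  move=> xT yT; rewrite /precedes; have := b1 x y; have := oT x y xT yT.
  by move: (o x y) (f1 x y) (f x y); clear; lia.
have pr x y : x \in T -> y \in T -> x != y -> precedes r f1 x y = precedes r f x y.
  move=> xT yT xy; have yx : y != x by rewrite eq_sym.
  apply/idP/idP; [exact: prl | move=> pf; apply/negPn/negP => np].
  have np' : ~~ precedes r f1 y x.
    by apply: contra (precedes_asym Af xy pf); apply: prl.
  have := precedes_lt Af xy (rT _ xT) (rT _ yT) pf.
  by rewrite ew1 // wt_incomparable // ltxx.
split; first by rewrite (mirrored_wt Af M) // (mirrored_wt Af1 M1) // ew1.
  by rewrite (mirrored_precedes Af1 M1) // (mirrored_precedes Af M) // pr.
by rewrite (mirrored_precedes Af1 M1) // (mirrored_precedes Af M) // pr.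
Qed.

End MirroredSum.

(** * Flipped and kept pairs *)

Section Orientation.
Variables (I : finType) (r : I -> nat).
Implicit Types (f g h : I -> I -> int) (i j k x y z : I) (T X Q : {set I}).

Lemma precedes_irr f i : alcove f -> precedes r f i i = false.
Proof. by case=> f0 _ _; rewrite /precedes f0. Qed.

Lemma precedes_neq f i j : alcove f -> precedes r f i j -> i != j.
Proof. by move=> Af; apply: contraTneq => ->; rewrite precedes_irr. Qed.

Lemma precedes_trans f i j k : alcove f ->
  precedes r f i j -> precedes r f j k -> precedes r f i k.
Proof.
move=> Af; have := alcove_le i j k Af; rewrite /precedes.
by move: (f i j) (f j k) (f i k) (r i) (r j) (r k); clear; lia.
Qed.

(** Along the order both the starts and the ends advance by at least one cell, so the outer pair
    overlaps strictly less than the inner ones. *)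
Lemma precedes_mid f i j k : alcove f -> precedes r f i j -> precedes r f j k ->
  wt r f i k = 0 \/ (wt r f i k < wt r f i j /\ wt r f i k < wt r f j k).
Proof.
move=> Af pij pjk; have pik := precedes_trans Af pij pjk.
rewrite !wt_precedes ?(precedes_neq Af) //.
have := alcove_le i j k Af; move: pij pjk; rewrite /precedes.
by move: (f i j) (f j k) (f i k) (r i) (r j) (r k); clear; lia.
Qed.

Lemma zero_left f i j : alcove f -> i != j -> (0 < r i)%N -> (0 < r j)%N ->
  ((r i)%:Z <= f i j) = precedes r f i j && (wt r f i j == 0).
Proof.
move=> Af ij ri rj; case: (boolP (precedes r f i j)) => p; last first.
  by move: p ri rj; rewrite /precedes; move: (f i j) (r i) (r j); clear; lia.
by rewrite wt_precedes //; move: (f i j) (r i); clear; lia.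
Qed.

Lemma zero_comparable f i j : alcove f -> i != j -> (0 < r i)%N -> (0 < r j)%N ->
  wt r f i j = 0 -> ((r i)%:Z <= f i j) || ((r j)%:Z <= f j i).
Proof.
move=> Af ij ri rj w0; rewrite !zero_left // 1?eq_sym //.
rewrite [wt r f j i]wtC w0 !eqxx !andbT; apply: contraT => /norP[p1 p2].
by move: w0 ri rj; rewrite wt_incomparable //; clear; lia.
Qed.

Lemma left_wt0 f i j : (r i)%:Z <= f i j -> wt r f i j = 0.
Proof. by rewrite /wt; clear; lia. Qed.

Lemma outer_incomparable f i j : alcove f -> i != j -> (r j <= r i)%N ->
  (-1 <= f i j) && ((r j)%:Z - (r i)%:Z - 1 <= f j i) =
  ~~ precedes r f i j && ~~ precedes r f j i.
Proof.
move=> Af ij rij; rewrite /precedes (alcoveN Af ij).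
by move: (f i j) (r i) (r j) rij; clear; lia.
Qed.

Lemma encapsulated_same f g T : alcove f -> alcove g -> {in T, forall x, (0 < r x)%N} ->
    (forall k x, k \notin T -> x \in T -> (0 < r k)%N -> same_type r f g k x) ->
  encapsulated r f T -> encapsulated r g T.
Proof.
move=> Af Ag rT st enc k kT rk.
have kx x : x \in T -> k != x by move=> xT; apply: contraNneq kT => ->.
have xk x : x \in T -> x != k by rewrite eq_sym; apply: kx.
case: (enc k kT rk) => H; [constructor 1|constructor 2|constructor 3] => x xT.
- have [e1 e2 _] := st k x kT xT rk; have := H x xT.
  rewrite (zero_left Af (kx x xT) rk (rT x xT)) (zero_left Ag (kx x xT) rk (rT x xT)).
  by rewrite e1 e2.
- have [e1 _ e2] := st k x kT xT rk; have := H x xT.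
  rewrite (zero_left Af (xk x xT) (rT x xT) rk) (zero_left Ag (xk x xT) (rT x xT) rk).
  by rewrite [wt r f x k]wtC [wt r g x k]wtC e1 e2.
- have [e1 e2 e3] := st k x kT xT rk; have [h1 h2 h3] := H x xT.
  have := outer_incomparable Af (kx x xT) h1; rewrite h2 h3 e2 e3 -(outer_incomparable Ag (kx x xT) h1).
  by case/esym/andP.
Qed.

Lemma encapsulated_sub f T X : X \subset T -> encapsulated r f T ->
    (forall k, k \in T -> k \notin X -> (0 < r k)%N ->
       [\/ left_of r f X k, right_of r f X k | outer_of r f X k]) ->
  encapsulated r f X.
Proof.
move=> /subsetP XT enc inT k kX rk; case: (boolP (k \in T)) => kT; first exact: inT.
by case: (enc k kT rk) => H; [constructor 1|constructor 2|constructor 3] => x /XT; apply: H.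
Qed.

Section Pair.
Variables (f g : I -> I -> int) (T : {set I}).
Hypotheses (Af : alcove f) (Ag : alcove g) (rT : {in T, forall x, (0 < r x)%N}).
Hypothesis fg : {in T &, forall x y, x != y -> wt r f x y = wt r g x y}.

Definition flipped : rel I := fun x y =>
  precedes r f x y && precedes r g y x || precedes r f y x && precedes r g x y.

Definition kept : rel I := fun x y =>
  precedes r f x y && precedes r g x y || precedes r f y x && precedes r g y x.

Definition meets : rel I := fun x y => (x != y) && (wt r f x y != 0).

Lemma flippedC : symmetric flipped. Proof. by move=> x y; rewrite /flipped orbC. Qed.
Lemma keptC : symmetric kept. Proof. by move=> x y; rewrite /kept orbC. Qed.
Lemma meetsC : symmetric meets. Proof. by move=> x y; rewrite /meets eq_sym wtC. Qed.

(** Comparability can be read off the weights, hence is the same for [f] and [g]; only the direction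
    may differ. *)
Lemma comparable_wt x y : x \in T -> y \in T -> x != y ->
  precedes r f x y || precedes r f y x = (wt r f x y < Num.min (r x)%:Z (r y)%:Z).
Proof.
move=> xT yT xy; case: (boolP (precedes r f x y)) => p1.
  by rewrite (precedes_lt Af xy (rT xT) (rT yT) p1).
case: (boolP (precedes r f y x)) => p2 /=; last by rewrite wt_incomparable ?ltxx.
by rewrite wtC minC (precedes_lt Af _ (rT yT) (rT xT) p2) // eq_sym.
Qed.

End Pair.

Section Link.
Variables (f g : I -> I -> int) (T : {set I}).
Hypotheses (Af : alcove f) (Ag : alcove g) (rT : {in T, forall x, (0 < r x)%N}).
Hypothesis fg : {in T &, forall x y, x != y -> wt r f x y = wt r g x y}.

Lemma comparable_same x y : x \in T -> y \in T ->
  precedes r f x y || precedes r f y x = precedes r g x y || precedes r g y x.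
Proof.
move=> xT yT; have [->|xy] := eqVneq x y; first by rewrite !precedes_irr.
by rewrite !(@comparable_wt _ T) // fg.
Qed.

Lemma comparable_flipped_kept x y : x \in T -> y \in T ->
  precedes r f x y || precedes r f y x = flipped f g x y || kept f g x y.
Proof.
move=> xT yT; have := comparable_same xT yT; rewrite /flipped /kept.
by case: (precedes r f x y); case: (precedes r f y x);
  case: (precedes r g x y); case: (precedes r g y x) => //=.
Qed.

Lemma flipped_not_kept x y : flipped f g x y -> ~~ kept f g x y.
Proof.
rewrite /flipped /kept => fxy; have xy : x != y.
  by apply: contraTneq fxy => ->; rewrite !precedes_irr.
have yx : y != x by rewrite eq_sym.
case/orP: fxy => /andP[p1 p2].
  by rewrite (negPf (precedes_asym Af xy p1)) (negPf (precedes_asym Ag yx p2)) andbF.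
by rewrite (negPf (precedes_asym Af yx p1)) (negPf (precedes_asym Ag xy p2)) andbF.
Qed.

(** If [x] and [z] overlapped, their weight would be the strictly smallest of the three by
    [precedes_mid] for [f]. In [g], however, [y] comes first or last, so [x] or [z] is in the
    middle, and [precedes_mid] for [g] contradicts this. *)
Lemma link_mid x y z : x \in T -> y \in T -> z \in T ->
    precedes r f x y -> precedes r f y z ->
    (precedes r g y x && precedes r g y z) || (precedes r g x y && precedes r g z y) ->
  wt r f x z = 0.
Proof.
move=> xT yT zT xy yz gxz; have xz := precedes_trans Af xy yz.
have [xny [ynz xnz]] := (precedes_neq Af xy, (precedes_neq Af yz, precedes_neq Af xz)).
have [znx [yny' zny]] : z != x /\ y != x /\ z != y by rewrite eq_sym xnz eq_sym xny eq_sym ynz.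
have [//|[l1 l2]] := precedes_mid Af xy yz.
have p1 := wt_ge0 r f x z.
have := comparable_same xT zT; rewrite xz /= => /esym/orP[gp|gp]; case/orP: gxz => /andP[g1 g2].
- have := precedes_mid Ag g1 gp; rewrite -!fg // [wt r f y x]wtC.
  by move: l1 l2 p1; clear; lia.
- have := precedes_mid Ag gp g2; rewrite -!fg // [wt r f z y]wtC.
  by move: l1 l2 p1; clear; lia.
- have := precedes_mid Ag g2 gp; rewrite -!fg // [wt r f y x]wtC [wt r f z x]wtC.
  by move: l1 l2 p1; clear; lia.
- have := precedes_mid Ag gp g1; rewrite -!fg // [wt r f z x]wtC [wt r f z y]wtC.
  by move: l1 l2 p1; clear; lia.
Qed.

End Link.

Section Components.
Variables (f g : I -> I -> int) (T : {set I}).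
Hypotheses (Af : alcove f) (Ag : alcove g) (rT : {in T, forall x, (0 < r x)%N}).
Hypothesis fg : {in T &, forall x y, x != y -> wt r f x y = wt r g x y}.

Let gf : {in T &, forall x y, x != y -> wt r g x y = wt r f x y}.
Proof. by move=> x y xT yT xy; rewrite fg. Qed.

Lemma flipped_kept_wt x y z : x \in T -> y \in T -> z \in T -> x != z ->
  flipped f g x y -> kept f g y z -> wt r f x z = 0.
Proof.
move=> xT yT zT xz; rewrite /flipped /kept.
case/orP=> /andP[p1 p2] /orP[] /andP[p3 p4].
- by apply: (@link_mid f g T _ _ _ _ x y z); rewrite ?p2 ?p4.
- rewrite fg // wtC; apply: (@link_mid g f T _ _ _ _ z y x); rewrite ?p1 ?p3 ?orbT //.
- rewrite fg //; apply: (@link_mid g f T _ _ _ _ x y z); rewrite ?p1 ?p3 ?orbT //.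
- by rewrite wtC; apply: (@link_mid f g T _ _ _ _ z y x); rewrite ?p2 ?p4 ?orbT.
Qed.

Lemma three_colored_pair : three_colored (flipped f g) (kept f g) (meets f) T.
Proof.
split; [exact: flippedC|exact: keptC|exact: meetsC| |split].
- by move=> x y; apply: flipped_not_kept.
- move=> x y xT yT xy; rewrite /meets xy negbK => /eqP w0.
  rewrite -(comparable_flipped_kept Af Ag rT fg) // (comparable_wt Af rT) // w0.
  by have := rT xT; have := rT yT; clear; lia.
- move=> x y z xT yT zT xy yz; rewrite /meets; case: eqVneq => //= xz.
  by rewrite (flipped_kept_wt xT yT zT xz xy yz) eqxx.
Qed.


Definition closed_block (e : rel I) X : Prop :=
  [/\ X \subset T, connected e X, 1 < #|X|
    & forall x k, x \in X -> k \in T -> k \notin X -> ~~ e x k]%N.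

Definition incomparable_to X k : Prop :=
  {in X, forall x, ~~ precedes r f k x && ~~ precedes r f x k}.

Lemma connected_all (e : rel I) X (A : pred I) x0 : connected e X -> x0 \in X -> A x0 ->
  {in X &, forall x y, e x y -> A x -> A y} -> {in X, forall x, A x}.
Proof.
move=> cX x0X A0 step x xX; apply: contraT => nA; exfalso.
have [|||a [b [aQ bX bQ ab]]] := connectedP (Q := [set y in X | A y]) cX.
- by apply/subsetP => y; rewrite inE => /andP[].
- by apply/set0Pn; exists x0; rewrite inE x0X.
- by apply: contraTneq xX => <-; rewrite inE (negPf nA) andbF.
move: aQ bQ; rewrite !inE bX => /andP[aX Aa] /negP; apply.
exact: (step a b).
Qed.

(** A row [k] comparable to [x] in [X] forms a kept pair with it. Excluding rainbow triangles, [k]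
    is disjoint from [x] and from its flipped neighbours, and on the same side of both, since
    otherwise transitivity would order the flipped pair alike in [f] and [g]. This spreads over the
    connected set [X]. *)
Lemma flipped_component X k : closed_block (flipped f g) X -> k \in T -> k \notin X ->
  [\/ incomparable_to X k, left_of r f X k | right_of r f X k].
Proof.
case=> /subsetP sXT cX X2 nF' kT kX.
have nF x : x \in X -> ~~ flipped f g x k /\ x != k.
  by move=> xX; split; [apply: nF'|apply: contraNneq kX => <-].
have prop x y : x \in X -> y \in X -> flipped f g x y ->
    [/\ precedes r f x k || precedes r f k x -> wt r f x k = 0,
     precedes r f x k -> precedes r f y k & precedes r f k x -> precedes r f k y].
  move=> xX yX xy; have [[nxk xk] [nyk yk]] := (nF x xX, nF y yX).
  have [xT yT] := (sXT x xX, sXT y yX).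
  have key : precedes r f x k || precedes r f k x ->
      [/\ kept f g x k, kept f g y k & wt r f x k = 0].
    rewrite (comparable_flipped_kept Af Ag rT fg) // (negPf nxk) /= => kxk.
    have w0 : wt r f y k = 0 by apply: (flipped_kept_wt yT xT kT yk _ kxk); rewrite flippedC.
    have kyk : kept f g y k.
      have := comparable_flipped_kept Af Ag rT fg yT kT; rewrite (negPf nyk) /= => <-.
      rewrite (comparable_wt Af rT) // w0.
      by have := rT yT; have := rT kT; clear; lia.
    by split=> //; apply: (flipped_kept_wt xT yT kT xk xy kyk).
  have tri : kept f g x k -> kept f g y k ->
      (precedes r f x k -> precedes r f y k) /\ (precedes r f k x -> precedes r f k y).
    have kx : k != x by rewrite eq_sym.
    have ky : k != y by rewrite eq_sym.
    move=> /orP[] /andP[p1 p2] /orP[] /andP[p3 p4]; split=> // p5.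
    - by have := precedes_asym Af xk p1; rewrite p5.
    - exfalso; have := precedes_trans Af p1 p3; have := precedes_trans Ag p2 p4.
      move=> gxy fxy; have xny := precedes_neq Af fxy.
      move: xy; rewrite /flipped (negPf (precedes_asym Af xny fxy)).
      by rewrite (negPf (precedes_asym Ag xny gxy)) andbF.
    - exfalso; have := precedes_trans Af p3 p1; have := precedes_trans Ag p4 p2.
      move=> gyx fyx; have ynx := precedes_neq Af fyx.
      move: xy; rewrite flippedC /flipped (negPf (precedes_asym Af ynx fyx)).
      by rewrite (negPf (precedes_asym Ag ynx gyx)) andbF.
    - by have := precedes_asym Af kx p1; rewrite p5.
  split=> [/key[]//|p|p].
  - have [|k1 k2 _] := key; first by rewrite p.
    by have [h _] := tri k1 k2; apply: h.
  - have [|k1 k2 _] := key; first by rewrite p orbT.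
    by have [_ h] := tri k1 k2; apply: h.
have zero x : x \in X -> precedes r f x k || precedes r f k x -> wt r f x k = 0.
  move=> xX; have [y yX /andP[_ xy]] := connected_nbr cX xX X2.
  by have [h _ _] := prop x y xX yX xy.
have rk := rT kT.
case: (boolP [exists x in X, precedes r f k x]) => [/exists_inP[x0 x0X p]|np1].
  have all := connected_all (A := fun x => precedes r f k x) cX x0X p.
  have {}all : {in X, forall x, precedes r f k x}.
    by apply: all => x y xX yX xy; have [_ _] := prop x y xX yX xy.
  constructor 2 => x xX; have [_ xk] := nF x xX.
  have kx : k != x by rewrite eq_sym.
  by rewrite (zero_left Af kx rk (rT (sXT _ xX))) all // wtC zero // all // orbT.
case: (boolP [exists x in X, precedes r f x k]) => [/exists_inP[x0 x0X p]|np2].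
  have all := connected_all (A := fun x => precedes r f x k) cX x0X p.
  have {}all : {in X, forall x, precedes r f x k}.
    by apply: all => x y xX yX xy; have [_ h _] := prop x y xX yX xy.
  constructor 3 => x xX; have [_ xk] := nF x xX.
  by rewrite (zero_left Af xk (rT (sXT _ xX)) rk) all // zero // all.
constructor 1 => x xX; apply/andP; split.
  by apply: contra np1 => p; apply/exists_inP; exists x.
by apply: contra np2 => p; apply/exists_inP; exists x.
Qed.

(** The added rows may lie within the span of [X], neither beside it nor around it. They have to
    move along with [X] to obtain an encapsulated set. *)
Definition hull X : {set I} :=
  X :|: [set k in T | (k \notin X) && [forall x in X, ~~ precedes r f k x && ~~ precedes r f x k]
                      && [exists x in X, r k < r x]%N].

(** Let [k] be shorter than [x1], and [y] a flipped neighbour of [x1]. On one side [y] reaches at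
    least one cell beyond [x1], further than [k] can; on the other side, sticking out of [x1] would
    make [k] comparable to [y]. *)
Lemma hull_bounds X k : closed_block (flipped f g) X -> k \in hull X ->
  (exists2 x, x \in X & 0 <= f x k) /\
  (exists2 x, x \in X & (r k)%:Z <= (r x)%:Z + f k x).
Proof.
case=> /subsetP sXT cX X2 _; rewrite /hull in_setU inE; have [f0 _ _] := Af.
case/orP=> [kX|/andP[kT /andP[/andP[kX /forall_inP inc] /exists_inP[x1 x1X lt1]]]].
  by split; exists k => //; rewrite f0 ?addr0.
have [y yX /andP[yx1 x1y]] := connected_nbr cX x1X X2.
have [x1T yT] := (sXT _ x1X, sXT _ yX).
have kx x : x \in X -> k != x by move=> xX; apply: contraNneq kX => ->.
have [k1 ky] := (kx _ x1X, kx _ yX).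
have /andP[i1 i2] := inc _ x1X; have /andP[i3 i4] := inc _ yX.
have n1 := alcoveN Af k1; have n2 := alcoveN Af ky; have n3 := alcoveN Af yx1.
have t1 := alcove_le k y x1 Af; have t2 := alcove_le y x1 k Af.
have t3 := alcove_le x1 y k Af; have t4 := alcove_le k x1 y Af.
have : precedes r f x1 y || precedes r f y x1.
  by rewrite (comparable_flipped_kept Af Ag rT fg) // x1y.
case/orP=> p.
  split; first exists x1 => //.
    by move: i1 i2 i3 i4 n1 n2 n3 t1 t2 t3 t4 p lt1; rewrite /precedes; clear; lia.
  exists y => //.
  by move: i1 i2 i3 i4 n1 n2 n3 t1 t2 t3 t4 p lt1; rewrite /precedes; clear; lia.
split; first exists y => //.
  by move: i1 i2 i3 i4 n1 n2 n3 t1 t2 t3 t4 p lt1; rewrite /precedes; clear; lia.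
exists x1 => //.
by move: i1 i2 i3 i4 n1 n2 n3 t1 t2 t3 t4 p lt1; rewrite /precedes; clear; lia.
Qed.

End Components.
End Orientation.

(** * Blocks whose hull is everything *)

Section Hull.
Variables (I : finType) (r : I -> nat).
Implicit Types (f g h : I -> I -> int) (i j k x y z : I) (T X Y : {set I}).

Section Pair.
Variables (f g : I -> I -> int) (T : {set I}).
Hypotheses (Af : alcove f) (Ag : alcove g) (rT : {in T, forall x, (0 < r x)%N}).
Hypothesis fg : {in T &, forall x y, x != y -> wt r f x y = wt r g x y}.

Lemma hull_sub X : X \subset T -> X \subset hull r f T X /\ hull r f T X \subset T.
Proof.
move=> XT; split; first exact: subsetUl.
by rewrite subUset XT; apply/subsetP => x; rewrite inE => /andP[].
Qed.

Lemma hull_encapsulated X : closed_block T (flipped r f g) X ->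
  encapsulated r f T -> encapsulated r f (hull r f T X).
Proof.
move=> BX; have [XT cX X2 cl] := BX; have [XH HT] := hull_sub XT.
move=> enc; apply: encapsulated_sub HT enc _ => k kT kH rk.
have kX : k \notin X by apply: contra kH; apply: (subsetP XH).
have hb y yH := @hull_bounds I r f g T Af Ag rT fg X y BX yH.
have [inc|lf|rt] := flipped_component Af Ag rT fg BX kT kX; last first.
- constructor 2 => y yH; have [_ [x xX le]] := hb y yH.
  by have := alcove_le y x k Af; have := rt x xX; move: le; clear; lia.
- constructor 1 => y yH; have [[x xX le] _] := hb y yH.
  by have := alcove_le k x y Af; have := lf x xX; move: le; clear; lia.
have rXk x : x \in X -> (r x <= r k)%N.
  move=> xX; rewrite leqNgt; apply: contra kH => lt.
  rewrite in_setU inE kT kX /=; apply/orP; right; apply/andP; split.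
    by apply/forall_inP.
  by apply/exists_inP; exists x.
have bX x : x \in X -> (-1 <= f k x) && ((r x)%:Z - (r k)%:Z - 1 <= f x k).
  move=> xX; have kx : k != x by apply: contraNneq kX => ->.
  by rewrite (outer_incomparable Af kx (rXk _ xX)); apply: inc.
constructor 3 => y yH; have [[x xX le] [x' x'X le']] := hb y yH; split.
- move: yH; rewrite in_setU inE => /orP[/rXk//|/andP[_ /andP[_ /exists_inP[x2 x2X]]]].
  by move/ltnW/leq_trans; apply; apply: rXk.
- by have /andP[+ _] := bX x xX; have := alcove_le k x y Af; move: le; clear; lia.
- by have /andP[_] := bX x' x'X; have := alcove_le y x' k Af; move: le'; clear; lia.
Qed.

Lemma flipped_block x y : x \in T -> y \in T -> flipped r f g x y ->
  closed_block T (flipped r f g) (component (flipped r f g) T x).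
Proof.
move=> xT yT xy; have sym := @flippedC I r f g; set e := flipped r f g in xy sym *.
have xC := component_refl e xT; have sC := component_sub e T x.
have step a b : a \in component e T x -> b \in T -> e a b -> b \in component e T x.
  by move=> aC bT ab; apply: component_step ab.
split=> //.
- apply: (component_connected sym xC); apply/eqP; rewrite eqEsubset component_sub /=.
  apply: component_ind; rewrite ?component_refl // => a b aC _ bC ab.
  exact: component_step aC bC ab.
- have yx : y != x by apply: contraTneq xy => ->; rewrite /e /flipped !precedes_irr.
  have yC : y \in component e T x by apply: step xy.
  by rewrite (cardsD1 x) xC (cardsD1 y) in_setD1 yx yC.
- by move=> a k aC kT kC; apply: contra kC; apply: step.
Qed.

(* X is a block of e whose hull is all of T. *)
Definition spanning_block (e : rel I) X : bool :=
  [&& X \subset T, connected e X, 1 < #|X| &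
   [forall k in T :\: X, [forall x in X, ~~ precedes r f k x && ~~ precedes r f x k]
                         && [exists x in X, r k < r x]]]%N.

Lemma spanning_blockP (e : rel I) X : spanning_block e X ->
  [/\ X \subset T, connected e X, (1 < #|X|)%N &
   forall k, k \in T -> k \notin X ->
     incomparable_to r f X k /\ exists2 x, x \in X & (r k < r x)%N].
Proof.
case/and4P=> XT cX X2 /forall_inP H; split=> // k kT kX.
have /andP[/forall_inP h1 /exists_inP h2] : [forall x in X, ~~ precedes r f k x && ~~ precedes r f x k]
                         && [exists x in X, r k < r x]%N by apply: H; rewrite inE kX.
by [].
Qed.

Lemma hull_spanning X : closed_block T (flipped r f g) X -> hull r f T X = T ->
  spanning_block (flipped r f g) X.
Proof.
case=> XT cX X2 _ HT; apply/and4P; split=> //; apply/forall_inP => k.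
rewrite inE => /andP[kX kT]; move: kT; rewrite -{1}HT in_setU inE (negPf kX) /=.
by case/andP.
Qed.

Lemma spanning_block_comparable (e : rel I) X Y : spanning_block e X -> Y \subset T ->
    connected [rel x y | precedes r f x y || precedes r f y x] Y ->
    Y :&: X != set0 ->
  Y \subset X.
Proof.
case/spanning_blockP=> XT _ _ clX YT cY YX.
apply: contraT => nYX; exfalso.
have [||| a [b [aQ bY bQ /= ab]]] := connectedP (Q := Y :&: X) cY => //.
- by apply: subsetIl.
- by apply: contraNneq nYX => <-; apply: subsetIr.
move: aQ bQ; rewrite !inE bY => /andP[aY aX] /= bX.
have [inc _] := clX b (subsetP YT _ bY) bX.
by have /andP[/negPf n1 /negPf n2] := inc a aX; rewrite n1 n2 in ab.
Qed.

Lemma connected_mono (e e' : rel I) X : {in X &, subrel e e'} -> connected e X ->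
  connected e' X.
Proof.
move=> sub cX; apply/forallP => Q; apply/implyP => /andP[/andP[QX Q0] QnX].
have [a [b [aQ bX bQ ab]]] := connectedP cX QX Q0 QnX.
apply/exists_inP; exists a => //; apply/exists_inP; exists b; rewrite ?inE ?bQ //.
by apply: sub; rewrite // (subsetP QX).
Qed.

(** Comparability leads out of neither block, so blocks that meet coincide. If they were disjoint, a
    longest row of [X] would be shorter than a row of [Y], and that one shorter than another row of
    [X]. *)
Lemma spanning_blocks_eq X Y : spanning_block (flipped r f g) X ->
  spanning_block (kept r f g) Y -> X = Y.
Proof.
move=> bX bY; have [XT cX X2 clX] := spanning_blockP bX.
have [YT cY Y2 clY] := spanning_blockP bY.
have cPX : connected [rel x y | precedes r f x y || precedes r f y x] X.
  apply: connected_mono cX => x y xX yX xy.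
  by rewrite /= (comparable_flipped_kept Af Ag rT fg) ?xy // (subsetP XT).
have cPY : connected [rel x y | precedes r f x y || precedes r f y x] Y.
  apply: connected_mono cY => x y xX yX xy.
  by rewrite /= (comparable_flipped_kept Af Ag rT fg) ?xy ?orbT // (subsetP YT).
have [XY0|XY] := eqVneq (X :&: Y) set0; last first.
  apply/eqP; rewrite eqEsubset (spanning_block_comparable bY XT cPX) //.
  by rewrite (spanning_block_comparable bX YT cPY) // setIC.
exfalso; have /set0Pn[x0 x0X] : X != set0 by rewrite -card_gt0; apply: leq_trans X2.
case: (@arg_maxnP _ x0 (fun x => x \in X) r x0X) => x xX max.
have nXY y : y \in X -> y \notin Y.
  by move=> yX; apply/negP => yY; have := in_set0 y; rewrite -XY0 inE yX yY.
have [_ [y yY lt]] := clY x (subsetP XT _ xX) (nXY _ xX).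
have yX : y \notin X by apply: contraTN yY; apply: nXY.
have [_ [z zX lt']] := clX y (subsetP YT _ yY) yX.
by have := max z zX; move: lt lt'; clear; lia.
Qed.

(** The blocks are one set [X], on which [flipped] and [kept] are connected. By Gallai's theorem
    [meets] is not, so some [y] of [T] is outside [X]. It meets every row of [X] but sticks out of a
    longer row [x] of [X] by less than one cell at each end. This leaves room for one component of
    [X] on each side of [x], three in all, against [four_blocks]. *)
Lemma spanning_blocks X Y : (1 < #|T|)%N -> connected (meets r f) T ->
  spanning_block (flipped r f g) X -> spanning_block (kept r f g) Y -> False.
Proof.
move=> T2 cE sX sY; have eXY := spanning_blocks_eq sX sY; subst Y.
have [XT cD X2 clX] := spanning_blockP sX; have [_ cS _ _] := spanning_blockP sY.
have H3 := three_colored_pair Af Ag rT fg.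
have /set0Pn[x0 x0X] : X != set0 by rewrite -card_gt0; apply: leq_trans X2.
have symE := @meetsC I r f.
case: (boolP [forall x in X, component (meets r f) X x == X]) => [/forall_inP full|].
  apply: (three_colored_disconnected H3 XT X2 cD cS).
  by apply: (component_connected symE x0X); apply/eqP; apply: full.
rewrite negb_forall_in => /exists_inP[x' x'X nfull].
have [y yT yX] : exists2 y, y \in T & y \notin X.
  have : X \proper T.
    rewrite properE XT; apply: contra nfull => TX.
    have eX : X = T by apply/eqP; rewrite eqEsubset XT.
    by rewrite eX (connected_component cE) // -eX.
  by case/properP=> _ [y]; exists y.
have [inc [x xX lt]] := clX y yT yX.
have nx : component (meets r f) X x != X.
  apply: contra nfull => /eqP Cx; have x'C : x' \in component (meets r f) X x by rewrite Cx.
  by rewrite (eq_component symE xX x'C) Cx.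
have xN z : z \in X -> x \notin component (meets r f) X z ->
    z != x /\ (((r z)%:Z <= f z x) || ((r x)%:Z <= f x z)).
  move=> zX nz; have [nE zx] := component_neq symE zX xX nz (component_refl _ zX).
  split=> //; apply: (zero_comparable Af zx); rewrite ?rT ?(subsetP XT) //.
  by move: nE; rewrite /meets zx negbK => /eqP.
(* The labels stand for the component of [x], the rows left of [x] and the rows right of [x]. *)
pose lab z : 'I_3 := if x \in component (meets r f) X z then inord 0
  else if ((r z)%:Z <= f z x) then inord 1 else inord 2.
apply: (four_blocks (lab := lab) H3 XT xX cD cS nx) => a b aX bX nab.
have [aT [bT xT]] := (subsetP XT _ aX, (subsetP XT _ bX, subsetP XT _ xX)).
have nba : b \notin component (meets r f) X a by apply: contra nab; apply: component_sym.
have [nE ab] := component_neq symE aX bX nba (component_refl _ aX).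
have w0 : wt r f a b = 0 by move: nE; rewrite /meets ab negbK => /eqP.
have cmp := zero_comparable Af ab (rT aT) (rT bT) w0.
have ny z : z \in X -> y != z by move=> zX; apply: contraNneq yX => ->.
have meet z : z \in X -> 0 < wt r f y z.
  move=> zX; have /andP[n1 n2] := inc z zX; rewrite (wt_incomparable Af (ny z zX)) //.
  by have := rT yT; have := rT (subsetP XT _ zX); clear; lia.
have xy : (-1 <= f x y) && ((r y)%:Z - (r x)%:Z - 1 <= f y x).
  have n := ny x xX; rewrite eq_sym in n.
  by rewrite (outer_incomparable Af n (ltnW lt)) andbC; apply: inc.
have n3 (i j : nat) : (i < 3)%N -> (j < 3)%N -> i != j -> inord i != inord j :> 'I_3.
  by move=> i3 j3; apply: contraNneq => /(congr1 val); rewrite /= !inordK // => ->.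
(* To meet [u], the row [y] would have to cover [v], which has at least one cell beyond [x]. *)
have lf u v : u \in X -> v \in X -> (r u)%:Z <= f u v -> (r v)%:Z <= f v x -> False.
  move=> uX vX uv vx; have := meet u uX; rewrite wtC left_wt0 ?ltxx //.
  have := rT (subsetP XT _ vX); have := alcove_le u v y Af; have := alcove_le v x y Af.
  by move: uv vx xy; clear; lia.
have rg u v : u \in X -> v \in X -> (r v)%:Z <= f v u -> (r x)%:Z <= f x v -> False.
  move=> uX vX uv vx; have := meet u uX; rewrite left_wt0 ?ltxx //.
  have := rT (subsetP XT _ vX); have := alcove_le y x u Af; have := alcove_le x v u Af.
  by move: uv vx xy; clear; lia.
rewrite /lab.
case: (boolP (x \in component (meets r f) X a)) => xa;
case: (boolP (x \in component (meets r f) X b)) => xb; try (case: ifP => _; exact: n3).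
- case/negP: nab; rewrite -(eq_component symE bX xb) (eq_component symE aX xa).
  exact: component_refl.
have [_ ca] := xN a aX xa; have [_ cb] := xN b bX xb.
case: (lerP (r a)%:Z (f a x)) => la; case: (lerP (r b)%:Z (f b x)) => lb; try exact: n3.
- by exfalso; case/orP: cmp => c; [apply: (lf a b) | apply: (lf b a)].
have ra : (r x)%:Z <= f x a by move: ca la; clear; lia.
have rb : (r x)%:Z <= f x b by move: cb lb; clear; lia.
by exfalso; case/orP: cmp => c; [apply: (rg b a) | apply: (rg a b)].
Qed.

End Pair.
End Hull.

(** * Rearranging one alcove into another *)

Section Rearrangement.
Variables (I : finType) (r : I -> nat) (Good : (I -> I -> int) -> Prop).
Implicit Types (f g h : I -> I -> int) (i j k l x y z : I) (T X Q : {set I}).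
Hypothesis Good_alcove : forall f, Good f -> alcove f.
Hypothesis Good_mirrored : forall f T f', Good f -> mirrored r f T f' ->
  {in T, forall x, 0 < r x}%N -> encapsulated r f T -> Good f'.

Definition same_wt_on T f g : Prop := {in T &, forall x y, x != y -> wt r f x y = wt r g x y}.

(** [Good] will mean having the weights and the polynomial of a fixed alcove. The rearrangements use
    reflections of encapsulated sets only, which preserve it. *)
Definition rearranges T g f f' : Prop :=
  [/\ Good f',
      forall k l, k != l -> (0 < r k)%N -> (0 < r l)%N -> ~~ ((k \in T) && (l \in T)) ->
        same_type r f f' k l
    & {in T &, forall k l, k != l -> same_type r f' g k l}].

Definition rearrangeable T g : Prop := forall f, Good f -> same_wt_on T f g ->
  encapsulated r f T -> exists f', rearranges T g f f'.

Lemma unflipped_same T f g : alcove f -> alcove g -> {in T, forall x, (0 < r x)%N} ->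
    same_wt_on T f g -> {in T &, forall x y, ~~ flipped r f g x y} ->
  {in T &, forall x y, x != y -> same_type r f g x y}.
Proof.
move=> Af Ag rT fg nofl x y xT yT xy.
suff [e1 e2] : precedes r f x y = precedes r g x y /\ precedes r f y x = precedes r g y x.
  by split=> //; apply: fg.
have := nofl x y xT yT; have := comparable_same Af Ag rT fg xT yT.
have := precedes_asym Af xy; have := precedes_asym Ag xy; rewrite /flipped.
by case: (precedes r f x y); case: (precedes r f y x); case: (precedes r g x y);
  case: (precedes r g y x) => // a b; have := a isT; have := b isT.
Qed.

(** Rows joined by [e] overlap while [k] overlaps no row of the component, so [k] cannot lie between
    two joined rows. *)
Lemma component_side (e : rel I) h T a k : alcove h -> symmetric e ->
    {in T, forall x, (0 < r x)%N} ->
    {in T &, forall x y, x != y -> e x y = (wt r h x y != 0)} ->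
    a \in T -> k \in T -> k \notin component e T a ->
  ((r k)%:Z <= h k a -> left_of r h (component e T a) k) /\
  ((r a)%:Z <= h a k -> right_of r h (component e T a) k).
Proof.
move=> Ah es rT eE aT kT kC; have sub := subsetP (component_sub e T a).
have zero z : z \in component e T a -> z != k /\ wt r h z k = 0.
  move=> zC; have [nE zk] := component_neq es aT kT kC zC; split=> //.
  by move: nE; rewrite eE // ?sub // negbK => /eqP.
have cmp z : z \in component e T a -> ((r z)%:Z <= h z k) || ((r k)%:Z <= h k z).
  move=> zC; have [zk w0] := zero z zC; have zT := sub z zC.
  exact: (zero_comparable Ah zk (rT z zT) (rT k kT) w0).
have meet y z : y \in component e T a -> z \in component e T a -> e y z ->
    y != z -> 0 < wt r h y z.
  move=> yC zC; have [yT zT] := (sub y yC, sub z zC) => + yz; rewrite eE // => w.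
  by rewrite lt_neqAle eq_sym w wt_ge0.
split=> [ka|ak].
  suff /subsetP H : component e T a \subset [set x | (r k)%:Z <= h k x].
    by move=> x /H; rewrite inE.
  apply: component_ind => // [|y z]; rewrite in_set // => ky yC zC yz; rewrite in_set.
  have [->//|yz'] := eqVneq z y.
  have yz'' : y != z by rewrite eq_sym.
  have := meet y z yC zC yz yz''; case/orP: (cmp z zC) => // zk.
  rewrite wtC left_wt0 //.
  by have := alcove_le z k y Ah; move: zk ky; clear; lia.
suff /subsetP H : component e T a \subset [set x | (r x)%:Z <= h x k].
  by move=> x /H; rewrite inE.
apply: component_ind => // [|y z]; rewrite in_set // => ky yC zC yz; rewrite in_set.
have [->//|yz'] := eqVneq z y.
have yz'' : y != z by rewrite eq_sym.
have := meet y z yC zC yz yz''; case/orP: (cmp z zC) => // zk.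
rewrite left_wt0 //.
by have := alcove_le y k z Ah; move: zk ky; clear; lia.
Qed.

(** The component [Q] of [a] comes first in [g]. In [f], reflecting [Q] together with everything
    left of it brings [Q] to the front. Then [Q] and [T :\: Q] lie side by side as in [g], and both
    are smaller than [T]. *)
Lemma rearrange_disconnected T g f a : alcove g -> {in T, forall x, (0 < r x)%N} ->
    (forall Q, Q \proper T -> rearrangeable Q g) ->
    Good f -> same_wt_on T f g -> encapsulated r f T -> a \in T ->
    {in T, forall x, position g a <= position g x} -> component (meets r f) T a != T ->
  exists f', rearranges T g f f'.
Proof.
move=> Ag rT IH Gf fg enc aT a_min CT; have Af := Good_alcove Gf.
set e := meets r f in CT; set Q := component e T a in CT.
have es : symmetric e by apply: meetsC.
have QT : Q \subset T by apply: component_sub.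
have sQT := subsetP QT; have aQ : a \in Q by apply: component_refl.
have eEf : {in T &, forall x y, x != y -> e x y = (wt r f x y != 0)}.
  by move=> x y _ _ xy; rewrite /e /meets xy.
have eEg : {in T &, forall x y, x != y -> e x y = (wt r g x y != 0)}.
  by move=> x y xT yT xy; rewrite eEf // fg.
have neqQ k : k \in T -> k \notin Q -> a != k.
  by move=> _; apply: contraNneq => <-.
have zero k : k \in T -> k \notin Q -> wt r f a k = 0.
  move=> kT kQ; have [nE ak] := component_neq es aT kT kQ aQ.
  by move: nE; rewrite eEf // negbK => /eqP.
have Qf k : k \in T -> k \notin Q -> (left_of r f Q k) \/ ((r a)%:Z <= f a k /\ right_of r f Q k).
  move=> kT kQ; have [hl hr] := component_side Af es rT eEf aT kT kQ.
  have := zero_comparable Af (neqQ k kT kQ) (rT a aT) (rT k kT) (zero k kT kQ).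
  by case/orP=> c; [right; split; [|apply: hr]|left; apply: hl].
have Qg k : k \in T -> k \notin Q -> right_of r g Q k.
  move=> kT kQ; have [_ hr] := component_side Ag es rT eEg aT kT kQ; apply: hr.
  have ak := neqQ k kT kQ; have ka : k != a by rewrite eq_sym.
  have w0 : wt r g a k = 0 by rewrite -fg // zero.
  have /orP[//|c] := zero_comparable Ag ak (rT a aT) (rT k kT) w0.
  have : 0 <= g k a by apply: le_trans c.
  by rewrite (position_lt Ag ka) ltNge a_min.
pose QL := Q :|: [set k in T | (k \notin Q) && ((r k)%:Z <= f k a)].
have QLT : QL \subset T.
  by rewrite subUset QT; apply/subsetP => x; rewrite inE => /andP[].
have rQL : {in QL, forall x, (0 < r x)%N} by move=> x /(subsetP QLT)/rT.
have right_QL k : k \in T -> k \notin QL -> right_of r f QL k.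
  move=> kT; rewrite in_setU inE negb_or kT /= negb_and negbK => /andP[kQ].
  rewrite (negPf kQ) /= => nk.
  have [/(_ a aQ)|[ak rQ]] := Qf k kT kQ; first by rewrite (negPf nk).
  move=> l; rewrite in_setU inE => /orP[/rQ//|/andP[lT /andP[lQ la]]].
  by have := alcove_le l a k Af; move: la ak; clear; lia.
have encQL : encapsulated r f QL.
  by apply: (encapsulated_sub QLT enc _) => k kT kQ _; constructor 2; apply: right_QL.
have QL0 : QL != set0 by apply/set0Pn; exists a; rewrite in_setU aQ.
have [f1 M] := exists_mirrored r Af QL0; have [Af1 MT _ Mside] := M.
have Gf1 := Good_mirrored Gf M rQL encQL.
have st1 := mirrored_same Af M rQL encQL.
have wt1 := mirrored_same_wt Af M rQL encQL.
have Q1 k : k \in T -> k \notin Q -> right_of r f1 Q k.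
  move=> kT kQ; case: (boolP (k \in QL)) => kQL; last first.
    have [_ h _] := Mside k kQL; have {}h := h (right_QL k kT kQL).
    by move=> x xQ; apply: h; rewrite in_setU xQ.
  move=> x xQ; have xk : x != k by apply: contraNneq kQ => <-.
  have xQL : x \in QL by rewrite in_setU xQ.
  rewrite MT //; have [h|[ak _]] := Qf k kT kQ; first by have := h x xQ; clear; lia.
  have ka : (r k)%:Z <= f k a.
    by move: kQL; rewrite in_setU inE (negPf kQ) kT.
  have := alcove_le a k a Af; have [-> _ _] := Af; have := rT k kT; move: ka ak; clear; lia.
have enc1 : encapsulated r f1 T.
  apply: (encapsulated_same Af Af1 rT _ enc) => k x kT xT rk.
  have kx : k != x by apply: contraNneq kT => ->.
  apply: st1 => //; last exact: rT.
  by apply: contra kT => /andP[kQL _]; apply: (subsetP QLT).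
have QpT : Q \proper T by rewrite properEneq CT.
have DT : T :\: Q \subset T by apply: subsetDl.
have DpT : T :\: Q \proper T.
  rewrite properEneq DT andbT; apply: contraTneq aQ => eT.
  by move: aT; rewrite -eT inE => /andP[].
have encQ1 : encapsulated r f1 Q.
  by apply: (encapsulated_sub QT enc1 _) => k kT kQ _; constructor 2; apply: Q1.
have encD1 : encapsulated r f1 (T :\: Q).
  apply: (encapsulated_sub DT enc1 _) => k kT kQ _; constructor 1 => x.
  rewrite inE => /andP[xQ xT]; apply: Q1 => //.
  by move: kQ; rewrite inE kT andbT negbK.
have f1g : same_wt_on T f1 g.
  by move=> x y xT yT xy; rewrite -wt1 // fg.
have [f2 [Gf2 st2 in2]] : exists f', rearranges Q g f1 f'.
  apply: IH => // x y xQ yQ; exact: f1g (sQT _ xQ) (sQT _ yQ).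
have Af2 := Good_alcove Gf2.
have notQ x : x \in T :\: Q -> (x \in T) /\ (x \notin Q) by rewrite inE => /andP[].
have st12 k x : x \in T :\: Q -> k != x -> (0 < r k)%N -> same_type r f1 f2 k x.
  move=> xD kx rk; have [xT xQ] := notQ x xD; apply: st2 => //; first exact: rT.
  by rewrite (negPf xQ) andbF.
have encD2 : encapsulated r f2 (T :\: Q).
  apply: (encapsulated_same Af1 Af2 _ _ encD1); first by move=> x /notQ[/rT].
  move=> k x kD xD rk; apply: st12 => //.
  by apply: contraNneq kD => ->.
have [f3 [Gf3 st3 in3]] : exists f', rearranges (T :\: Q) g f2 f'.
  apply: IH => // x y xD yD xy; have [xT xQ] := notQ x xD; have [yT yQ] := notQ y yD.
  by have [<- _ _] := st12 x y yD xy (rT x xT); apply: f1g.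
exists f3; split=> //.
  move=> k l kl rk rl nT.
  have nQ (P : {set I}) : P \subset T -> ~~ ((k \in P) && (l \in P)).
    by move=> /subsetP PT; apply: contra nT => /andP[/PT-> /PT->].
  apply: same_type_trans (st1 k l (nQ QL QLT) kl rk rl) _.
  exact: same_type_trans (st2 k l kl rk rl (nQ Q QT)) (st3 k l kl rk rl (nQ _ DT)).
move=> k l kT lT kl; have [rk rl] := (rT k kT, rT l lT).
have mixed x y : x \in Q -> y \in T -> y \notin Q -> same_type r f3 g x y.
  move=> xQ yT yQ; have xy : x != y by apply: contraNneq yQ => <-.
  have [rx ry] := (rT x (sQT x xQ), rT y yT).
  have yD : y \in T :\: Q by rewrite inE yQ yT.
  apply: same_type_trans (same_type_sym (st3 x y xy rx ry _)) _.
    by rewrite inE xQ.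
  apply: same_type_trans (same_type_sym (st12 x y yD xy rx)) _.
  by apply: left_same => //; [apply: Q1|apply: Qg].
case: (boolP (k \in Q)) => kQ; case: (boolP (l \in Q)) => lQ.
- apply: same_type_trans (in2 k l kQ lQ kl).
  by apply: same_type_sym; apply: st3; rewrite // inE kQ.
- exact: mixed.
- by apply/same_typeC; apply: mixed.
- by apply: in3; rewrite // inE ?kQ ?lQ.
Qed.

(** The hull of a flipped component is a proper subset of [T], so it can be put in the order of [g].
    This removes a flipped pair and creates none, so that still no flipped block spans [T]. *)
Lemma rearrange_clean T g : alcove g -> {in T, forall x, (0 < r x)%N} ->
    (forall Q, Q \proper T -> rearrangeable Q g) ->
  forall f, Good f -> same_wt_on T f g -> encapsulated r f T ->
    (forall X, ~~ spanning_block r f T (flipped r f g) X) ->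
  exists f', rearranges T g f f'.
Proof.
move=> Ag rT IH f.
have [n] := ubnP #|[set p : I * I | [&& p.1 \in T, p.2 \in T & flipped r f g p.1 p.2]]|.
elim: n f => // n IHn f; rewrite ltnS => fn Gf fg enc nsp; have Af := Good_alcove Gf.
case: (boolP [exists x in T, exists y in T, flipped r f g x y]) => [|nofl]; last first.
  exists f; split=> //.
  apply: unflipped_same => // x y xT yT; apply: contra nofl => xy.
  by apply/exists_inP; exists x => //; apply/exists_inP; exists y.
case/exists_inP=> x xT /exists_inP[y yT xy].
have BX := flipped_block Af Ag xT yT xy; set X := component _ _ _ in BX.
have [XT _ _ _] := BX; have [XH HT] := hull_sub r f XT.
have xX : x \in X by apply: component_refl.
have yX : y \in X by apply: component_step xX yT xy.
have encH := hull_encapsulated Af Ag rT fg BX enc.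
have HpT : hull r f T X \proper T.
  rewrite properEneq HT andbT; apply: contra (nsp X) => /eqP; exact: hull_spanning.
have [|f1 [Gf1 st1 in1]] := IH _ HpT f Gf _ encH.
  by move=> u v /(subsetP HT) uT /(subsetP HT) vT; apply: fg.
have Af1 := Good_alcove Gf1.
have wt1 u v : u \in T -> v \in T -> u != v -> wt r f1 u v = wt r f u v.
  move=> uT vT uv; case: (boolP ((u \in hull r f T X) && (v \in hull r f T X))).
    by case/andP=> uH vH; have [-> _ _] := in1 u v uH vH uv; rewrite fg.
  by move=> nH; have [-> _ _] := st1 u v uv (rT u uT) (rT v vT) nH.
have flip1 u v : u \in T -> v \in T -> flipped r f1 g u v ->
    flipped r f g u v && ~~ ((u \in hull r f T X) && (v \in hull r f T X)).
  move=> uT vT fl; have uv : u != v.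
    by apply: contraTneq fl => ->; rewrite /flipped !precedes_irr.
  case: (boolP ((u \in hull r f T X) && (v \in hull r f T X))) => [/andP[uH vH]|nH].
    have [_ e1 e2] := in1 u v uH vH uv; move: fl; rewrite /flipped e1 e2.
    case/orP=> /andP[p1 p2].
      by have := precedes_asym Ag uv p1; rewrite p2.
    by have := precedes_asym Ag uv p2; rewrite p1.
  have [_ e1 e2] := st1 u v uv (rT u uT) (rT v vT) nH.
  by move: fl; rewrite /flipped e1 e2 => ->.
have f1g : same_wt_on T f1 g by move=> u v uT vT uv; rewrite wt1 // fg.
have enc1 : encapsulated r f1 T.
  apply: (encapsulated_same Af Af1 rT _ enc) => k z kT zT rk.
  have kz : k != z by apply: contraNneq kT => ->.
  apply: st1 => //; first exact: rT.
  by apply: contra kT => /andP[kH _]; apply: (subsetP HT).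
have [||f2 [Gf2 st2 in2]] := IHn f1 _ Gf1 f1g enc1.
- apply: leq_trans fn; apply: proper_card; apply/properP; split.
    apply/subsetP => -[u v]; rewrite !inE /= => /and3P[uT vT fl].
    by rewrite uT vT; have /andP[->] := flip1 u v uT vT fl.
  exists (x, y); rewrite !inE /= xT yT /= ?xy //.
  by apply/negP => /(flip1 x y xT yT)/andP[_]; rewrite !(subsetP XH).
- move=> Y; apply: contra (nsp Y) => /spanning_blockP[YT cY Y2 clY].
  have inT := subsetP YT.
  apply/and4P; split=> //.
    by apply: connected_mono cY => u v uY vY /(flip1 u v (inT _ uY) (inT _ vY))/andP[].
  apply/forall_inP => k; rewrite inE => /andP[kY kT].
  have [inc [z zY lt]] := clY k kT kY; apply/andP; split; last by apply/exists_inP; exists z.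
  apply/forall_inP => u uY; have := inc u uY; rewrite -!negb_or.
  have ku : k != u by apply: contraNneq kY => ->.
  have uT := inT u uY; rewrite (comparable_wt Af rT kT uT ku).
  by rewrite (comparable_wt Af1 rT kT uT ku) wt1.
exists f2; split=> // k l kl rk rl nT; apply: same_type_trans (st2 k l kl rk rl nT).
apply: st1 => //; apply: contra nT => /andP[kH lH].
by rewrite !(subsetP HT).
Qed.

(** If a flipped block spans [T], then [T] is reflected first. This exchanges flipped and kept
    pairs, and by [spanning_blocks] no flipped block spans [T] afterwards. *)
Lemma rearrangement T g : alcove g -> {in T, forall x, (0 < r x)%N} -> rearrangeable T g.
Proof.
move=> Ag; have [n] := ubnP #|T|; elim: n T => // n IHn T; rewrite ltnS => Tn rT.
have IH Q : Q \proper T -> rearrangeable Q g.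
  move=> QT; apply: IHn; first by apply: leq_trans (proper_card QT) Tn.
  by move=> x xQ; apply: rT; apply: (subsetP (proper_sub QT)).
move=> f Gf fg enc; have Af := Good_alcove Gf.
have [T1|T2] := leqP #|T| 1.
  exists f; split=> // k l kT lT.
  by rewrite (card_le1_eqP T1 k l) // eqxx.
have /set0Pn[a0 a0T] : T != set0 by rewrite -card_gt0; apply: leq_trans T2.
case: (@Order.TotalTheory.arg_minP _ _ _ a0 (fun x => x \in T) (position g) a0T) => a aT a_min.
case: (eqVneq (component (meets r f) T a) T) => [CT|CT]; last first.
  exact: (rearrange_disconnected Ag rT IH Gf fg enc aT a_min CT).
have cE := component_connected (@meetsC I r f) aT CT.
case: (boolP [exists X : {set I}, spanning_block r f T (flipped r f g) X]) => [/existsP[X sX]|]; last first.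
  rewrite negb_exists => /forallP nsp.
  exact: (rearrange_clean Ag rT IH Gf fg enc nsp).
have T0 : T != set0 by apply/set0Pn; exists a.
have [f1 M] := exists_mirrored r Af T0; have [Af1 MT _ _] := M.
have Gf1 := Good_mirrored Gf M rT enc.
have st1 := mirrored_same Af M rT enc.
have fl1 u v : u \in T -> v \in T -> flipped r f1 g u v = kept r f g u v.
  move=> uT vT; have [->|uv] := eqVneq u v; first by rewrite /flipped /kept !precedes_irr.
  have vu : v != u by rewrite eq_sym.
  by rewrite /flipped /kept !(mirrored_precedes Af M) // orbC.
have wt1 u v : u \in T -> v \in T -> u != v -> wt r f1 u v = wt r f u v.
  exact: (mirrored_wt Af M).
have f1g : same_wt_on T f1 g by move=> u v uT vT uv; rewrite wt1 // fg.
have enc1 : encapsulated r f1 T.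
  apply: (encapsulated_same Af Af1 rT _ enc) => k x kT xT rk.
  have kx : k != x by apply: contraNneq kT => ->.
  by apply: st1 => //; [rewrite (negPf kT)|apply: rT].
have [|f2 [Gf2 st2 in2]] := rearrange_clean Ag rT IH Gf1 f1g enc1.
  move=> Y; apply/negP => /spanning_blockP[YT cY Y2 clY]; have inT := subsetP YT.
  apply: (spanning_blocks Af Ag rT fg T2 cE sX (Y := Y)).
  apply/and4P; split=> //.
    by apply: connected_mono cY => u v uY vY; rewrite fl1 ?inT.
  apply/forall_inP => k; rewrite inE => /andP[kY kT].
  have [inc [z zY lt]] := clY k kT kY; apply/andP; split; last by apply/exists_inP; exists z.
  apply/forall_inP => u uY; have := inc u uY; rewrite -!negb_or.
  have ku : k != u by apply: contraNneq kY => ->.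
  have uT := inT u uY; rewrite (comparable_wt Af rT kT uT ku).
  by rewrite (comparable_wt Af1 rT kT uT ku) wt1.
exists f2; split=> // k l kl rk rl nT.
exact: same_type_trans (st1 k l nT kl rk rl) (st2 k l kl rk rl nT).
Qed.

End Rearrangement.

(** * The weights determine the polynomial *)

Section WeightsDetermine.
Variables (R : idomainType) (q : R) (L : nat) (xs : seq R) (I : finType).
Implicit Types (f g h : I -> I -> int) (r : I -> nat).

Lemma sum_sq_le r : (\sum_k r k ^ 2 <= (\sum_k r k) ^ 2)%N.
Proof.
rewrite -mulnn big_distrl; apply: leq_sum => k _ /=.
by rewrite -mulnn leq_mul2l (bigD1 k) //= leq_addr orbT.
Qed.

Theorem letter_sum_wt f g r : q != 0 -> (\sum_k r k < L)%N -> alcove f -> alcove g ->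
    (forall i j, i != j -> wt r f i j = wt r g i j) ->
  letter_sum q L f xs r = letter_sum q L g xs r.
Proof.
move=> q0; have [n] := ubnP (L ^ 2 - \sum_k r k ^ 2)%N.
elim: n r f g => // n IHn r f g; rewrite ltnS => rn rL Af.
have spread w f1 g1 : (\sum_k w k = \sum_k r k)%N -> (\sum_k r k ^ 2 < \sum_k w k ^ 2)%N ->
    alcove f1 -> alcove g1 -> (forall i j, i != j -> wt w f1 i j = wt w g1 i j) ->
    letter_sum q L f1 xs w = letter_sum q L g1 xs w.
  move=> ew lt; apply: IHn; last by rewrite ew.
  have := sum_sq_le w; rewrite ew; have : ((\sum_k r k) ^ 2 <= L ^ 2)%N by rewrite leq_sqr ltnW.
  by move: rn lt; clear; lia.
(* Weights are bounded by lengths, so [mu] falls when weights rise; its diagonal terms vanish for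
   every alcove. *)
pose mu h := (\sum_(p : I * I) absz ((r p.1)%:Z - wt r h p.1 p.2))%N.
have [m] := ubnP (mu f); elim: m f g Af => // m IHm f g Af; rewrite ltnS => fm Ag fg.
have raise f1 g1 : alcove f1 -> alcove g1 ->
    (forall i j, i != j -> wt r f1 i j = wt r g1 i j) ->
    (forall i j, i != j -> wt r f i j <= wt r f1 i j) ->
    (exists i j, i != j /\ wt r f i j < wt r f1 i j) ->
    letter_sum q L f1 xs r = letter_sum q L g1 xs r.
  move=> Af1 Ag1 eq1 le1 [i [j [ij lt1]]]; apply: IHm => //.
  apply: leq_trans fm; rewrite /mu (bigD1 (i, j)) //= [X in (_ < X)%N](bigD1 (i, j)) //=.
  rewrite -addSn; apply: leq_add.
    by have := wt_le r f1 i j; move: lt1; clear; lia.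
  apply: leq_sum => -[k l] _ /=; have := wt_le r f1 k l.
  have [->|kl] := eqVneq k l; last by have := le1 k l kl; clear; lia.
  by have [[f0 _ _] [f10 _ _]] := (Af, Af1); rewrite /wt f0 f10.
pose Good h := [/\ alcove h, forall i j, i != j -> wt r h i j = wt r f i j
  & letter_sum q L h xs r = letter_sum q L f xs r].
have Good_mirrored h T h' : Good h -> mirrored r h T h' ->
    {in T, forall x, 0 < r x}%N -> encapsulated r h T -> Good h'.
  case=> Ah hf eh M rT enc; have [Ah' _ _ _] := M; split=> // [i j ij|].
    by rewrite -hf // -(mirrored_same_wt Ah M).
  by rewrite -eh -(mirrored_sum q0 rL spread raise Ah hf M rT enc).
pose T := [set i | 0 < r i]%N.
have rT : {in T, forall x, 0 < r x}%N by move=> x; rewrite inE.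
have [|||f' [[Af' _ <-] _ in']] :=
  @rearrangement _ r Good (fun h => fun '(And3 a _ _) => a) Good_mirrored T g Ag rT f.
- by split.
- by move=> x y _ _; apply: fg.
- by move=> k; rewrite inE => /negPf->.
apply: same_type_sum => // i j ij ri rj.
by apply: in'; rewrite // inE.
Qed.

End WeightsDetermine.

(** * Fillings *)

Lemma card_ord_lt n s : (s <= n)%N -> #|[set t : 'I_n | (t < s)%N]| = s.
Proof.
move=> sn; rewrite -sum1_card; transitivity (\sum_(t < s) 1)%N; last by rewrite sum1_card card_ord.
rewrite (big_ord_widen n (fun=> 1%N)) //.
by apply: eq_bigl => t; rewrite inE.
Qed.

Lemma initial_segment n (D : pred 'I_n) :
    (forall s t : 'I_n, (s <= t)%N -> D t -> D s) ->
  forall s, D s = (s < #|[set t | D t]|)%N.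
Proof.
move=> down s; case: (boolP (D s)) => Ds; apply/esym.
  rewrite -ltnS -[X in (X < _)%N](card_ord_lt (ltn_ord s)).
  apply: subset_leq_card; apply/subsetP => t; rewrite !inE ltnS => ts; exact: down Ds.
apply/negbTE; rewrite -leqNgt -[X in (_ <= X)%N](card_ord_lt (ltnW (ltn_ord s))).
apply: subset_leq_card; apply/subsetP => t; rewrite !inE => Dt.
by rewrite ltnNge; apply: contra Ds => st; apply: down Dt.
Qed.

Lemma overlap_count n m a b c v : (a <= b)%N -> (b <= n)%N -> (v <= m)%N ->
  overlap a b c v = (\sum_(p < n) \sum_(s < m)
    [&& ((s : nat)%:Z == (p : nat)%:Z - c)%R, (a <= p < b)%N & (s < v)%N])%N.
Proof.
move=> ab bn vm.
have inner (p : nat) : (\sum_(s < m) (((s : nat)%:Z == p%:Z - c)%R && (s < v)%N))%N =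
    ((c <= p%:Z) && (p%:Z < c + v%:Z)) :> nat.
  case: (boolP ((c <= p%:Z) && _)) => [/andP[l1 l2]|nl]; last first.
    rewrite big1 // => s _; case: eqP => //= e; case: ltnP => // sv.
    by move: nl e sv; clear; lia.
  have sm : (absz (p%:Z - c)%R < m)%N by move: l1 l2 vm; clear; lia.
  rewrite (bigD1 (Ordinal sm)) //= big1 ?addn0.
    by move: l1 l2; clear; lia.
  move=> s; rewrite -val_eqE /= => ne; case: eqP => //= e.
  by move: ne; rewrite -e; clear; lia.
rewrite (eq_bigr (fun p : 'I_n => if (a <= p < b)%N then
    ((c <= (p : nat)%:Z) && ((p : nat)%:Z < c + v%:Z)) : nat else 0%N)); last first.
  move=> p _; case: ifP => _; last by apply: big1 => s _; rewrite andbF.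
  by rewrite -inner.
rewrite -big_mkcond /=; pose F p : nat := (c <= p%:Z) && (p%:Z < c + v%:Z).
have <- : (\sum_(a <= p < b) F p = \sum_(p < n | (a <= p < b)%N) F p)%N.
  rewrite (big_nat_widen _ _ n) // (big_nat_widenl a 0) // big_mkord.
  by apply: eq_bigl => p; rewrite andbC.
rewrite /F {F}.
elim: b ab {bn} => [|b IH]; first by rewrite leqn0 => /eqP->; rewrite overlap0l big_geq.
rewrite leq_eqVlt ltnS => /orP[/eqP->|ab]; first by rewrite overlap0l big_geq.
rewrite big_nat_recr //= PoszD -IH // /overlap /clamp.
by move: ab; clear; lia.
Qed.

Section Fillings.
Variables (R : idomainType) (q : R) (L K : nat) (x : nat -> R).
Variables (I : finType) (f : I -> I -> int) (r : I -> nat).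
Hypothesis rL : forall i, (r i < L)%N.

Let cells : finType := {i : I & 'I_(r i)}.
Implicit Types (T : {ffun cells -> 'I_K.+1}) (w : I -> nat) (u : {ffun I -> 'I_L}).

(* The cells beyond the first w i ones of row i are empty, marked by K; the
   others have entries below b. *)
Definition row_filling b w T : bool :=
  [forall c : cells, if (tagged c < w (tag c))%N then (T c < b)%N else T c == K :> nat] &&
  [forall c : cells, forall d : cells, (tag c == tag d) && (tagged c <= tagged d)%N ==> (T c <= T d)%N].

(** In real positions: [d] starts at or after the start of [c], by less than one cell. An attack is
    an inversion when [c] has the larger entry. *)
Definition attacks (c d : cells) : bool :=
  (tag d != tag c) && ((tagged d : nat)%:Z == (tagged c : nat)%:Z - f (tag c) (tag d)).

Definition inversions T : nat :=
  (\sum_(c : cells) \sum_(d : cells) (attacks c d && (T d < T c < K)))%N.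

Definition entries T : R := \prod_(c : cells | (T c < K)%N) x (T c).

Lemma row_fillingP b w T : row_filling b w T ->
  [/\ forall c : cells, (tagged c < w (tag c))%N -> (T c < b)%N,
      forall c : cells, (w (tag c) <= tagged c)%N -> T c = K :> nat
    & forall i (s t : 'I_(r i)), (s <= t)%N -> (T (Tagged _ s) <= T (Tagged _ t))%N].
Proof.
case/andP=> /forallP H1 /forallP H2; split=> [c lt|c le|i s t st].
- by have := H1 c; rewrite lt.
- by have := H1 c; rewrite ltnNge le => /eqP.
have /forallP/(_ (Tagged (fun i => 'I_(r i)) t)) := H2 (Tagged (fun i => 'I_(r i)) s).
by rewrite /= eqxx st.
Qed.

Lemma row_filling_intro b w T :
    (forall c : cells, (tagged c < w (tag c))%N -> (T c < b)%N) ->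
    (forall c : cells, (w (tag c) <= tagged c)%N -> T c = K :> nat) ->
    (forall i (s t : 'I_(r i)), (s <= t)%N -> (T (Tagged _ s) <= T (Tagged _ t))%N) ->
  row_filling b w T.
Proof.
move=> H1 H2 H3; apply/andP; split; apply/forallP => c.
  by case: ltnP => [/H1|/H2->].
apply/forallP => -[j t]; case: c => i s; apply/implyP => /= /andP[/eqP e].
by case: j / e t => t; apply: H3.
Qed.

Lemma cross_inv_count u w : (forall i, u i <= w i)%N -> (forall i, w i <= r i)%N ->
  absz (cross_inv f (fun i => u i) w) = (\sum_(c : cells) \sum_(d : cells)
    (attacks c d && ((u (tag c) <= tagged c < w (tag c)) && (tagged d < u (tag d)))))%N.
Proof.
move=> uw wr; rewrite /cross_inv.
rewrite (eq_bigr (fun i => (\sum_(j | j != i) \sum_(p < r i) \sum_(s < r j)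
    [&& ((s : nat)%:Z == (p : nat)%:Z - f i j)%R, (u i <= p < w i) & (s < u j)])%N%:Z)); last first.
  move=> i _; rewrite -[RHS]natz natr_sum; apply: eq_bigr => j _; rewrite natz.
  by apply: overlap_count => //; apply: leq_trans (uw j) (wr j).
under eq_bigr do rewrite -natz.
rewrite -natr_sum natz absz_nat.
transitivity (\sum_i \sum_(p < r i) \sum_j \sum_(s < r j)
   ((j != i) && [&& ((s : nat)%:Z == (p : nat)%:Z - f i j)%R, (u i <= p < w i) & (s < u j)]))%N.
  apply: eq_bigr => i _; rewrite exchange_big /= ; apply: eq_bigr => p _.
  rewrite big_mkcond; apply: eq_bigr => j _; case: (j != i) => //=.
  by rewrite big1.
rewrite (sig_big_dep (fun=> true) (fun _ _ => true) (fun i (p : 'I_(r i)) => \sum_j \sum_(s < r j)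
   ((j != i) && [&& ((s : nat)%:Z == (p : nat)%:Z - f i j)%R, (u i <= p < w i) & (s < u j)])))%N /=.
apply: eq_bigr => c _; rewrite (sig_big_dep (fun=> true) (fun _ _ => true) (fun j (s : 'I_(r j)) =>
   ((j != tag c) && [&& ((s : nat)%:Z == (tagged c : nat)%:Z - f (tag c) j)%R,
      (u (tag c) <= tagged c < w (tag c)) & (s < u j)]) : nat))%N /=.
by apply: eq_bigr => d _; rewrite /attacks -!andbA.
Qed.

Definition top_letter b u w T : {ffun cells -> 'I_K.+1} :=
  [ffun c : cells => if (tagged c < u (tag c))%N then T c
     else if (tagged c < w (tag c))%N then inord b else ord_max].

(** The inverse of [top_letter]. Entries below [b] fill an initial segment of each row, so counting
    them gives its length. *)
Definition lower_letters b T : {ffun I -> 'I_L} * {ffun cells -> 'I_K.+1} :=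
  ([ffun i => Ordinal (leq_ltn_trans (max_card [set s : 'I_(r i) | T (Tagged _ s) < b])%N
     (eq_ind_r (fun n => n < L)%N (rL i) (card_ord _)))],
   [ffun c => if (T c < b)%N then T c else ord_max]).

Lemma lower_letters_count b i w T : row_filling b.+1 w T -> forall s : 'I_(r i),
  (T (Tagged (fun i => 'I_(r i)) s) < b)%N = (s < (lower_letters b T).1 i)%N.
Proof.
case/row_fillingP=> _ _ mono s; rewrite /lower_letters /= ffunE /=.
rewrite (@initial_segment _ (fun s => (T (Tagged (fun i => 'I_(r i)) s) < b)%N)) //.
by move=> t t' tt'; apply: leq_ltn_trans; apply: mono.
Qed.

Lemma lower_lettersP b w T : (b < K)%N -> row_filling b.+1 w T ->
  let p := lower_letters b T in
  [/\ forall i, (p.1 i <= w i)%N, row_filling b (fun i => p.1 i) p.2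
    & top_letter b p.1 w p.2 = T].
Proof.
move=> bK F p; have cnt i s := @lower_letters_count b i w T F s.
have [lt eqK mono] := row_fillingP F.
have cntc (c : cells) : (T c < b)%N = (tagged c < p.1 (tag c))%N by case: c => i s; apply: cnt.
have p2 c : p.2 c = if (T c < b)%N then T c else ord_max by rewrite ffunE.
have uw i : (p.1 i <= w i)%N.
  rewrite leqNgt; apply/negP => lt'; have wr : (w i < r i)%N.
    apply: leq_trans lt' _; rewrite /p /lower_letters /= ffunE /=.
    by apply: leq_trans (max_card _) _; rewrite card_ord.
  have := cnt i (Ordinal wr); rewrite /= lt' eqK //.
  by move: bK; clear; lia.
split=> //.
  apply: row_filling_intro => [c|c|i s t st].
  - by rewrite p2 -cntc => cb; rewrite cb.
  - by rewrite p2 leqNgt -cntc => /negPf->.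
  rewrite !p2; case: ifP => sb; case: ifP => tb //; first exact: mono.
    by rewrite -ltnS ltn_ord.
  by have := mono i s t st; move: sb tb; clear; lia.
apply/ffunP => c; apply: ord_inj; rewrite ffunE -cntc p2; case: ifP => [->//|nb].
case: ltnP => [/lt|/eqK->//]; rewrite inordK; last by apply: leq_trans bK _.
by move: nb; clear; lia.
Qed.

Lemma top_letterP b u w T : (b < K)%N -> (forall i, u i <= w i)%N -> (forall i, w i <= r i)%N ->
    row_filling b (fun i => u i) T ->
  let T' := top_letter b u w T in
  [/\ row_filling b.+1 w T', lower_letters b T' = (u, T),
      inversions T' = (inversions T + absz (cross_inv f (fun i => u i) w))%N
    & entries T' = x b ^+ (\sum_i w i - \sum_i u i) * entries T].
Proof.
move=> bK uw wr F T'; have [lt eqK mono] := row_fillingP F.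
have vb : (inord b : 'I_K.+1) = b :> nat by rewrite inordK //; apply: leq_trans bK _.
have T'E (c : cells) : T' c = (if (tagged c < u (tag c))%N then T c : nat
    else if (tagged c < w (tag c))%N then b else K) :> nat.
  by rewrite ffunE; do 2?case: ifP.
have TE (c : cells) : ((tagged c < u (tag c)) && (T c < b) || (u (tag c) <= tagged c) && (T c == K :> nat))%N.
  by case: ltnP => [/lt->|/eqK->]; rewrite // eqxx.
have T'b (c : cells) : (T' c < b)%N = (tagged c < u (tag c))%N.
  rewrite T'E; case: ifP => [/lt->//|_]; case: ifP => _; first by rewrite ltnn.
  by apply/negbTE; rewrite -leqNgt ltnW.
split.
- apply: row_filling_intro => [c cw|c cw|i s t st].
  + rewrite T'E cw; case: ifP => [/lt|]//; by rewrite ltnS => /ltnW.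
  + by rewrite T'E ltnNge (leq_trans (uw _) cw) /= ltnNge cw.
  have := mono i s t st; have := lt (Tagged _ s); rewrite !T'E /=.
  move: st bK (uw i); clear; case: (ltnP s (u i)); case: (ltnP s (w i));
    case: (ltnP t (u i)); case: (ltnP t (w i)); lia.
- rewrite /lower_letters; congr (_, _); last first.
    apply/ffunP => c; apply: ord_inj; rewrite ffunE T'b; case: ltnP => [cu|/eqK->//].
    by rewrite T'E cu.
  apply/ffunP => i; apply: val_inj; rewrite ffunE /=.
  rewrite -[RHS](@card_ord_lt (r i)); last exact: leq_trans (uw i) (wr i).
  by apply: eq_card => s; rewrite !inE T'b.
- rewrite cross_inv_count // /inversions -big_split; apply: eq_bigr => c _.
  rewrite -big_split; apply: eq_bigr => d _ /=; case: (attacks c d) => //=.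
  have := TE c; have := TE d; rewrite !T'E; move: bK (uw (tag c)) (uw (tag d)); clear.
  case: (ltnP (tagged c) (u (tag c))); case: (ltnP (tagged c) (w (tag c)));
    case: (ltnP (tagged d) (u (tag d))); case: (ltnP (tagged d) (w (tag d))) => /=; rewrite ?andbF ?addn0 ?add0n;
    try (congr nat_of_bool); try lia.
rewrite /entries (bigID (fun c => T' c < b)%N) /= mulrC; congr (_ * _).
  rewrite (eq_bigl (fun c : cells => (u (tag c) <= tagged c < w (tag c))%N)); last first.
    move=> c; rewrite T'E; move: bK (uw (tag c)) (lt c); clear.
    case: (ltnP (tagged c) (u (tag c))); case: (ltnP (tagged c) (w (tag c))); lia.
  rewrite (eq_bigr (fun=> x b)); last first.
    by move=> c /andP[cu cw]; rewrite T'E ltnNge cu cw.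
  rewrite prodr_const; congr (_ ^+ _).
  rewrite -sum1_card -(sig_big_dep (fun=> true) (fun i (s : 'I_(r i)) => (u i <= s < w i)%N) (fun _ _ => 1%N)).
  rewrite -sumnB; last by move=> i _.
  apply: eq_bigr => i _; rewrite sum1dep_card.
  set A := [set t : 'I_(r i) | (t < u i)%N]; set B := [set t : 'I_(r i) | (t < w i)%N].
  have AB : A \subset B by apply/subsetP => t; rewrite !inE => /leq_trans; apply; apply: uw.
  transitivity #|B :\: A|.
    by apply: eq_card => t; rewrite !inE -leqNgt.
  by rewrite cardsD (setIidPr AB) !card_ord_lt // (leq_trans (uw i)).
apply: eq_big => [c|c /andP[_ cb]].
  rewrite T'b T'E; case: (ltnP _ (u _)) => cu; last by rewrite andbF eqK // ltnn.
  by rewrite andbT.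
by rewrite T'E -T'b cb.
Qed.

Lemma letter_sum_fillings b w : (b <= K)%N -> (forall i, w i <= r i)%N ->
  letter_sum q L f [seq x k | k <- rev (iota 0 b)] w =
  \sum_(T | row_filling b w T) q ^+ inversions T * entries T.
Proof.
elim: b w => [|b IH] w bK wr.
  rewrite /=; case: (boolP [forall i, w i == 0%N]) => [/forallP w0|nw].
    rewrite (bigD1 [ffun=> ord_max]) /=; last first.
      by apply: row_filling_intro => [c|c _|i s t _]; rewrite ?ffunE // (eqP (w0 _)).
    rewrite [X in _ + X]big1 ?addr0 => [|T /andP[F /eqP[]]]; last first.
      have [_ h _] := row_fillingP F; apply/ffunP => c; apply: ord_inj.
      by rewrite ffunE h // (eqP (w0 _)).
    rewrite /inversions big1 => [|c _]; last by rewrite big1 // => d _; rewrite !ffunE ltnn !andbF.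
    by rewrite /entries big_pred0 ?mulr1 // => c; rewrite ffunE ltnn.
  rewrite big_pred0 // => T; apply/negP => F; have [h _ _] := row_fillingP F.
  case/negP: nw; apply/forallP => i; rewrite -leqn0 leqNgt; apply/negP => wi.
  by have := h (Tagged (fun i => 'I_(r i)) (Ordinal (leq_trans wi (wr i)))) wi.
(* The variables are reversed because [letter_sum] removes the largest letter first. *)
rewrite -[X in iota _ X]addn1 iotaD rev_cat /= add0n.
transitivity (\sum_(u : {ffun I -> 'I_L} | [forall i, (u i <= w i)%N])
    \sum_(T | row_filling b (fun i => u i) T)
      q ^+ inversions (top_letter b u w T) * entries (top_letter b u w T)).
  rewrite [RHS]big_mkcond; apply: eq_bigr => u _; rewrite /letter.
  case: ifP => [/forallP uw|_]; last by rewrite mul0r.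
  rewrite IH ?(ltnW bK) // => [|i]; last exact: leq_trans (uw i) (wr i).
  rewrite big_distrr; apply: eq_bigr => T F.
  have [_ _ -> ->] := top_letterP bK uw wr F.
  by rewrite exprD [LHS]mulrACA [RHS]mulrACA [X in X * _ = _]mulrC.
rewrite pair_big_dep /= (reindex_onto (fun p => top_letter b p.1 w p.2) (lower_letters b)) /=; last first.
  by move=> T F; have [] := lower_lettersP bK F.
apply: eq_bigl => -[u T] /=; apply/andP/andP => [[/forallP uw F]|[F /eqP e]].
  by have [F' e _ _] := top_letterP bK uw wr F; split=> //; apply/eqP.
have [h1 h2 _] := lower_lettersP bK F; rewrite e in h1 h2.
by split=> //; apply/forallP.
Qed.

End Fillings.

Lemma rsizeE (R : hrow) : rsize R = (hi R - lo R)%N.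
Proof. exact: size_iota. Qed.

Lemma size_iota_cap a m b n :
  size [seq j <- iota a m | j \in iota b n] = (minn (a + m) (b + n) - maxn a b)%N.
Proof.
rewrite -(size_iota (maxn a b) (minn (a + m) (b + n) - maxn a b)).
apply/perm_size/uniq_perm; rewrite ?filter_uniq ?iota_uniq // => j.
by rewrite mem_filter !mem_iota; clear; lia.
Qed.

(* Row i starts at lo (nrow i), shifted by i times an infinitesimal. *)
Definition offset (lam : strip) (i j : 'I_(size lam)) : int :=
  (lo (nrow j))%:Z - (lo (nrow i))%:Z - (j < i)%N%:Z.

Section Strip.
Variable lam : strip.
Implicit Types i j : 'I_(size lam).
Let r i := rsize (nrow i).

Lemma alcove_offset : alcove (@offset lam).
Proof.
rewrite /offset; split=> [i|i j ij|i j k].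
- by rewrite ltnn; clear; lia.
- by move: ij; rewrite -val_eqE /=; clear; lia.
- by clear; lia.
Qed.

(** For [i < j] the tie-break lowers [offset j i] by one; this is the shift by [rplus] that [rowM]
    makes when row [i] starts right of row [j]. *)
Lemma wt_offset i j : i != j -> wt r (@offset lam) i j = (Pi_ewt i j)%:Z.
Proof.
wlog ij : i j / (i < j)%N => [wl|_].
  case: (ltngtP i j) => [ij|ji|/val_inj->]; [exact: wl | | by rewrite eqxx].
  by move=> ij; rewrite wtC Pi_ewt_sym; apply: wl; rewrite // eq_sym.
rewrite /wt /r !rsizeE /offset /Pi_ewt ij /rowM /rcap /columns !size_iota_cap /=.
have ji : (j < i)%N = false by apply/negbTE; rewrite -leqNgt ltnW.
rewrite ji; have := lo_le_hi (nrow i); have := lo_le_hi (nrow j).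
by case: (leqP (lo (nrow i)) (lo (nrow j)));
  move: (lo (nrow i)) (lo (nrow j)) (hi (nrow i)) (hi (nrow j)); clear; lia.
Qed.

End Strip.

Lemma digits_inj (B K : nat) (a b : nat -> nat) :
    (forall k, a k < B)%N -> (forall k, b k < B)%N ->
    (\sum_(k < K) a k * B ^ k = \sum_(k < K) b k * B ^ k)%N ->
  forall k, (k < K)%N -> a k = b k.
Proof.
elim: K a b => // K IH a b aB bB; rewrite !big_ord_recl /= !expn0 !muln1.
have shift (c : nat -> nat) : (\sum_(i < K) c (bump 0 i) * B ^ bump 0 i =
    (\sum_(i < K) c i.+1 * B ^ i) * B)%N.
  by rewrite big_distrl; apply: eq_bigr => i _; rewrite /bump add1n expnSr mulnA.
rewrite !shift => e; have e0 : a 0%N = b 0%N.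
  have := congr1 (modn^~ B) e; rewrite /= addnC modnMDl [in RHS]addnC modnMDl.
  by rewrite !modn_small.
move=> [|k] // kK; apply: (IH (fun k => a k.+1) (fun k => b k.+1)) => //.
move: e; rewrite e0 => /addnI/eqP; rewrite eqn_mul2r; have := bB 0%N.
by case: B {IH aB bB shift} => // B _ /eqP.
Qed.

(** * Coefficients by substitution of powers *)

Section Coefficient.
Variables (lam : strip) (m : monomial) (L B K : nat).
Hypotheses (rL : forall i : 'I_(size lam), (rsize (nrow i) < L)%N)
  (cB : (#|cell lam| < B)%N) (mB : forall k, (m k < B)%N)
  (mK : forall k, k \in finsupp m -> (k < K)%N) (m0 : 0%N \notin finsupp m).

Let r (i : 'I_(size lam)) := rsize (nrow i).
Let R : idomainType := {poly {poly int}}.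
(** Multiplicities are below [B], so they are the base [B] digits of the resulting exponent. The
    inner polynomial variable is left for [q]. *)
Let word (k : nat) : R := 'X^(B ^ k).

Implicit Types (T : {ffun cell lam -> 'I_K.+1}) (S : filling lam m).

Let multiplicity T k : nat := #|[set c : cell lam | T c == k :> nat]|.

Let code (a : nat -> nat) : nat := (\sum_(k < K) a k * B ^ k)%N.

Let entriesE T : entries (r := r) word T = 'X^(code (multiplicity T)).
Proof.
rewrite /entries /word /code expr_sum.
transitivity (\prod_(c : cell lam) \prod_(k < K | T c == k :> nat) 'X^(B ^ k) : R).
  rewrite big_mkcond; apply: eq_bigr => c _; case: ltnP => Tc; last first.
    by rewrite big_pred0 // => k; apply: contraTF Tc => /eqP->; rewrite -ltnNge.
  rewrite (bigD1 (Ordinal Tc)) //= big1 ?mulr1 // => k /andP[/eqP e].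
  by rewrite -val_eqE /= e eqxx.
rewrite (exchange_big_dep predT) //=; apply: eq_bigr => k _.
rewrite prodr_const -exprM mulnC; congr (_ ^+ (_ * _)).
by apply: eq_card => c; rewrite inE.
Qed.

Let code_eq T : (code m == code (multiplicity T)) =
  [forall k : 'I_K, multiplicity T k == m k].
Proof.
apply/eqP/forallP => [e k|H]; last first.
  by apply: eq_bigr => k _; rewrite (eqP (H k)).
rewrite eq_sym; apply/eqP; apply: (digits_inj (B := B) (K := K)) => // l.
by apply: leq_ltn_trans cB; apply: max_card.
Qed.

Let embed S : {ffun cell lam -> 'I_K.+1} := [ffun c => inord (val (S c))].

Let embedE S c : embed S c = val (S c) :> nat.
Proof. by rewrite ffunE inordK // ltnS ltnW // mK // fsvalP. Qed.

Let embed_inj : injective embed.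
Proof.
move=> S S' e; apply/ffunP => c; apply: val_inj.
by have := congr1 (fun T : {ffun cell lam -> 'I_K.+1} => T c : nat) e; rewrite /= !embedE.
Qed.

Let embed_row S : row_filling K r (embed S) = row_increasing S.
Proof.
rewrite /row_filling /row_increasing; congr (_ && _).
  transitivity true; last apply/esym.
    apply/forallP => -[i s] /=; rewrite /r ltn_ord embedE mK // fsvalP.
    by [].
  apply/forallP => c; rewrite /entry lt0n; apply: contraNneq m0 => e.
  by have := fsvalP (S c); rewrite -[fsval _]/(val _) e.
apply: eq_forallb => c; apply: eq_forallb => d; rewrite !embedE /cellrow /content /entry.
case: eqP => //= e; have -> : lo (nrow (tag c)) = lo (nrow (tag d)) by rewrite e.
by rewrite leq_add2l.
Qed.

Let embed_weight S : (code m == code (multiplicity (embed S))) = has_weight S.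
Proof.
have mult k : multiplicity (embed S) k = #|[set u | entry S u == k]|.
  by apply: eq_card => c; rewrite !inE embedE.
rewrite code_eq; apply/forallP/forallP => H k.
  by have := H (Ordinal (mK (fsvalP k))); rewrite /= mult.
rewrite mult; case: (boolP ((k : nat) \in finsupp m)) => km.
  exact: (H [` km]%fset).
have -> : m k = 0%N by apply/eqP; move: km; rewrite mem_finsupp negbK.
rewrite cards_eq0; apply/eqP/setP => u; rewrite !inE.
by apply: contraNF km => /eqP <-; apply: fsvalP.
Qed.

Let embed_inv S : inversions (@offset lam) (embed S) = Defs.inv S.
Proof.
pose a (c d : cell lam) : nat := attacks (r := r) (@offset lam) c d && (embed S d < embed S c < K)%N.
have aE (u v : cell lam) : (cellrow u < cellrow v)%N -> (a u v + a v u = is_inv S u v)%N.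
  move=> uv; rewrite /a /attacks /is_inv uv /= !embedE /offset /content /entry.
  have K1 c : (val (S c) < K)%N by apply: mK; apply: fsvalP.
  have := K1 u; have := K1 v; move: uv; rewrite /cellrow.
  rewrite -!val_eqE /=.
  move: (val (S u)) (val (S v)) (lo _) (lo _) => su sv lu lv.
  move: (nat_of_ord (tagged u)) (nat_of_ord (tagged v)) => tu tv.
  move: (nat_of_ord (tag u)) (nat_of_ord (tag v)) => iu iv.
  clear; case: (ltngtP iu iv) => //= _.
  case: (ltngtP su sv) => /=; rewrite ?andbF ?addn0 ?add0n ?orbF; move=> *; 
    try (congr nat_of_bool); lia.
have a0 (u v : cell lam) : cellrow u = cellrow v -> a u v = 0%N.
  by move=> uv; rewrite /a /attacks (_ : (tag v == tag u) = true) //; apply/eqP.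
rewrite /inversions -/a pair_bigA /= (bigID (fun p : cell lam * cell lam => cellrow p.1 < cellrow p.2)%N) /=.
rewrite (bigID (fun p : cell lam * cell lam => cellrow p.2 < cellrow p.1)%N (fun p => ~~ _)) /=.
rewrite [X in (_ + (_ + X))%N]big1 ?addn0; last first.
  by move=> p; rewrite -!leqNgt -eqn_leq => /eqP/val_inj e; apply: a0.
rewrite [X in (_ + X)%N](reindex (fun p : cell lam * cell lam => (p.2, p.1))) /=; last first.
  by exists (fun p => (p.2, p.1)) => -[].
rewrite [X in (_ + X)%N](eq_bigl (fun p => cellrow p.1 < cellrow p.2)%N); last first.
  by move=> p /=; case: ltngtP.
rewrite -big_split /Defs.inv -sum1_card big_mkcond [RHS]big_mkcond; apply: eq_bigr => -[u v] _ /=.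
rewrite inE /=; case: ifP => [/aE->|nuv]; first by case: is_inv.
by rewrite /is_inv nuv.
Qed.

Lemma LLT_coef : LLT lam m =
  (letter_sum (R := R) ('X)%:P L (@offset lam) [seq word k | k <- rev (iota 0 K)] r)`_(code m).
Proof.
rewrite (letter_sum_fillings _ _ _ rL (K := K)) // coef_sum.
rewrite big_mkcond (big_inj_support _ embed_inj) /=; last first.
  (* A filling that contributes to this coefficient uses only letters occurring in [m], so it is in
     the image of [embed]. *)
  move=> T nT; case: ifP => // F; rewrite entriesE -polyC_exp coefCM coefXn code_eq.
  case: forallP => [H|_]; last by rewrite mulr0.
  have [lt _ _] := row_fillingP F.
  have TS c : (T c : nat) \in finsupp m.
    have TcK : (T c < K)%N by apply: lt; apply: ltn_ord.
    rewrite mem_finsupp -(eqP (H (Ordinal TcK))) -lt0n; apply/card_gt0P; exists c.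
    by rewrite inE.
  case/negP: nT; apply/codomP; exists [ffun c => [` TS c]%fset].
  by apply/ffunP => c; apply: ord_inj; rewrite embedE ffunE.
rewrite /LLT big_mkcond; apply: eq_bigr => S _.
rewrite embed_row; case: (row_increasing S) => //=.
rewrite entriesE -polyC_exp coefCM coefXn embed_weight embed_inv.
by case: (has_weight S); rewrite ?mulr1 ?mulr0.
Qed.

End Coefficient.

Lemma LLT0 lam (m : monomial) : 0%N \in finsupp m -> LLT lam m = 0.
Proof.
move=> m0; rewrite /LLT big_pred0 // => S; apply/negP => /andP[/andP[/forallP pos _] /forallP H].
have /eqP e := H [` m0]%fset.
have : (0 < m 0%N)%N by rewrite lt0n -mem_finsupp.
rewrite -[X in m X]/(val [` m0]%fset) -e card_gt0 => /set0Pn[u]; rewrite inE => /eqP eu.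
by have := pos u; rewrite eu.
Qed.

(* The variables are replaced by high powers of one variable, so that the
   coefficients of an LLT polynomial can still be read off. *)
Lemma eq_LLT lam mu :
    (forall (R : idomainType) (q : R) L xs, q != 0 ->
       (\sum_(i < size lam) rsize (nrow i) < L)%N -> (\sum_(i < size mu) rsize (nrow i) < L)%N ->
       letter_sum q L (@offset lam) xs (fun i => rsize (nrow i)) =
       letter_sum q L (@offset mu) xs (fun i => rsize (nrow i))) ->
  LLT lam =1 LLT mu.
Proof.
move=> H m; case: (boolP (0%N \in finsupp m)) => [m0|m0]; first by rewrite !LLT0.
pose M := (\sum_(k <- finsupp m) k + \sum_(k <- finsupp m) m k)%N.
pose L := ((\sum_(i < size lam) rsize (nrow i)) + \sum_(i < size mu) rsize (nrow i)).+1%N.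
pose B := (#|cell lam| + #|cell mu| + M).+1%N.
have mem k : k \in finsupp m -> (k <= M)%N /\ (m k <= M)%N.
  move=> km; rewrite /M !(big_fsetD1 k km) /=; clear; lia.
have mB k : (m k < B)%N.
  case: (boolP (k \in finsupp m)) => [/mem[_ le]|]; first by rewrite /B ltnS (leq_trans le) // leq_addl.
  by rewrite mem_finsupp negbK => /eqP->.
have mK k : k \in finsupp m -> (k < M.+1)%N by case/mem.
have rle (nu : strip) (i : 'I_(size nu)) : (rsize (nrow i) <= \sum_(i < size nu) rsize (nrow i))%N.
  by rewrite (bigD1 i) //= leq_addr.
rewrite !(@LLT_coef _ m L B M.+1) //; last 4 first.
- by move=> i; rewrite /L ltnS (leq_trans (rle _ i)) // leq_addl.
- by rewrite /B; clear; lia.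
- by move=> i; rewrite /L ltnS (leq_trans (rle _ i)) // leq_addr.
- by rewrite /B; clear; lia.
rewrite H //; first by rewrite polyC_eq0 polyX_eq0.
- by rewrite /L; clear; lia.
- by rewrite /L; clear; lia.
Qed.

(* The quotients and the remainders of the positions modulo #|X| give the left
   ends and the order of the rows. *)
Lemma exists_strip (X : finType) (f : X -> X -> int) (r : X -> nat) : alcove f ->
  exists (lam : strip) (phi : 'I_(size lam) -> X),
    [/\ bijective phi, forall i, rsize (nrow i) = r (phi i)
      & forall i j, i != j -> offset i j = f (phi i) (phi j)].
Proof.
move=> Af; case: (pickP X) => [x0 _|X0]; last first.
  have phi0 : 'I_0 -> X by case.
  have phi1 : X -> 'I_0 by move=> x; have := X0 x.
  exists [::], phi0; split=> [|[]//|[]//].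
  by exists phi1 => [[]//|x]; have := X0 x.
set N := #|X|; have N0 : (0 < N)%N by apply/card_gt0P; exists x0.
pose S := (\sum_x absz (position f x))%N.
(* Adding a multiple of [N] makes the positions nonnegative and preserves their residues. *)
pose P x := absz (position f x + (N * S)%N%:Z).
have PE x : (P x)%:Z = position f x + (N * S)%N%:Z.
  rewrite gez0_abs //; have : (absz (position f x) <= S)%N by rewrite /S (bigD1 x) //= leq_addr.
  by have := leq_pmull S N0; move: (N * S)%N => NS; clear; lia.
pose b x := (P x %/ N)%N; pose m x := (P x %% N)%N.
have bm x : (P x)%:Z = N%:Z * (b x)%:Z + (m x)%:Z.
  by rewrite -PoszM -PoszD mulnC -divn_eq.
have mN x : (m x < N)%N by apply: ltn_pmod.
have key x y : x != y -> (m x != m y) /\ f x y = (b y)%:Z - (b x)%:Z - (m y < m x)%N%:Z.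
  move=> xy; have /andP[l1 l2] := position_bounds Af xy; rewrite -/N in l1 l2.
  have N0' : 0 < N%:Z by rewrite ltz_nat.
  have e : position f y - position f x =
      N%:Z * ((b y)%:Z - (b x)%:Z) + ((m y)%:Z - (m x)%:Z).
    have := PE x; have := PE y; rewrite !bm mulrBr.
    by move: (N%:Z * _) (N%:Z * _) (N * S)%N%:Z => ? ? ?; clear; lia.
  rewrite e in l1 l2; move: (mN x) (mN y) => mx my; set d := (b y)%:Z - (b x)%:Z in l1 l2 *.
  clearbody d; clear e.
  have h1 : N%:Z * f x y < N%:Z * (d + 1) by rewrite mulrDr mulr1; move: l1 my; clear; lia.
  have h2 : N%:Z * d < N%:Z * (f x y + 2) by rewrite mulrDr; move: l2 mx; clear; lia.
  rewrite !ltr_pM2l // in h1 h2.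
  case: (ltngtP (m x) (m y)) => lt; last first.
  - rewrite lt subrr addr0 in l1 l2.
    have h3 : N%:Z * d < N%:Z * (f x y + 1) by rewrite mulrDr mulr1.
    by rewrite !ltr_pM2l // in l1 h3; move: l1 h3; clear; lia.
  - have h3 : N%:Z * f x y < N%:Z * d by move: l1 lt; clear; lia.
    by rewrite ltr_pM2l // in h3; split=> //; move: h2 h3; clear; lia.
  have h3 : N%:Z * d < N%:Z * (f x y + 1) by rewrite mulrDr mulr1; move: l2 lt; clear; lia.
  by rewrite ltr_pM2l // in h3; split=> //; move: h1 h3; clear; lia.
(* Sorted by residues, the rows are indexed in the order in which [offset] breaks ties. *)
pose s := sort (fun x y => m x <= m y)%N (enum X).
have us : uniq s by rewrite sort_uniq enum_uniq.
have ms x : x \in s by rewrite mem_sort mem_enum.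
have ss : sorted (fun x y => m x <= m y)%N s by apply: sort_sorted => x y; apply: leq_total.
pose lam : strip := [seq HRow (leq_addr (r x) (b x)) | x <- s].
have lamE : size lam = size s by rewrite size_map.
exists lam; exists (fun i => nth x0 s i).
have rowE (i : 'I_(size lam)) : nrow i = HRow (leq_addr (r (nth x0 s i)) (b (nth x0 s i))).
  have h : HRow (leq_addr (r x0) (b x0)) = HRow (leq_addr (r x0) (b x0)) by [].
  by rewrite /nrow (tnth_nth (HRow (leq_addr (r x0) (b x0)))) /= (nth_map x0) // -lamE.
split.
- have idx x : (index x s < size lam)%N by rewrite lamE index_mem.
  exists (fun x => Ordinal (idx x)) => [i|x]; last exact: nth_index.
  by apply: ord_inj; rewrite /= index_uniq // -lamE.
- by move=> i; rewrite rsizeE rowE /= addKn.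
move=> i j ij; rewrite /offset !rowE /=.
have [is_ js] : (i < size s)%N /\ (j < size s)%N by rewrite -lamE !ltn_ord.
have nij : nth x0 s i != nth x0 s j by rewrite nth_uniq // val_eqE.
have [nm ->] := key _ _ nij; congr (_ - _%:Z); congr nat_of_bool.
have tr : transitive (fun x y => m x <= m y)%N by move=> y x z; apply: leq_trans.
have mono := sorted_ltn_nth tr x0 ss.
case: (ltngtP i j) ij => [lt|lt|/val_inj->]; last by rewrite eqxx.
  by move=> _; apply/esym/negbTE; rewrite -leqNgt; apply: mono.
by move=> _; apply/esym; rewrite ltn_neqAle eq_sym nm; apply: mono.
Qed.

(** * Weighted graphs *)

(* A configuration with the weights of G, in which all rows start after da G
   and end before dz G, ties being broken by the reading order. *)
Definition realizes (G : dgraph) (f : G -> G -> int) : Prop :=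
  [/\ alcove f, forall u v, u != v -> wt (@vwt G) f u v = (ewt u v)%:Z,
      (0 < vwt (da G))%N /\ (0 < vwt (dz G))%N,
      forall v, (0 < vwt v)%N -> 0 <= f (da G) v
    & forall v, (0 < vwt v)%N -> (vwt v)%:Z <= (vwt (dz G))%:Z + f v (dz G)].

(** * Concatenation of realized graphs *)

Section Join.
Variables G H : dgraph.

(* near_concat, with the vertex da H kept as a vertex of weight 0 *)
Definition near_vwt (u : G + H) : nat :=
  match u with
  | inl g => if g == dz G then vwt g + vwt (da H) else vwt g
  | inr h => if h == da H then 0 else vwt h
  end%N.

Definition near_ewt (u v : G + H) : nat :=
  match u, v with
  | inl g, inl g' => ewt g g'
  | inr h, inr h' => if (h == da H) || (h' == da H) then 0 else ewt h h'
  | inl g, inr h | inr h, inl g => if (g == dz G) && (h != da H) then ewt (da H) h else 0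
  end%N.

Lemma near_ewt_sym u v : near_ewt u v = near_ewt v u.
Proof. by case: u v => [g|h] [g'|h'] //=; rewrite 1?orbC ewt_sym. Qed.

Lemma near_ewt_irr u : near_ewt u u = 0%N.
Proof. by case: u => [g|h] /=; rewrite ewt_irr ?if_same. Qed.

Definition near_wgraph : wgraph :=
  @WGraph (G + H)%type near_vwt near_ewt near_ewt_sym near_ewt_irr.

Definition near : dgraph :=
  @DGraph near_wgraph (inl (da G)) (if dz H == da H then inl (dz G) else inr (dz H)).

Section Realization.
Variables (f : G -> G -> int) (g : H -> H -> int).

(** The row [da H] starts right where [dz G] ends. The integral parts simply add up because the
    fractional parts of [G] can be compressed just below that of [dz G], and those of [H] just above
    that of [da H]. *)
Definition apart (u v : G + H) : int :=
  match u, v with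
  | inl i, inl j => f i j
  | inr i, inr j => g i j
  | inl i, inr j => f i (dz G) + (vwt (dz G))%:Z + g (da H) j
  | inr j, inl i => - 1 - (f i (dz G) + (vwt (dz G))%:Z + g (da H) j)
  end.

(** Crossing the wall back makes [dz G] and [da H] overlap in one cell, the added edge of weight
    1. *)
Definition touching : G + H -> G + H -> int := cross apart (inr (da H)) (inl (dz G)).

Lemma alcove_apart : alcove f -> alcove g -> alcove apart.
Proof.
move=> Af Ag; have [f0 fN _] := Af; have [g0 gN _] := Ag.
split=> [[i|i]|[i|i] [j|j]|[i|i] [j|j] [k|k]] /=.
- exact: f0.
- exact: g0.
- by move=> ij; apply: fN.
- by move=> _; clear; lia.
- by move=> _; clear; lia.
- by move=> ij; apply: gN.
- exact: alcove_le.
- by have := alcove_le i j (dz G) Af; clear; lia.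
- by have := alcove_ge i k (dz G) Af; clear; lia.
- by have := alcove_le (da H) j k Ag; clear; lia.
- by have := alcove_le j k (dz G) Af; clear; lia.
- by have := alcove_ge (da H) i k Ag; clear; lia.
- by have := alcove_le (da H) i j Ag; clear; lia.
- exact: alcove_le.
Qed.

Hypotheses (Rf : realizes f) (Rg : realizes g).

Lemma adjacent_touching : adjacent touching apart (inl (dz G)) (inr (da H)).
Proof.
have [Af _ _ _ _] := Rf; have [Ag _ _ _ _] := Rg.
have [f0 _ _] := Af; have [g0 _ _] := Ag.
apply/adjacentC/adjacent_cross => //; first exact: alcove_apart.
by move=> [k|k] _ _ /=; rewrite ?f0 ?g0; ring.
Qed.

Lemma realizes_concat : realizes (G := concat G H) touching.
Proof.
have [_ Atc _ [c1 c2 c3]] := adjacentC adjacent_touching.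
have [Af wf [aG zG] fa fz] := Rf; have [Ag wg [aH zH] ga gz] := Rg.
have [f0 _ _] := Af; have [g0 _ _] := Ag.
have tE i j : touching (inl i) (inr j) =
    f i (dz G) + (vwt (dz G))%:Z + g (da H) j - ((i == dz G) && (j == da H))%:Z.
  by rewrite /touching /cross /= addr0; congr (_ - _%:Z); rewrite /eq_op /= andbC.
have tl i j : touching (inl i) (inl j) = f i j by rewrite c3 //= andbF.
have tr i j : touching (inr i) (inr j) = g i j by rewrite c3 //= andbF.
have tC i j : touching (inr j) (inl i) = - 1 - touching (inl i) (inr j) by apply: alcoveN.
have cross_wt i j : wt (@concat_vwt G H) touching (inl i) (inr j) = ((i == dz G) && (j == da H))%N%:Z.
  rewrite /wt tC tE /=; case: eqP => [->|iz] /=; last first.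
    have [->|vi] := posnP (vwt i); first by clear; lia.
    have [->|vj] := posnP (vwt j); first by clear; lia.
    by have := fz i vi; have := ga j vj; clear; lia.
  rewrite f0; case: eqP => [->|ja]; first by rewrite g0; move: zG aH; clear; lia.
  have [->|vj] := posnP (vwt j); first by clear; lia.
  by have := ga j vj; clear; lia.
split=> //.
- move=> [i|i] [j|j] //= ij.
  + by rewrite /wt !tl -wf.
  + by rewrite wtC cross_wt.
  + by rewrite /wt !tr -wg.
- case=> v /= v0; rewrite ?tl ?tE; first exact: fa.
  have := fa _ zG; have := ga v v0; move: zG; case: (_ && _); clear; lia.
- case=> v /= v0; rewrite ?tr ?tE; last exact: gz.
  have := fz v v0; have := ga _ zH; move: zH; case: (_ && _); clear; lia.
Qed.

Lemma realizes_near : realizes (G := near) apart.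
Proof.
have [Af wf [aG zG] fa fz] := Rf; have [Ag wg [aH zH] ga gz] := Rg.
have [f0 _ _] := Af; have [g0 _ _] := Ag.
have cross_wt i j : wt (@near_vwt) apart (inl i) (inr j) = (near_ewt (inl i) (inr j))%:Z.
  rewrite /wt /=; case: (eqVneq j (da H)) => [->|ja]; first by rewrite andbF; clear; lia.
  rewrite andbT; have aj : da H != j by rewrite eq_sym.
  have [vj|vj] := posnP (vwt j).
    case: eqP => _; last by rewrite vj; clear; lia.
    by rewrite -wg // /wt vj; clear; lia.
  have ga' := ga j vj; case: eqP => [->|iz] /=.
    by rewrite -wg // /wt f0 (alcoveN Ag aj); move: aH ga'; clear; lia.
  have [->|vi] := posnP (vwt i); first by clear; lia.
  by have := fz i vi; move: ga'; clear; lia.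
have ll i j : i != j -> wt (@near_vwt) apart (inl i) (inl j) = (ewt i j)%:Z.
  wlog jz : i j / j != dz G => [wl|] ij.
    case: (eqVneq j (dz G)) => [e|jz]; last exact: wl.
    by rewrite wtC ewt_sym; apply: wl; [rewrite -e | rewrite eq_sym].
  rewrite -wf // /wt /= (negPf jz); case: eqP => // e.
  have [->|vj] := posnP (vwt j); first by clear; lia.
  have := fz j vj; have := alcoveN Af ij; rewrite e; clear; lia.
split.
- exact: alcove_apart.
- move=> [i|i] [j|j] /= ij //.
  + exact: ll.
  + by rewrite wtC cross_wt.
  + rewrite /wt /=; case: (eqVneq i (da H)) => [->|ia] /=; first by clear; lia.
    case: (eqVneq j (da H)) => [->|ja] /=; first by clear; lia.
    by rewrite -wg.
- rewrite /=; split; first by case: ifP; rewrite ?addn_gt0 ?aG.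
  by case: (eqVneq (dz H) (da H)) => [_|/negPf ne] /=; rewrite ?eqxx ?ne // addn_gt0 zG.
- case=> v /=; first by case: eqP => [-> _|_]; apply: fa.
  case: eqP => // _ vj; have := fa _ zG; have := ga v vj; clear; lia.
case: (eqVneq (dz H) (da H)) => [e|/negPf ne].
  case=> v /=; rewrite e eqxx /= eqxx.
    case: eqP => [->|_] v0; first by rewrite f0; clear; lia.
    by have := fz v v0; clear; lia.
  case: eqP => // va vj; have := gz v vj; rewrite e.
  have av : da H != v by rewrite eq_sym; apply/eqP.
  by rewrite f0 (alcoveN Ag av); clear; lia.
case=> v /=; rewrite ne /= ne; last by case: eqP => // _; apply: gz.
have := gz _ aH; have := ga _ zH; case: eqP => [->|_]; first by rewrite f0; clear; lia.
by move=> h1 _ v0; have := fz v v0; move: h1; clear; lia.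
Qed.

End Realization.
End Join.

(** The missed vertices are the empty rows left behind by near-concatenations; dropping them does
    not change [letter_sum]. *)
Definition embedding (G G' : wgraph) (h : G -> G') : Prop :=
  [/\ injective h, forall u, vwt (h u) = vwt u, forall u v, ewt (h u) (h v) = ewt u v
    & forall w, w \notin codom h -> vwt w = 0%N].

Definition embeds (G G' : dgraph) : Prop :=
  exists h : G -> G', [/\ embedding h, h (da G) = da G' & h (dz G) = dz G'].

Lemma embeddingI (G G' : wgraph) (h : G -> G') (h' : G' -> G) : cancel h h' -> cancel h' h ->
    (forall u, vwt (h u) = vwt u) -> (forall u v, ewt (h u) (h v) = ewt u v) ->
  embedding h.
Proof.
move=> hK h'K hv he; split=> //; first exact: can_inj hK.
by move=> w; rewrite -[w]h'K codom_f.
Qed.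

Lemma embedding_comp (G G' G'' : wgraph) (h : G -> G') (h' : G' -> G'') :
  embedding h -> embedding h' -> embedding (h' \o h).
Proof.
case=> i1 v1 e1 z1 [i2 v2 e2 z2]; split=> [|u|u v|w] /=.
- exact: inj_comp.
- by rewrite v2.
- by rewrite e2.
case: (boolP (w \in codom h')) => [/codomP[u ->]|/z2//] nw.
by rewrite v2 z1 //; apply: contra nw => /codomP[x ->]; rewrite -[h' (h x)]/((h' \o h) x) codom_f.
Qed.

Lemma embeds_refl G : embeds G G.
Proof. by exists id; split=> //; apply: embeddingI (fun _ => erefl) _ _ _. Qed.

Lemma embeds_trans G G' G'' : embeds G G' -> embeds G' G'' -> embeds G G''.
Proof.
case=> h [Eh ha hz] [h' [Eh' ha' hz']]; exists (h' \o h).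
by split; [apply: embedding_comp|rewrite /= ha|rewrite /= hz].
Qed.

Section SumMap.
Variables (G G' H H' : dgraph) (h : G -> G') (k : H -> H').

Definition sum_map (u : G + H) : G' + H' :=
  match u with inl g => inl (h g) | inr v => inr (k v) end.

Lemma sum_map_inj : injective h -> injective k -> injective sum_map.
Proof. by move=> ih ik [u|u] [v|v] //= [] => [/ih->|/ik->]. Qed.

Lemma sum_map_codom w : w \notin codom sum_map ->
  match w with inl g => g \notin codom h | inr v => v \notin codom k end.
Proof.
case: w => w; apply: contra => /codomP[u ->].
  by apply/codomP; exists (inl u).
by apply/codomP; exists (inr u).
Qed.

End SumMap.

Lemma embeds_concat G G' H H' : embeds G G' -> embeds H H' ->
  embeds (concat G H) (concat G' H').
Proof.
case=> h [[ih vh eh zh] ha hz] [k [[ik vk ek zk] ka kz]].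
exists (sum_map h k : concat G H -> concat G' H'); split; [split|by rewrite /= ha|by rewrite /= kz].
- exact: sum_map_inj.
- by case=> u /=; rewrite ?vh ?vk.
- by case=> u [] v /=; rewrite ?eh ?ek // -hz -ka !inj_eq.
- by move=> w /sum_map_codom; case: w => w /=; [apply: zh|apply: zk].
Qed.

Lemma embeds_near G G' H H' : embeds G G' -> embeds H H' -> embeds (near G H) (near G' H').
Proof.
case=> h [[ih vh eh zh] ha hz] [k [[ik vk ek zk] ka kz]].
exists (sum_map h k : near G H -> near G' H'); split; [split|by rewrite /= ha|].
- exact: sum_map_inj.
- by case=> u /=; rewrite -?hz -?ka !inj_eq // ?vh ?vk.
- by case=> u [] v /=; rewrite ?eh // -?hz -?ka !inj_eq // ek.
- move=> w /sum_map_codom; case: w => w /= wn; case: eqP => // e.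
  + by move: wn; rewrite e -hz codom_f.
  + exact: zh.
  + exact: zk.
- by rewrite /= -kz -ka inj_eq //; case: eqP; rewrite /= ?hz.
Qed.

Lemma embeds_near_concat G H : embeds (near_concat G H) (near G H).
Proof.
set x : concat_wgraph G H := inl (dz G); set y : concat_wgraph G H := inr (da H).
pose h (u : near_concat G H) : near G H := val (u : cvert y).
have hy u : h u != inr (da H) by exact: (valP (u : cvert y)).
pose eq_sum := @eq_op (concat_wgraph G H).
have ell (a b : G) : eq_sum (inl a) (inl b) = (a == b) by [].
have err (a b : H) : eq_sum (inr a) (inr b) = (a == b) by [].
have elr (a : G) (b : H) : eq_sum (inl a) (inr b) = false by [].
have erl (a : G) (b : H) : eq_sum (inr b) (inl a) = false by [].
exists h; split; [split| |].
- exact: val_inj.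
- move=> u; rewrite /= /cvwt -/(h u) -/eq_sum; have := hy u; rewrite -/eq_sum.
  case: (h u) => [g|v]; rewrite ?ell ?err ?erl /=; first by case: eqP => [->|].
  by case: eqP.
- move=> u v; rewrite /= /cewt -(inj_eq val_inj) -/(h u) -/(h v).
  have := hy u; have := hy v; rewrite -/eq_sum; case: (h u) => g; case: (h v) => g';
    rewrite ?ell ?err ?erl ?elr /= ?eqxx ?andbT.
  + move=> _ _; case: (eqVneq g g') => [->|ne]; first by rewrite ewt_irr.
    case: (eqVneq g (dz G)) => [e|_]; case: (eqVneq g' (dz G)) => [e'|_] //=; rewrite ?addn0 //.
    by move: ne; rewrite e e' eqxx.
  + by move=> /negPf-> _; rewrite andbF /= addn0; case: eqP.
  + by move=> _ /negPf->; rewrite andbF /= addn0; case: eqP => // _; rewrite ewt_sym.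
  + move=> /negPf-> /negPf->; rewrite /= !addn0.
    by case: eqVneq => [->|//]; rewrite ewt_irr.
- move=> w; case: (eqVneq w (inr (da H))) => [->|ne] /=; first by rewrite eqxx.
  by case/negP; apply/codomP; exists (Sub w ne : cvert y).
- by rewrite /h /= /cproj val_insubd.
rewrite /h /= /cproj val_insubd -/eq_sum err.
by case: eqP.
Qed.

Lemma inl_eqE (A B : eqType) (a b : A) : (inl a == inl b :> A + B) = (a == b).
Proof. by []. Qed.

Lemma inr_eqE (A B : eqType) (a b : B) : (inr a == inr b :> A + B) = (a == b).
Proof. by []. Qed.

Lemma inl_inrE (A B : eqType) (a : A) (b : B) : (inl a == inr b :> A + B) = false.
Proof. by []. Qed.

Lemma inr_inlE (A B : eqType) (a : A) (b : B) : (inr b == inl a :> A + B) = false.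
Proof. by []. Qed.

Definition sum_eqE := (inl_eqE, inr_eqE, inl_inrE, inr_inlE).

Lemma embeds_nearA X Y Z : embeds (near X (near Y Z)) (near (near X Y) Z).
Proof.
pose h (u : near X (near Y Z)) : near (near X Y) Z :=
  match u with inl x => inl (inl x) | inr (inl y) => inl (inr y) | inr (inr z) => inr z end.
pose h' (u : near (near X Y) Z) : near X (near Y Z) :=
  match u with inl (inl x) => inl x | inl (inr y) => inr (inl y) | inr z => inr (inr z) end.
exists h; split=> //.
  apply: (embeddingI (h' := h')); [by case=> [x|[y|z]]|by case=> [[x|y]|z]| |].
    case=> [x|[y|z]] /=; rewrite ?sum_eqE //.
    - case: (eqVneq (dz Y) (da Y)) => [e|/negPf ne]; rewrite ?e ?eqxx ?ne ?sum_eqE /= ?sum_eqE.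
        by case: eqP => //= _; rewrite addnA.
      by case: eqP.
    - case: (eqVneq (dz Y) (da Y)) => [e|/negPf ne]; rewrite ?e ?eqxx ?ne ?sum_eqE /= ?sum_eqE //.
        by case: (eqVneq y (da Y)).
      by case: (eqVneq y (da Y)) => [->|//]; rewrite eq_sym ne.
  case=> [x|[y|z]] [x'|[y'|z']] /=; rewrite ?sum_eqE //;
    case: (eqVneq (dz Y) (da Y)) => [e|/negPf ne]; rewrite ?e ?eqxx ?ne ?sum_eqE /= ?sum_eqE //;
    rewrite ?andbT ?orbF ?if_same //; try (by case: (_ == dz X)); try (by case: eqP);
    [case: (eqVneq y (da Y)) => [->|//]|case: (eqVneq y' (da Y)) => [->|//]];
    by rewrite eq_sym ne.
rewrite /=; case: (eqVneq (dz Z) (da Z)) => [_|_]; rewrite sum_eqE //=.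
by case: eqP.
Qed.

Lemma embeds_near_concatA X Y Z : embeds (near (concat X Y) Z) (concat X (near Y Z)).
Proof.
pose h (u : near (concat X Y) Z) : concat X (near Y Z) :=
  match u with inl (inl x) => inl x | inl (inr y) => inr (inl y) | inr z => inr (inr z) end.
pose h' (u : concat X (near Y Z)) : near (concat X Y) Z :=
  match u with inl x => inl (inl x) | inr (inl y) => inl (inr y) | inr (inr z) => inr z end.
exists h; split=> //; last first.
  by rewrite /=; case: (eqVneq (dz Z) (da Z)).
apply: (embeddingI (h' := h')); [by case=> [[x|y]|z]|by case=> [x|[y|z]]| |].
  by case=> [[x|y]|z] /=; rewrite ?sum_eqE.
by case=> [[x|y]|z] [[x'|y']|z'] /=; rewrite ?sum_eqE ?andbF ?andFb.
Qed.

Record rgraph := RGraph { rg :> dgraph; rf : rg -> rg -> int; rfP : realizes rf }.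

Definition rconcat (X Y : rgraph) : rgraph := RGraph (realizes_concat (rfP X) (rfP Y)).

Definition rnear (X Y : rgraph) : rgraph := RGraph (realizes_near (rfP X) (rfP Y)).

Definition rpow (P : rgraph) (k : nat) : rgraph := iter k.-1 (fun X => rnear X P) P.

Definition rcomp (P : rgraph) (k : nat) (alpha : seq nat) : rgraph :=
  foldl (fun X l => rconcat X (rpow P l)) (rpow P k) alpha.

Lemma near_pow_embeds (P : rgraph) k : embeds (near_pow P k) (rpow P k).
Proof.
rewrite /near_pow /rpow; elim: k.-1 => [|n IH] /=; first exact: embeds_refl.
apply: embeds_trans (embeds_near_concat _ _) _.
by apply: embeds_near => //; apply: embeds_refl.
Qed.

Lemma comp_graph_embeds (P : rgraph) k alpha :
  exists h : comp_graph (k :: alpha) P -> rcomp P k alpha, embedding h.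
Proof.
have : embeds (foldl (fun H k' => concat H (near_pow P k')) (near_pow P k) alpha) (rcomp P k alpha).
  elim/last_ind: alpha => [|alpha l IH]; first exact: near_pow_embeds.
  rewrite /rcomp !foldl_rcons; apply: embeds_concat => //; exact: near_pow_embeds.
by case=> h [Eh _ _]; exists h.
Qed.

Lemma rpow_embeds (P : rgraph) k l : (0 < k)%N -> (0 < l)%N ->
  embeds (near (rpow P k) (rpow P l)) (rpow P (k + l)).
Proof.
move=> k0; elim: l => // -[_ _|l IH _].
  by rewrite addn1 /rpow; case: k k0 => //= k _; apply: embeds_refl.
have -> : rpow P l.+2 = rnear (rpow P l.+1) P by [].
have -> : rpow P (k + l.+2) = rnear (rpow P (k + l.+1)) P by rewrite !addnS.
apply: embeds_trans (embeds_nearA _ _ _) _.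
by apply: embeds_near (embeds_refl _); apply: IH.
Qed.

(** * The recursion for concatenations *)

Section Value.
Variables (R : idomainType) (q : R) (L : nat) (xs : seq R).
Hypothesis q_neq0 : q != 0.

Definition total (X : wgraph) : nat := (\sum_(u : X) vwt u)%N.

Definition value (X : rgraph) : R := letter_sum q L (rf (r := X)) xs (@vwt X).

Lemma embedding_total (X Y : wgraph) (h : X -> Y) : embedding h -> total X = total Y.
Proof.
case=> ih vh _ zh; rewrite /total [RHS](big_inj_support _ ih) //.
by apply: eq_bigr => u _; rewrite vh.
Qed.

(** The realization of [Y], restricted to the image of [h], has the weights of [f], so
    [letter_sum_wt] applies. *)
Lemma embedding_value (X : wgraph) (f : X -> X -> int) (Y : rgraph) (h : X -> Y) :
    embedding h -> alcove f -> (forall u v, u != v -> wt (@vwt X) f u v = (ewt u v)%:Z) ->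
    (total Y < L)%N ->
  letter_sum q L f xs (@vwt X) = value Y.
Proof.
move=> Eh Af wf YL; have [ih vh eh zh] := Eh; have [AY wY _ _ _] := rfP Y.
rewrite /value (letter_sum_inj q ih _ _ xs zh); last exact: leq_ltn_trans YL.
rewrite -(eq_letter_sum q L xs (f := fun u v => rf (h u) (h v)) (fun _ _ _ => erefl)
  (w := @vwt X)) => [|u]; last by rewrite vh.
have [Y0 YN YT] := AY.
apply: letter_sum_wt => //; first by rewrite -/(total X) (embedding_total Eh).
- by split=> [u|u v uv|u v w]; [exact: Y0|apply: YN; rewrite (inj_eq ih)|exact: YT].
- move=> u v uv; rewrite wf // -eh -wY ?(inj_eq ih) //.
  by rewrite /wt !vh.
Qed.

Lemma embeds_value (X Y : rgraph) : embeds X Y -> (total Y < L)%N -> value X = value Y.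
Proof.
case=> h [Eh _ _] YL; have [AX wX _ _ _] := rfP X.
exact: (embedding_value Eh).
Qed.

Lemma total_concat (X Y : rgraph) : total (rconcat X Y) = (total X + total Y)%N.
Proof. by rewrite /total big_sumType. Qed.

(** Beyond the wall the rows of [X] and [Y] are disjoint, which gives the product. In the
    contraction the union is the merged row and the intersection is empty, which is the weight
    function of [near]. *)
Lemma value_concat (X Y : rgraph) : (total X + total Y < L)%N ->
  value (rconcat X Y) = q * (value X * value Y) + (1 - q) * value (rnear X Y).
Proof.
move=> XYL; have A := adjacent_touching (rfP X) (rfP Y).
have [AX wX [aX zX] fa fz] := rfP X; have [AY wY [aY zY] ga gz] := rfP Y.
have [X0 _ _] := AX; have [Y0 _ _] := AY.
have m : apart (rf (r := X)) (rf (r := Y)) (inl (dz X)) (inr (da Y)) = (vwt (dz X))%:Z.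
  by rewrite /= X0 Y0 add0r addr0.
rewrite /value /= (adjacent_straddle q xs A); last 2 first.
- by rewrite /straddle m; move: zX aY; clear => *; split; rewrite /=; lia.
- by rewrite -[X in (X < _)%N]/(total (rconcat X Y)) total_concat.
congr (q * _ + (1 - q) * _).
  apply: letter_sum_sum => // i j vi vj.
  have := fz i vi; have := ga j vj => /=; clear => h1 h2; split; lia.
apply: eq_letter_sum => // u; rewrite m absz_nat /swap_at.
case: u => u; rewrite !sum_eqE /=; first by case: eqP => [->|].
by rewrite subnn.
Qed.

End Value.

(* Both sides of the recursion split off the last part; the coarsenings are
   defined by splitting off the first one. *)
Section Coarsenings.
Variables (R : comNzRingType) (q : R) (V : seq nat -> R).

Variable N : nat.

(** Values are letter sums truncated at some [L], so the recursion is available for bounded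
    compositions only. *)
Let good (alpha : seq nat) : bool := is_composition alpha && (sumn alpha <= N)%N.

Hypothesis V_rec : forall alpha k l, good (alpha ++ [:: k; l]) ->
  V (alpha ++ [:: k; l]) =
  q * (V (rcons alpha k) * V [:: l]) + (1 - q) * V (rcons alpha (k + l)%N).

(** Expanding the last two parts by [V_rec] commutes with expanding the first two by induction. With
    two or three parts the ends interfere, and the identity is checked directly. *)
Lemma left_recursion alpha k l : good [:: k, l & alpha] ->
  V [:: k, l & alpha] = q * (V [:: k] * V (l :: alpha)) + (1 - q) * V ((k + l)%N :: alpha).
Proof.
have [n] := ubnP (size alpha); elim: n alpha k l => // n IH alpha k l; rewrite ltnS.
case/lastP: alpha => [_|alpha m]; first exact: (V_rec (alpha := [::])).
case/lastP: alpha => [_|alpha p].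
  rewrite /= => g.
  have e1 := @V_rec [:: k] l m; have e2 := @V_rec [::] k l; have e3 := @V_rec [::] l m.
  have e4 := @V_rec [::] k (l + m)%N; have e5 := @V_rec [::] (k + l)%N m.
  rewrite /= in e1 e2 e3 e4 e5 *; rewrite e1 // e2 ?e3 ?e4 ?e5 ?addnA; first ring;
    by move: g; rewrite /good /=; clear; lia.
rewrite !size_rcons => lt g.
have e x : rcons (rcons (x ++ alpha) p) m = (x ++ alpha) ++ [:: p; m].
  by rewrite -!cats1 -catA.
have e1 := e [:: k; l]; have e2 := e [:: l]; have e3 := e [:: (k + l)%N].
move: g; rewrite /= in e1 e2 e3 *; rewrite e1 e2 e3 => g.
have r1 := @V_rec ([:: k, l & alpha]) p m; have r2 := @V_rec (l :: alpha) p m.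
have r3 := @V_rec ((k + l)%N :: alpha) p m; rewrite /= in r1 r2 r3.
have i1 := IH (rcons alpha p) k l; have i2 := IH (rcons alpha (p + m)%N) k l.
rewrite !size_rcons in i1 i2; rewrite r1 // r2 ?r3 ?i1 ?i2 //; first ring;
  move: g; rewrite /good /is_composition /= ?all_cat ?all_rcons ?sumn_cat ?sumn_rcons /=;
  by clear; lia.
Qed.

(** A joint between adjacent parts contributes [q] if it is kept and [1 - q] if it is merged. *)
Definition coarsening_term n (beta : seq nat) : R :=
  q ^+ (size beta).-1 * (1 - q) ^+ (n - size beta) * \prod_(b <- beta) V [:: b].

Lemma coarsenings_head k l alpha :
  coarsenings ((k + l)%N :: alpha) =
  [seq (k + head 0%N beta)%N :: behead beta | beta <- coarsenings (l :: alpha)].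
Proof.
case: alpha => [|m alpha] //=; rewrite map_cat -!map_comp; congr (_ ++ _).
by apply: eq_map => beta /=; rewrite addnA.
Qed.

Lemma size_coarsening alpha beta : beta \in coarsenings alpha ->
  (size beta <= size alpha)%N /\ (alpha != [::] -> 0 < size beta)%N.
Proof.
elim: alpha beta => [|k [|l alpha] IH] beta; rewrite /= ?inE.
- by move/eqP->.
- by move/eqP->.
rewrite -/(coarsenings (l :: alpha)) mem_cat => /orP[] /mapP[b /IH[/= h1 h2] ->] /=; first by split.
split=> //; rewrite size_behead; move: h1; clear; lia.
Qed.

Lemma sum_coarsenings alpha : good alpha -> alpha != [::] ->
  V alpha = \sum_(beta <- coarsenings alpha) coarsening_term (size alpha) beta.
Proof.
have [n] := ubnP (size alpha); elim: n alpha => // n IH [//|k [|l alpha]]; rewrite ltnS => lt g _.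
  by rewrite /= big_seq1 /coarsening_term /= big_seq1 !expr0 !mul1r.
rewrite left_recursion // (IH (l :: alpha)) ?(IH ((k + l)%N :: alpha)) //; last 2 first.
- by move: g; rewrite /good /=; clear; lia.
- by move: g; rewrite /good /=; clear; lia.
rewrite coarsenings_head /= -/(coarsenings (l :: alpha)) big_cat !big_map /=.
rewrite !big_distrr /=; congr (_ + _); apply: eq_big_seq => beta.
  move=> bc; have [_ /(_ isT) b0] := @size_coarsening (l :: alpha) _ bc.
  rewrite /coarsening_term /= big_cons subSS.
  by rewrite -[size beta]prednK // exprS /=; ring.
move=> bc; have [/= b1 /(_ isT) b0] := @size_coarsening (l :: alpha) _ bc; rewrite /coarsening_term /=.
case: beta b0 b1 {bc} => //= b beta _ b1; rewrite subSS subSn // exprS; ring.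
Qed.

Lemma cM_perm alpha beta : cM alpha = cM beta ->
  perm_eq [seq sort geq b | b <- coarsenings alpha] [seq sort geq b | b <- coarsenings beta].
Proof.
by move=> e; apply/eq_seq_msetP.
Qed.

Lemma coarsenings_self alpha : alpha \in coarsenings alpha.
Proof.
elim: alpha => [|k [|l alpha] IH]; rewrite ?inE //.
by rewrite /= -/(coarsenings (l :: alpha)) mem_cat map_f.
Qed.

(** The number of parts of a composition is the largest size of its coarsenings. *)
Lemma cM_size alpha beta : cM alpha = cM beta -> size alpha = size beta.
Proof.
wlog suff le : alpha beta / cM alpha = cM beta -> (size alpha <= size beta)%N.
  by move=> e; apply/eqP; rewrite eqn_leq !le.
move/cM_perm/perm_mem/(_ (sort geq alpha)).
rewrite map_f ?coarsenings_self // => /esym/mapP[b /size_coarsening[le _] e].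
by rewrite -(size_sort geq alpha) e size_sort.
Qed.

Lemma eq_cM alpha beta : good alpha -> good beta -> alpha != [::] -> cM alpha = cM beta -> V alpha = V beta.
Proof.
move=> ga gb a0 e; have es := cM_size e; have b0 : beta != [::].
  by rewrite -size_eq0 -es size_eq0.
have step (gamma : seq nat) :
    \sum_(b <- coarsenings gamma) coarsening_term (size gamma) b =
    \sum_(b <- [seq sort geq b | b <- coarsenings gamma]) coarsening_term (size gamma) b.
  rewrite big_map; apply: eq_bigr => b _; rewrite /coarsening_term size_sort; congr (_ * _).
  by apply/esym/perm_big; rewrite perm_sort.
by rewrite !sum_coarsenings // !step es; apply: perm_big; apply: cM_perm.
Qed.

End Coarsenings.

(** * Powers of the given strip and the conclusion *)

Lemma total_near (X Y : rgraph) : total (rnear X Y) = (total X + total Y)%N.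
Proof.
rewrite /total big_sumType /= (bigD1 (dz X)) //= eqxx [X in (_ + X)%N](bigD1 (da Y)) //= eqxx.
rewrite [in RHS](bigD1 (dz X)) //= [X in _ = (_ + X)%N](bigD1 (da Y)) //=.
rewrite (eq_bigr (@vwt X)) => [|u /negPf->//].
rewrite [X in (_ + (_ + X))%N = _](eq_bigr (@vwt Y)) => [|u /negPf->//].
by clear; lia.
Qed.

Lemma total_rpow (P : rgraph) k : (0 < k)%N -> total (rpow P k) = (k * total P)%N.
Proof.
case: k => // k _; rewrite /rpow /=; elim: k => [|k IH]; first by rewrite mul1n.
by rewrite [in LHS]iterS total_near IH -mulSnr.
Qed.

Lemma total_rcomp (P : rgraph) k alpha : is_composition (k :: alpha) ->
  total (rcomp P k alpha) = (sumn (k :: alpha) * total P)%N.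
Proof.
rewrite /is_composition /= => /andP[k0]; elim/last_ind: alpha => [_|alpha l IH].
  by rewrite /= addn0 /rcomp /= total_rpow.
rewrite all_rcons => /andP[l0 al].
by rewrite /rcomp foldl_rcons total_concat -/(rcomp P k alpha) IH // total_rpow //= sumn_rcons addnA -mulnDl.
Qed.

Lemma value_rec (R : idomainType) (q : R) (L N : nat) (xs : seq R) (P : rgraph)
    (V := fun alpha => if alpha is k :: alpha' then value q L xs (rcomp P k alpha') else 0) :
    q != 0 -> (N * total P < L)%N ->
  forall alpha k l, is_composition (alpha ++ [:: k; l]) && (sumn (alpha ++ [:: k; l]) <= N)%N ->
    V (alpha ++ [:: k; l]) = q * (V (rcons alpha k) * V [:: l]) + (1 - q) * V (rcons alpha (k + l)%N).
Proof.
move=> q0 NL alpha k l; rewrite /is_composition all_cat sumn_cat /= => /andP[/and4P[al k0 l0 _] le].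
have small n : (n <= N)%N -> (n * total P < L)%N.
  by move=> nN; apply: leq_ltn_trans NL; rewrite leq_mul2r nN orbT.
have kl0 : (0 < k + l)%N by rewrite addn_gt0 k0.
rewrite addn0 in le; case: alpha al le => [|a alpha] al le /=.
  rewrite /rcomp /= value_concat ?total_rpow // -?mulnDl ?small //.
  congr (_ + _ * _); apply: (embeds_value xs q0); first exact: rpow_embeds.
  by rewrite total_rpow // small.
rewrite -cat_rcons cats1 /rcomp !foldl_rcons -/(rcomp P a alpha).
move: le; set C := rcomp P a alpha => le.
have tC : total C = (sumn (a :: alpha) * total P)%N by apply: total_rcomp.
rewrite value_concat; last first.
  by rewrite total_concat tC !total_rpow // -!mulnDl -addnA small.
congr (_ + _ * _); apply: (embeds_value xs q0); last first.
  by rewrite total_concat tC total_rpow // -mulnDl small.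
apply: embeds_trans (embeds_near_concatA _ _ _) _.
by apply: embeds_concat (embeds_refl _) _; apply: rpow_embeds.
Qed.

Lemma realizes_strip (lam : strip) (a z : 'I_(size lam)) :
  is_first_row a -> is_last_row z -> realizes (G := @DGraph (Pi lam) a z) (@offset lam).
Proof.
case/existsP=> u /andP[/eqP ua /forallP ufirst] /existsP[v /andP[/eqP vz /forallP vlast]].
have row (w : cell lam) : (0 < rsize (nrow (cellrow w)))%N.
  exact: leq_ltn_trans (leq0n _) (ltn_ord (tagged w)).
split=> /=.
- exact: alcove_offset.
- exact: wt_offset.
- by rewrite -{1}ua -vz.
- move=> j j0; have := ufirst (Tagged (fun i => 'I_(rsize (nrow i))) (Ordinal j0)).
  rewrite /reading_le /content /cellrow /offset /= -ua /cellrow.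
  move: (nat_of_ord (tagged u)) (lo _) (lo _) (nat_of_ord j) (nat_of_ord (tag u)).
  by clear; lia.
move=> j j0; have jlt : ((rsize (nrow j)).-1 < rsize (nrow j))%N by rewrite prednK.
have := vlast (Tagged (fun i => 'I_(rsize (nrow i))) (Ordinal jlt)).
have := ltn_ord (tagged v); rewrite /reading_le /content /cellrow /offset /= -vz /cellrow.
move: j0 (nat_of_ord (tagged v)) => + t; move: (lo _) (lo _) (rsize _) (rsize _) (nat_of_ord j) (nat_of_ord (tag v)).
by clear; lia.
Qed.

Lemma embedding_iso (G H : wgraph) : wg_iso G H -> exists h : G -> H, embedding h.
Proof. by case=> h [[h' hK h'K] hv he]; exists h; apply: embeddingI hK h'K hv he. Qed.

Lemma exists_strip_iso (G : wgraph) (f : G -> G -> int) : alcove f ->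
    (forall u v, u != v -> wt (@vwt G) f u v = (ewt u v)%:Z) ->
  admissible G.
Proof.
move=> Af wf; have [lam [phi [bij rp op]]] := exists_strip (@vwt G) Af.
exists lam, phi; split=> // [i|i j]; first by rewrite /= rp.
have [->|ij] := eqVneq i j; first by rewrite !ewt_irr.
have ij' : phi i != phi j by rewrite (inj_eq (bij_inj bij)).
apply/eqP; rewrite -eqz_nat -wf // -(wt_offset ij); apply/eqP.
by rewrite /wt !rp !op // eq_sym.
Qed.

Lemma embedding_admissible (G : wgraph) (X : rgraph) (h : G -> X) : embedding h -> admissible G.
Proof.
case=> ih vh eh _; have [[X0 XN XT] wX _ _ _] := rfP X.
apply: (exists_strip_iso (f := fun u v => rf (h u) (h v))).
  by split=> [u|u v uv|u v w]; [exact: X0|apply: XN; rewrite (inj_eq ih)|exact: XT].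
by move=> u v uv; rewrite -eh -wX ?(inj_eq ih) // /wt !vh.
Qed.

Lemma empty_strip (mu : strip) : wg_iso (Pi mu) empty_wgraph -> mu = [::].
Proof. by case=> h _; case: mu h => // R mu h; case: (h ord0). Qed.

Local Close Scope ring_scope.

Theorem theorem4p18 (lam : strip) (a z : 'I_(size lam))
    (ha : is_first_row a) (hz : is_last_row z) :
  let P := @DGraph (Pi lam) a z in
  (forall alpha : seq nat,
     is_composition alpha -> admissible (comp_graph alpha P)) /\
  (forall alpha beta : seq nat,
     is_composition alpha -> is_composition beta -> cM alpha = cM beta ->
     forall mu nu : strip,
       wg_iso (Pi mu) (comp_graph alpha P) ->
       wg_iso (Pi nu) (comp_graph beta P) ->
       LLT mu =1 LLT nu).
Proof.
move=> P; pose X : rgraph := @RGraph P _ (realizes_strip ha hz); split=> [[|k alpha] _|alpha beta ca cb eM mu nu].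
- by apply: (@exists_strip_iso empty_wgraph (fun _ _ => 0)); first split; case.
- by have [h Eh] := @comp_graph_embeds X k alpha; apply: (embedding_admissible Eh).
have es := cM_size eM; case: alpha ca eM es => [|k alpha] ca eM es.
  by case: beta cb eM es => // _ _ _ /empty_strip-> /empty_strip->.
case: beta cb eM es => // l beta cb eM es.
have strip_value (tau : strip) i gamma : wg_iso (Pi tau) (comp_graph (i :: gamma) P) ->
    is_composition (i :: gamma) ->
    (\sum_(i < size tau) rsize (nrow i) = sumn (i :: gamma) * total X)%N /\
    forall (R : idomainType) (q : R) L xs, (q != 0)%R ->
      (\sum_(i < size tau) rsize (nrow i) < L)%N ->
      letter_sum q L (@offset tau) xs (fun i => rsize (nrow i)) = value q L xs (rcomp X i gamma).
  move=> /embedding_iso[h1 E1] cg; have [h2 E2] := @comp_graph_embeds X i gamma.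
  have E := embedding_comp E1 E2; have t := embedding_total E.
  split=> [|R q L xs q0 tL]; first by rewrite -(total_rcomp X cg).
  by apply: (embedding_value xs q0 E (@alcove_offset tau) (@wt_offset tau)); rewrite -t.
move=> /strip_value/(_ ca)[tm vm] /strip_value/(_ cb)[tn vn].
apply: eq_LLT => R q L xs q0 mL nL; rewrite vm // vn //.
pose N := maxn (sumn (k :: alpha)) (sumn (l :: beta)).
have NL : (N * total X < L)%N by rewrite /N maxnMl gtn_max -tm -tn mL.
apply: (eq_cM (value_rec xs q0 NL) _ _ _ eM) => //.
  by rewrite ca leq_maxl.
by rewrite cb leq_maxr.
Qed.
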